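(* Let $1<p<3$, let $q,s$ satisfy $$\max\left\{1,\frac{3p}{5p-3}\right\}<q<3,\qquad \max\left\{1,\frac{(q^*-1)p}{q^*}\right\}<s<\frac{(q^*-1)p^*}{q^*},$$ where $p^*=\frac{3p}{3-p}$ and $q^*=\frac{3q}{3-q}$, and let $p<r<p^*$ and $\lambda>0$. For $u\in W^{1,p}(\mathbb{R}^3)$ let $\phi_u\in D^{1,q}(\mathbb{R}^3)$ be the unique solution of $-\Delta_q\phi=|u|^s$, and define $$\mathcal{J}(u)=\frac1p\int_{\mathbb{R}^3}\left(|\nabla u|^p+|u|^p\right)dx+\frac{\lambda(q-1)}{qs}\int_{\mathbb{R}^3}\phi_u|u|^s\,dx-\frac1r\int_{\mathbb{R}^3}|u|^r\,dx .$$ Let $(u,\phi)\in W^{1,p}(\mathbb{R}^3)\times D^{1,q}(\mathbb{R}^3)$. Then $(u,\phi)$ is a solution of $$\begin{cases}-\Delta_p u+|u|^{p-2}u+\lambda\phi |u|^{s-2}u=|u|^{r-2}u & \text{in }\mathbb{R}^3,\\ -\Delta_q\phi=|u|^s & \text{in }\mathbb{R}^3\end{cases}$$ if and only if $u$ is a critical point of $\mathcal{J}$ and $\phi=\phi_u$.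
   Context: All functions are real-valued. $\Delta_i u=\operatorname{div}(|\nabla u|^{i-2}\nabla u)$ for $i=p,q$. $W^{1,p}(\mathbb{R}^3)$ has the norm $\|u\|=\left(\int_{\mathbb{R}^3}(|\nabla u|^p+|u|^p)\,dx\right)^{1/p}$. $D^{1,q}(\mathbb{R}^3)$ is the completion of $C_0^\infty(\mathbb{R}^3)$ with respect to the norm $\|u\|_{D^{1,q}}=\left(\int_{\mathbb{R}^3}|\nabla u|^q\,dx\right)^{1/q}$; by the Sobolev inequality it is regarded as a space of functions in $L^{q^*}(\mathbb{R}^3)$. Under the stated conditions, $-\Delta_q\phi=|u|^s$ has exactly one weak solution $\phi_u\in D^{1,q}(\mathbb{R}^3)$ for each $u\in W^{1,p}(\mathbb{R}^3)$, and $\mathcal{J}\in C^1(W^{1,p}(\mathbb{R}^3),\mathbb{R})$; a critical point is $u$ with $\mathcal{J}'(u)=0$. A solution of the system is a weak solution: for all $v\in W^{1,p}(\mathbb{R}^3)$ and $w\in D^{1,q}(\mathbb{R}^3)$, $$\int_{\mathbb{R}^3}\left(|\nabla u|^{p-2}\nabla u\cdot\nabla v+|u|^{p-2}uv\right)dx+\lambda\int_{\mathbb{R}^3}\phi|u|^{s-2}uv\,dx=\int_{\mathbb{R}^3}|u|^{r-2}uv\,dx,$$ $$\int_{\mathbb{R}^3}|\nabla\phi|^{q-2}\nabla\phi\cdot\nabla w\,dx=\int_{\mathbb{R}^3}|u|^sw\,dx.$$ Expressions such as $|u|^{s-2}u$ or $|\nabla u|^{p-2}\nabla u$ are understood as $0$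 where $u=0$, respectively $\nabla u=0$. *)

(* Defs.v *)
From HB Require Import structures.
From mathcomp Require Import all_boot all_order all_algebra.
From mathcomp Require Import all_classical all_reals all_analysis.

Set Implicit Arguments.
Unset Strict Implicit.
Unset Printing Implicit Defensive.
Import Order.TTheory GRing.Theory Num.Theory.
Import numFieldNormedType.Exports.

Local Open Scope classical_set_scope.
Local Open Scope ring_scope.

(* R^3 is the iterated product R * R * R, which carries both the product
   normed-module structure and the product sigma-algebra. *)
Notation R3 R := (R * R * R)%type.

(* Real powers are `^, for which 0 `^ a = 0 when a != 0 and 0 `^ 0 = 1; in
   particular |t|^{a-2} t and |xi|^{a-2} xi vanish at 0 for every a. *)

Lemma sigma_finite_prod d1 d2 (T1 : measurableType d1) (T2 : measurableType d2)
    (R : realType) (m1 : {sigma_finite_measure set T1 -> \bar R})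
    (m2 : {sigma_finite_measure set T2 -> \bar R}) :
  sigma_finite setT (m1 \x m2)%E.
Proof.
have /sigma_finiteP[F [TF ndF Foo]] := sigma_finiteT m1.
have /sigma_finiteP[G [TG ndG Goo]] := sigma_finiteT m2.
exists (fun n => F n `*` G n).
  rewrite -setXTT TF TG predeqE => -[x y]; split.
    move=> [/= [n _ Fnx] [k _ Gky]]; exists (maxn n k) => //; split.
    - by move: x Fnx; exact/subsetPset/ndF/leq_maxl.
    - by move: y Gky; exact/subsetPset/ndG/leq_maxr.
  by move=> [n _ []/= ? ?]; split; exists n.
move=> k; have [? ?] := Foo k; have [? ?] := Goo k.
split; first exact: measurableX.
by rewrite product_measure1E// lte_mul_pinfty// ge0_fin_numE.
Qed.

(* The canonical sigma-finite structure of a product measure is shadowed by that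
   of products of subprobabilities, so it is declared on named constants. *)
Section Lebesgue.
Variable R : realType.

Definition leb2 := (@lebesgue_measure R \x @lebesgue_measure R)%E.
HB.instance Definition _ := Measure.on leb2.
HB.instance Definition _ :=
  Measure_isSigmaFinite.Build _ _ _ leb2 (sigma_finite_prod _ _).

Definition leb3 := (leb2 \x @lebesgue_measure R)%E.
HB.instance Definition _ := Measure.on leb3.
HB.instance Definition _ :=
  Measure_isSigmaFinite.Build _ _ _ leb3 (sigma_finite_prod _ _).

End Lebesgue.

Arguments leb2 {R}.
Arguments leb3 {R}.

Section SobolevSpaces.
Variable R : realType.
Implicit Types (u v g : R3 R -> R) (i : 'I_3) (p q : R).

Definition basis3 i : R3 R :=
  ((val i == 0%N)%:R, (val i == 1%N)%:R, (val i == 2%N)%:R).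

Definition partial i u : R3 R -> R := fun x => 'D_(basis3 i) u x.

Fixpoint Ck (k : nat) u : Prop :=
  if k is k'.+1 then
    [/\ continuous u, (forall i x, derivable u x (basis3 i))
      & forall i, Ck k' (partial i u)]
  else continuous u.

Definition test_function u : Prop :=
  (forall k, Ck k u) /\ compact (closure [set x | u x != 0]).

Definition loc_integrable u : Prop :=
  measurable_fun [set: R3 (measurableTypeR R)] u /\
  forall K : set (R3 R), compact K -> leb3.-integrable K (EFin \o u).

Definition is_weak_partial i u g : Prop :=
  [/\ loc_integrable u, loc_integrable g &
    forall eta, test_function eta ->
      \int[leb3]_x (u x * partial i eta x) = - \int[leb3]_x (g x * eta x)].

(* Weak partial derivatives are unique up to null sets; a representative is
   chosen here (0 if there is none). *)
Definition wpartial i u : R3 R -> R := xget (cst 0) [set g | is_weak_partial i u g].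

Definition grad_norm u : R3 R -> R :=
  fun x => Num.sqrt (\sum_(i < 3) wpartial i u x ^+ 2).

Definition grad_dot u v : R3 R -> R :=
  fun x => \sum_(i < 3) wpartial i u x * wpartial i v x.

Definition weak_grad_in p u : Prop :=
  forall i, exists2 g, g \in Lfun leb3 p%:E & is_weak_partial i u g.

Definition W1 p u : Prop := u \in Lfun leb3 p%:E /\ weak_grad_in p u.

Definition W1norm p u : R :=
  (\int[leb3]_x (grad_norm u x `^ p + `|u x| `^ p)) `^ p^-1.

Definition sobolev_conj q : R := 3 * q / (3 - q).

(* The completion of the test functions for |grad u|_q, realized in L^{q*}
   through the Sobolev inequality: a function is the L^{q*} limit of test
   functions whose gradients converge in L^q to its weak gradient. *)
Definition D1 q u : Prop :=
  [/\ u \in Lfun leb3 (sobolev_conj q)%:E, weak_grad_in q u &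
    exists eta : nat -> R3 R -> R,
      [/\ forall n, test_function (eta n),
          ('N[leb3]_(q%:E)[EFin \o grad_norm (eta n \- u)%R])%E @[n --> \oo] --> 0%E &
          ('N[leb3]_((sobolev_conj q)%:E)[EFin \o (eta n \- u)%R])%E @[n --> \oo] --> 0%E]].

(* L is the Frechet derivative at u of the functional J on W^{1,p}. *)
Definition is_frechet_derivative p (J : (R3 R -> R) -> R) u
    (L : (R3 R -> R) -> R) : Prop :=
  [/\ forall (a : R) v w, W1 p v -> W1 p w ->
        L (fun x => a * v x + w x) = a * L v + L w,
      exists C : R, forall v, W1 p v -> `|L v| <= C * W1norm p v &
      forall eps : R, 0 < eps -> exists2 delta : R, 0 < delta &
        forall v, W1 p v -> W1norm p v < delta ->
          `|J (u \+ v) - J u - L v| <= eps * W1norm p v].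

Definition critical_point p (J : (R3 R -> R) -> R) u : Prop :=
  W1 p u /\ is_frechet_derivative p J u (fun=> 0).

End SobolevSpaces.

Section System.
Variable R : realType.
Implicit Types (u v w phi : R3 R -> R) (p q s r lambda : R).

(* Weak form of - Delta_q phi = |u|^s. *)
Definition poisson_weak q s u phi : Prop :=
  forall w, D1 q w ->
    \int[leb3]_x (grad_norm phi x `^ (q - 2) * grad_dot phi w x) =
    \int[leb3]_x (`|u x| `^ s * w x).

(* Weak form of
   - Delta_p u + |u|^{p-2} u + lambda phi |u|^{s-2} u = |u|^{r-2} u. *)
Definition schrodinger_weak p s r lambda u phi : Prop :=
  forall v, W1 p v ->
    \int[leb3]_x (grad_norm u x `^ (p - 2) * grad_dot u v x
                  + `|u x| `^ (p - 2) * u x * v x)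
    + lambda * \int[leb3]_x (phi x * `|u x| `^ (s - 2) * u x * v x) =
    \int[leb3]_x (`|u x| `^ (r - 2) * u x * v x).

Definition system_solution p q s r lambda u phi : Prop :=
  [/\ W1 p u, D1 q phi, schrodinger_weak p s r lambda u phi
    & poisson_weak q s u phi].

(* The weak solution phi_u in D^{1,q}, by definite description (up to the
   choice of a representative). *)
Definition phi_sol q s u : R3 R -> R :=
  xget (cst 0) [set phi | D1 q phi /\ poisson_weak q s u phi].

Definition energy p q s r lambda u : R :=
  p^-1 * \int[leb3]_x (grad_norm u x `^ p + `|u x| `^ p)
  + lambda * (q - 1) / (q * s) * \int[leb3]_x (phi_sol q s u x * `|u x| `^ s)
  - r^-1 * \int[leb3]_x (`|u x| `^ r).

End System.

(* Main.v *)
(* The parameter ranges make sigma = s (q-star)', where (q-star)' is conjugate to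
   q-star, lie strictly between p and p-star, so |u|^s lies in the dual of D^{1,q}
   by the Sobolev inequality (obtained here from weak differences along lines and
   the Loomis-Whitney inequality).  The solution phi_u minimizes
   E_f(w) = |grad w|_q^q / q - \int f w with f = |u|^s, and Bregman-distance
   estimates give existence, uniqueness and continuity of f |-> phi_f.
   The value A(f) = (1 - 1/q) \int f phi_f = - min E_f satisfies the envelope bound
     0 <= A(g) - A(f) - \int (g - f) phi_f <= \int (g - f) (phi_g - phi_f),
   so A is differentiable with derivative phi_f and the nonlocal term of the energy
   has derivative lambda \int phi_u |u|^{s-2} u v, although phi_u need not depend
   differentiably on u.  Critical points are therefore exactly the u solving the
   first equation with phi = phi_u. *)
Require Import Defs.
From HB Require Import structures.
From mathcomp Require Import all_boot all_order all_algebra.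
From mathcomp Require Import all_classical all_reals all_analysis.
From mathcomp Require Import measurable_realfun ring lra.
Set Implicit Arguments.
Unset Strict Implicit.
Unset Printing Implicit Defensive.
Import Order.TTheory GRing.Theory Num.Theory.
Import numFieldNormedType.Exports.
Local Open Scope classical_set_scope.
Local Open Scope ring_scope.

(** * Powers of norms *)

Section Powers.
Variable R : realType.
Implicit Types a b c p q d h eps : R.

(** The two basic pointwise estimates therefore carry a free parameter: a Taylor error eps |x|^(p-1)
    |y| + C |y|^p, and a coercivity bound of |x - y|^p by eps |y|^p plus C times the Bregman
    distance, with C depending on eps and p alone. Integrated, they give little-o statements and
    strong convergence, with no rate. Strong convergence of minimizing sequences, read off from the
    energy at midpoints, replaces weak compactness. It also fits [D1], which asks for strong
    approximation by test functions. The envelope bound reflects that A is a supremum of affine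
    functions f |-> -E_f(w): both of its gaps are Bregman distances between grad phi_f and grad
    phi_g, hence nonnegative. The Sobolev inequality is proved for u itself and not by density,
    since [W1] is defined by weak gradients without approximating test functions; truncating u at a
    level M keeps finite the norm that is divided out at the end. *)

Lemma powR_linear_approx c eps : 0 < eps ->
  exists2 d : R, 0 < d < 1 &
    forall h, `|h| <= d -> `|(1 + h) `^ c - 1 - c * h| <= eps * `|h|.
Proof.
move=> e0.
have [dc ec] := is_derive1_powR c (@ltr01 R).
move: ec; rewrite powR1 mulr1 => ec.
have : (fun h : R => h^-1 *: ((h *: (1:R) + 1) `^ c - 1 `^ c)) @ 0^' --> c.
  by rewrite -[X in _ --> X]ec; exact: dc.
move=> /cvgrPdist_lt /(_ _ e0) /nbhs_ballP[e /= e_gt0 H].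
exists (Num.min (e / 2) (2^-1)) => [|h].
  by rewrite lt_min divr_gt0//= invr_gt0 ltr0n/= gt_min invf_lt1 ?ltr1n ?orbT.
rewrite le_min => /andP[he _].
have [->|h0] := eqVneq h 0.
  by rewrite addr0 powR1 mulr0 subrr subr0 normr0 mulr0.
have /= := H h; rewrite /ball/= sub0r normrN powR1 => /(_ _ h0) H1.
have {H1} : `|c - h^-1 * ((h * 1 + 1) `^ c - 1)| < eps.
  by apply: H1; rewrite (le_lt_trans he)// gtr_pMr// invf_lt1 ?ltr1n.
rewrite mulr1 (addrC h) => H1.
have -> : (1 + h) `^ c - 1 - c * h = - h * (c - h^-1 * ((1 + h) `^ c - 1)) by field.
by rewrite normrM normrN mulrC ler_wpM2r// ltW.
Qed.

Lemma young_le a b p : 0 <= a -> 0 <= b -> 1 < p ->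
  p * (a `^ (p - 1) * b) <= b `^ p + (p - 1) * a `^ p.
Proof.
move=> a0 b0 p1; have p0 : 0 < p by lra.
have q0 : 0 < p / (p - 1) by rewrite divr_gt0//; lra.
have pq : p^-1 + (p / (p - 1))^-1 = 1 by field; lra.
have := conjugate_powR b0 (powR_ge0 a (p - 1)) p0 q0 pq.
rewrite -powRrM mulrCA divff ?mulr1; last lra.
move=> H; have -> : b `^ p + (p - 1) * a `^ p = p * (b `^ p / p + a `^ p / (p / (p - 1))).
  by field; lra.
by rewrite ler_pM2l// mulrC.
Qed.

Lemma powR_sub_le a b p : 0 <= a -> 0 <= b -> 1 < p ->
  a `^ p - b `^ p <= p * a `^ (p - 1) * (a - b).
Proof.
move=> a0 b0 p1; have := young_le a0 b0 p1.
have : a * a `^ (p - 1) = a `^ p by rewrite mulr_powRB1//; lra.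
by nra.
Qed.

(* Testing Young's inequality for [t] against [1 + k] and [1 - k] with [k]
   small bounds its deficit below by a multiple of [|t - 1| - d / 2]. *)
Lemma young_strict p d : 1 < p -> 0 < d ->
  exists2 c : R, 0 < c &
    forall t : R, 0 <= t -> d <= `|t - 1| -> c <= t `^ p / p + (1 - p^-1) - t.
Proof.
move=> p1 d0; have p0 : 0 < p by lra.
pose q := p / (p - 1).
have q0 : 0 < q by rewrite divr_gt0//; lra.
have pq : p^-1 + q^-1 = 1 by rewrite /q; field; lra.
have [k /andP[k0 k1] H] := @powR_linear_approx q (d / 2 * q) (mulr_gt0 (divr_gt0 d0 (ltr0n _ 2)) q0).
exists (k * (d / 2)); first by rewrite !mulr_gt0// divr_gt0.
move=> t t0 td.
have pE : 1 - p^-1 = q^-1 by rewrite -pq addrC addKr.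
have Hk s : `|s| = k -> (t - 1) * s - k * (d / 2) <= t `^ p / p + (1 - p^-1) - t.
  move=> sk; have s1 : 0 <= 1 + s.
    by move: k1; rewrite -sk ltr_norml => /andP[]; lra.
  have := conjugate_powR t0 s1 p0 q0 pq.
  have := H s; rewrite sk lexx => /(_ isT); rewrite ler_norml => /andP[_].
  rewrite pE; set A := (1 + s) `^ q => hA hB.
  have : A / q <= q^-1 + s + k * (d / 2).
    rewrite ler_pdivrMr//.
    have -> : (q^-1 + s + k * (d / 2)) * q = 1 + q * s + d / 2 * q * k.
      by field; rewrite gt_eqF.
    lra.
  by move: hB; lra.
have := Hk k; have := Hk (- k); rewrite normrN gtr0_norm// => /(_ erefl) h1 /(_ erefl) h2.

have [t1|t1] := leP 1 t.
  by move: td; rewrite ger0_norm ?subr_ge0// => td; nra.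
by move: td; rewrite ltr0_norm ?subr_lt0// => td; nra.
Qed.

Section Vectors.
Variable n : nat.
Implicit Types x y : 'I_n -> R.

(** Vectors are functions on ['I_n], so that weak gradients (n = 3) and scalar functions (n = 1)
    share the estimates of this section. *)
Definition dotv x y : R := \sum_(i < n) x i * y i.
Definition normv x : R := Num.sqrt (\sum_(i < n) x i ^+ 2).

Lemma normv_ge0 x : 0 <= normv x. Proof. exact: sqrtr_ge0. Qed.

Lemma sqr_normv x : normv x ^+ 2 = \sum_(i < n) x i ^+ 2.
Proof. by rewrite sqr_sqrtr// sumr_ge0// => i _; rewrite sqr_ge0. Qed.

Lemma dotvC x y : dotv x y = dotv y x.
Proof. by apply: eq_bigr => i _; rewrite mulrC. Qed.

Lemma dotvDr x y z : dotv x (y \+ z) = dotv x y + dotv x z.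
Proof. by rewrite -big_split; apply: eq_bigr => i _; rewrite /= mulrDr. Qed.

Lemma dotvZr x t y : dotv x (fun i => t * y i) = t * dotv x y.
Proof. by rewrite /dotv mulr_sumr; apply: eq_bigr => i _; rewrite mulrCA. Qed.

Lemma dotvv x : dotv x x = normv x ^+ 2.
Proof. by rewrite sqr_normv; apply: eq_bigr => i _; rewrite expr2. Qed.

Lemma sqr_normvD x y :
  normv (x \+ y) ^+ 2 = normv x ^+ 2 + 2 * dotv x y + normv y ^+ 2.
Proof.
rewrite !sqr_normv /dotv mulr_sumr -!big_split/=.
by apply: eq_bigr => i _; ring.
Qed.

Lemma sqr_normvB x y :
  normv (x \- y) ^+ 2 = normv x ^+ 2 - 2 * dotv x y + normv y ^+ 2.
Proof.
rewrite !sqr_normv /dotv mulr_sumr -sumrB -!big_split/=.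
by apply: eq_bigr => i _; ring.
Qed.

Lemma normvZ t x : normv (fun i => t * x i) = `|t| * normv x.
Proof.
rewrite /normv -sqrtr_sqr -sqrtrM ?sqr_ge0// mulr_sumr.
by congr Num.sqrt; apply: eq_bigr => i _; rewrite exprMn.
Qed.

Lemma le_normv_coord x i : `|x i| <= normv x.
Proof.
rewrite -(ler_pXn2r (n := 2)) ?nnegrE ?normv_ge0//.
rewrite sqr_normv real_normK ?num_real// (bigD1 i)//= lerDl.
by apply: sumr_ge0 => j _; exact: sqr_ge0.
Qed.

Lemma normv_eq0 x : normv x = 0 -> forall i, x i = 0.
Proof.
move=> x0 i; apply/eqP; rewrite -normr_eq0 eq_le normr_ge0 andbT -x0.
exact: le_normv_coord.
Qed.

Lemma dotv_le x y : `|dotv x y| <= normv x * normv y.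
Proof.
have [y0|y0] := eqVneq (normv y) 0.
  by rewrite y0 mulr0 /dotv big1 ?normr0// => i _; rewrite (normv_eq0 y0) mulr0.
rewrite -(ler_pXn2r (n := 2)) ?nnegrE ?mulr_ge0 ?normv_ge0//.
rewrite real_normK ?num_real// exprMn.
have yp : 0 < normv y ^+ 2 by rewrite exprn_even_gt0.
rewrite -subr_ge0 -(pmulr_rge0 _ yp).
(* With b = |y|^2 and c = x.y this sum of squares is |y|^2 times the deficit in the inequality. *)
have E (b c : R) : b ^+ 2 * \sum_(i < n) x i ^+ 2 - 2 * b * c * dotv x y
    + c ^+ 2 * \sum_(i < n) y i ^+ 2 = \sum_(i < n) (b * x i - c * y i) ^+ 2.
  rewrite /dotv !mulr_sumr -sumrB -big_split/=.
  by apply: eq_bigr => i _; ring.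
have := sumr_ge0 (index_enum 'I_n) (fun i (_ : true) => sqr_ge0 (normv y ^+ 2 * x i - dotv x y * y i)).
by rewrite -E -!sqr_normv; lra.
Qed.

Lemma normvD_le x y : normv (x \+ y) <= normv x + normv y.
Proof.
rewrite -(ler_pXn2r (n := 2)) ?nnegrE ?addr_ge0 ?normv_ge0//.
rewrite sqr_normvD sqrrD lerD2r lerD2l -[leRHS]mulr_natl ler_pM2l//.
by have := dotv_le x y; rewrite ler_norml => /andP[].
Qed.

Lemma normvN x : normv (fun i => - x i) = normv x.
Proof. by congr Num.sqrt; apply: eq_bigr => i _; rewrite sqrrN. Qed.

Lemma powR_add_le a b p : 0 <= a -> 0 <= b -> 0 < p ->
  (a + b) `^ p <= 2 `^ p * (a `^ p + b `^ p).
Proof.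
move=> a0 b0 p0.
wlog ab : a b a0 b0 / a <= b.
  move=> H; have [/H|/ltW/H] := leP a b; first exact.
  by rewrite addrC (addrC (b `^ p)); exact.
apply: (@le_trans _ _ ((2 * b) `^ p)).
  by rewrite ge0_ler_powR ?nnegrE ?addr_ge0 ?mulr_ge0 ?(ltW p0)//; lra.
by rewrite powRM// ler_wpM2l ?powR_ge0// lerDr powR_ge0.
Qed.

Lemma sqrt_powR a p : 0 <= a -> (a ^+ 2) `^ (p / 2) = a `^ p.
Proof.
by move=> a0; rewrite -powR_mulrn// -powRrM mulrCA divff ?pnatr_eq0// mulr1.
Qed.

(* Where [normv y] is small against [normv x], expand [t `^ (p / 2)] at
   [normv (x + y) ^+ 2 / normv x ^+ 2]. *)
Lemma normv_powR_taylor p eps : 1 < p -> 0 < eps ->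
  exists2 C : R, 0 < C & forall x y,
    `|normv (x \+ y) `^ p - normv x `^ p - p * (normv x `^ (p - 2) * dotv x y)|
    <= eps * (normv x `^ (p - 1) * normv y) + C * normv y `^ p.
Proof.
move=> p1 e0; have p0 : 0 < p by lra.
have e3 : 0 < eps / 6 by rewrite divr_gt0.
have [d /andP[d0 d1] H] := @powR_linear_approx (p / 2) (eps / 6) e3.
(* For |y| < k |x|, the bound d / 3 keeps the increment h of |x + y|^2 / |x|^2 within d, and eps / p
   makes the quadratic term cost at most half of eps. The linear remainder, eps / 6 times |h| <= 3
   |y| / |x|, costs the other half. *)
pose k := Num.min (d / 3) (eps / p).
have k0 : 0 < k by rewrite lt_min !divr_gt0.
(* For |y| >= k |x| nothing cancels: each of the three terms is at most a constant times |y|^p, and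
   [C] adds up these constants. *)
pose C := (k^-1 + 1) `^ p + k^-1 `^ p + p * k^-1 `^ (p - 1).
have C0 : 0 < C.
  by rewrite !addr_gt0// ?mulr_gt0 ?powR_gt0 ?addr_gt0 ?invr_gt0.
exists C => // x y.
have dxy := dotv_le x y.
have a0 := normv_ge0 x; have b0 := normv_ge0 y.
have [|bk] := leP (k * normv x) (normv y).
  rewrite mulrC -ler_pdivlMr// mulrC => ab.
  apply: (@le_trans _ _ (C * normv y `^ p)); last first.
    by rewrite lerDr !mulr_ge0 ?powR_ge0// ltW.
  have h1 : normv (x \+ y) `^ p <= (k^-1 + 1) `^ p * normv y `^ p.
    rewrite -powRM ?addr_ge0 ?invr_ge0 ?(ltW k0)// ge0_ler_powR ?nnegrE ?normv_ge0 ?(ltW p0)//.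
      by rewrite mulr_ge0 ?addr_ge0 ?invr_ge0 ?(ltW k0).
    by rewrite mulrDl mul1r (le_trans (normvD_le _ _))// lerD2r.
  have h2 : normv x `^ p <= k^-1 `^ p * normv y `^ p.
    rewrite -powRM ?invr_ge0 ?(ltW k0)// ge0_ler_powR ?nnegrE ?(ltW p0)//.
    by rewrite mulr_ge0 ?invr_ge0 ?(ltW k0).
  have h3 : `|normv x `^ (p - 2) * dotv x y| <= k^-1 `^ (p - 1) * normv y `^ p.
    rewrite normrM (ger0_norm (powR_ge0 _ _)).
    apply: (@le_trans _ _ (normv x `^ (p - 1) * normv y)).
      have [x0|x0] := eqVneq (normv x) 0.
        have : `|dotv x y| <= 0 by rewrite (le_trans dxy)// x0 mul0r.
        rewrite normr_le0 => /eqP ->.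
        by rewrite normr0 mulr0 mulr_ge0 ?powR_ge0.
      have -> : normv x `^ (p - 1) = normv x `^ (p - 2) * normv x.
        rewrite -{3}(powRr1 a0) -powRD ?x0 ?implybT//; congr (_ `^ _); lra.
      by rewrite -mulrA ler_wpM2l ?powR_ge0.
    rewrite -(@mulr_powRB1 _ (normv y))// mulrCA mulrC ler_wpM2l//.
    rewrite -powRM ?invr_ge0 ?(ltW k0)// ge0_ler_powR ?nnegrE//; first lra.
    by rewrite mulr_ge0 ?invr_ge0 ?(ltW k0).
  rewrite -addrA (le_trans (ler_normD _ _))// ger0_norm ?powR_ge0//.
  rewrite -opprD normrN (le_trans (lerD (lexx _) (ler_normD _ _)))//.
  rewrite (ger0_norm (powR_ge0 _ _)) normrM (gtr0_norm p0).
  have := ler_wpM2l (ltW p0) h3.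
  by rewrite /C; lra.
have x0 : 0 < normv x by move: bk; have := k0; nra.
apply: (@le_trans _ _ (eps * (normv x `^ (p - 1) * normv y))); last first.
  by rewrite lerDl mulr_ge0 ?powR_ge0// ltW.
set a := normv x in a0 x0 bk dxy *; set b := normv y in b0 bk dxy *.
set c := dotv x y in dxy *.
pose h := (2 * c + b ^+ 2) / a ^+ 2.
have ba : b <= d / 3 * a.
  by rewrite ltW// (lt_le_trans bk)// ler_wpM2r// /k ge_min lexx.
have ba' : b <= eps / p * a.
  by rewrite ltW// (lt_le_trans bk)// ler_wpM2r// /k ge_min lexx orbT.
have a2 : 0 < a ^+ 2 by rewrite exprn_gt0.
have hb : `|h| <= 3 * (b / a).
  rewrite normrM (gtr0_norm (x := (a ^+ 2)^-1)) ?invr_gt0// ler_pdivrMr//.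
  have -> : 3 * (b / a) * a ^+ 2 = 3 * (a * b) by field; rewrite gt_eqF.
  rewrite (le_trans (ler_normD _ _))// normrM (ger0_norm (x := 2))//.
  rewrite (ger0_norm (sqr_ge0 b)).
  have : b ^+ 2 <= a * b by rewrite expr2 ler_wpM2r// (le_trans ba)//; nra.
  lra.
have hd : `|h| <= d.
  rewrite (le_trans hb)// mulrA ler_pdivrMr//; lra.
have := H _ hd.
have -> : 1 + h = (normv (x \+ y) ^+ 2) / a ^+ 2.
  by rewrite sqr_normvD -/a -/b -/c /h; field; rewrite gt_eqF.
rewrite powRM ?sqr_ge0 ?invr_ge0 ?sqr_ge0// sqrt_powR ?normv_ge0//.
rewrite -[(a ^+ 2)^-1]exprVn sqrt_powR ?invr_ge0//.
set N := normv (x \+ y) `^ p => HN.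
have ap : 0 < a `^ p by rewrite powR_gt0.
have aV : a^-1 `^ p = (a `^ p)^-1.
  by rewrite -powR_inv1// -powRrM mulrC powRrM powR_inv1// powR_ge0.
have a1E : a `^ (p - 1) = a `^ p / a.
  by rewrite powRB ?(gt_eqF x0) ?implybT// powRr1.
have a2E : a `^ (p - 2) = a `^ p / a ^+ 2.
  by rewrite powRB ?(gt_eqF x0) ?implybT// powR_mulrn.
have -> : N - a `^ p - p * (a `^ (p - 2) * c) =
    a `^ p * ((N * a^-1 `^ p - 1 - p / 2 * h) + p / 2 * (b / a) ^+ 2).
  by rewrite aV a2E /h; field; rewrite !gt_eqF.
rewrite normrM (gtr0_norm ap) a1E.
have -> : eps * (a `^ p / a * b) = a `^ p * (eps * (b / a)) by field; rewrite gt_eqF.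
rewrite ler_pM2l//.
rewrite (le_trans (ler_normD _ _))//.
have ba0 : 0 <= b / a by rewrite divr_ge0.
have h2 : `|p / 2 * (b / a) ^+ 2| <= eps / 2 * (b / a).
  have : b / a <= eps / p by rewrite ler_pdivrMr.
  rewrite ler_pdivlMr// ger0_norm; last by rewrite mulr_ge0 ?sqr_ge0 ?divr_ge0//; lra.
  by move: (b / a) ba0 => B B0; nra.
have h3 := le_trans HN (ler_wpM2l (ltW e3) hb).
rewrite (le_trans (lerD h3 h2))//; move: (b / a) => B; lra.
Qed.


(* The Bregman distance of [t |-> |t|^p / p]. *)
Definition bregman p x y : R :=
  normv x `^ p / p + (1 - p^-1) * normv y `^ p - normv y `^ (p - 2) * dotv y x.

(** By homogeneity, for y nonzero only t = |x| / |y| and k = x.y / |y|^2 matter, and the distance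
    becomes t^p / p + 1 - 1/p - k. For t >= T it dominates t^p. For t < T, either |x - y|^p <= eps
    |y|^p, or t is far from 1, or k is far from t; the last two cases bound the distance below by
    [c1], while |x - y|^p is at most (T + 1)^p |y|^p. *)
Lemma bregman_powR p eps : 1 < p -> 0 < eps ->
  exists2 C : R, 0 < C & forall x y,
    normv (x \- y) `^ p <= eps * normv y `^ p + C * bregman p x y.
Proof.
move=> p1 e0; have p0 : 0 < p by lra.
(* In the scaling |y| = 1, |x - y|^p > eps reads (t - 1)^2 + 2 (t - k) > 2 d^2, so one of the two
   summands is at least d^2. *)
pose d : R := Num.sqrt (eps `^ (2 / p) / 2).
have ep0 : 0 < eps `^ (2 / p) by rewrite powR_gt0.
have d0 : 0 < d by rewrite sqrtr_gt0 divr_gt0.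
have d2 : 2 * d ^+ 2 = eps `^ (2 / p).
  by rewrite sqr_sqrtr ?divr_ge0 ?(ltW ep0)//; lra.
have [c c0 Hc] := young_strict p1 d0.
(* T solves T^(p-1) = 2p. Beyond it t <= t^p / (2p), so subtracting k <= t leaves at least half of
   t^p / p. *)
pose T := (2 * p) `^ (p - 1)^-1.
have T1 : 1 <= T.
  have -> : 1 = 1 `^ (p - 1)^-1 :> R by rewrite powR1.
  by rewrite ge0_ler_powR ?nnegrE ?invr_ge0//; lra.
have TP t : T <= t -> t <= t `^ p / (2 * p).
  move=> tT; rewrite ler_pdivlMr; last lra.
  have t0 : 0 <= t by lra.
  rewrite -(mulr_powRB1 t0 p0) ler_wpM2l//.
  have -> : 2 * p = T `^ (p - 1) by rewrite -powRrM mulVf ?powRr1//; lra.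
  by rewrite ge0_ler_powR ?nnegrE//; lra.
pose c1 := Num.min c (d ^+ 2 / 2).
have c10 : 0 < c1 by rewrite lt_min c0 divr_gt0 ?exprn_gt0.
pose C := (T + 1) `^ p / c1 + 2 `^ p * (2 * p).
have C0 : 0 < C.
  rewrite addr_gt0// ?divr_gt0 ?mulr_gt0 ?powR_gt0//; lra.
have young t : 0 <= t -> 0 <= t `^ p / p + (1 - p^-1) - t.
  move=> t0; have [tle|] := leP d `|t - 1|; first by rewrite (le_trans _ (Hc _ t0 tle))// ltW.
  have := @young_le 1 t p ler01 t0 p1; rewrite !powR1 mul1r mulr1 => h _.
  rewrite -(pmulr_rge0 _ p0).
  have -> : p * (t `^ p / p + (1 - p^-1) - t) = t `^ p + p - 1 - p * t by field; lra.
  lra.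
have key t k : 0 <= t -> k <= t -> - t <= k ->
    (t ^+ 2 + 1 - 2 * k) `^ (p / 2) <= eps + C * (t `^ p / p + (1 - p^-1) - k).
  move=> t0 kt tk.
  have le1 : t ^+ 2 + 1 - 2 * k <= (t + 1) ^+ 2 by rewrite sqrrD expr1n; lra.
  have ge0 : 0 <= t ^+ 2 + 1 - 2 * k by have := sqr_ge0 (t - 1); rewrite sqrrB; lra.
  have le2 : (t ^+ 2 + 1 - 2 * k) `^ (p / 2) <= (t + 1) `^ p.
    rewrite -[leRHS]sqrt_powR ?addr_ge0// ge0_ler_powR ?nnegrE ?sqr_ge0 ?divr_ge0//; lra.
  have D0 := young _ t0.
  have [tT|Tt] := leP T t.
    have := TP _ tT; set A := t `^ p / (2 * p) => tA.
    have AE : t `^ p / p = 2 * A by rewrite /A; field; lra.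
    have : (t + 1) `^ p <= 2 `^ p * (2 * p) * A.
      have -> : 2 `^ p * (2 * p) * A = (2 * t) `^ p by rewrite powRM// /A; field; lra.
      by rewrite ge0_ler_powR ?nnegrE//; lra.
    move=> le3; have pV : p^-1 < 1 by rewrite invf_lt1.
    have XA : A <= t `^ p / p + (1 - p^-1) - k by rewrite AE; lra.
    rewrite (le_trans le2)// (le_trans le3)//.
    rewrite -[leLHS]add0r lerD ?(ltW e0)//.
    apply: ler_pM => //.
    - by rewrite mulr_ge0 ?powR_ge0//; lra.
    - lra.
    - by rewrite /C lerDr divr_ge0 ?powR_ge0 ?(ltW c10).
  have [small|big] := leP ((t ^+ 2 + 1 - 2 * k) `^ (p / 2)) eps.
    rewrite (le_trans small)// lerDl mulr_ge0 ?(ltW C0)//; lra.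
  have {}big : 2 * d ^+ 2 <= (t - 1) ^+ 2 + 2 * (t - k).
    rewrite d2 (_ : (t - 1) ^+ 2 + 2 * (t - k) = t ^+ 2 + 1 - 2 * k); last by ring.
    rewrite leNgt; apply: contraTN big => lt; rewrite -leNgt.
    have -> : eps = (eps `^ (2 / p)) `^ (p / 2).
      by rewrite -powRrM (_ : 2 / p * (p / 2) = 1) ?powRr1 ?(ltW e0)//; field; lra.
    by rewrite ge0_ler_powR ?nnegrE ?divr_ge0 ?(ltW p0)//; lra.
  have cB : c1 <= t `^ p / p + (1 - p^-1) - k.
    have [td|td] := leP d `|t - 1|.
      by have := Hc _ t0 td; have : c1 <= c; [rewrite /c1 ge_min lexx|lra].
    have : (t - 1) ^+ 2 < d ^+ 2.
      by rewrite -(real_normK (num_real (t - 1))) ltrXn2r ?nnegrE ?(ltW d0).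
    by have : c1 <= d ^+ 2 / 2; [rewrite /c1 ge_min lexx orbT|lra].
  rewrite (le_trans le2)//.
  apply: (@le_trans _ _ ((T + 1) `^ p)); first by rewrite ge0_ler_powR ?nnegrE//; lra.
  have : (T + 1) `^ p <= (T + 1) `^ p / c1 * (t `^ p / p + (1 - p^-1) - k).
    by rewrite mulrAC -mulrA ler_peMr ?powR_ge0// ler_pdivlMr// mul1r.
  have : 0 <= 2 `^ p * (2 * p) * (t `^ p / p + (1 - p^-1) - k).
    by rewrite !mulr_ge0 ?powR_ge0//; lra.
  by rewrite /C mulrDl; lra.
(* The extra [p] pays for y = 0, where the distance is |x|^p / p. *)
exists (C + p) => [|x y]; first lra.
have a0 := normv_ge0 x; have b0 := normv_ge0 y.
have cab := dotv_le y x.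
rewrite -[leLHS]sqrt_powR ?normv_ge0// sqr_normvB dotvC /bregman.
have [y0|y0] := eqVneq (normv y) 0.
  have -> : dotv y x = 0.
    by apply/eqP; rewrite -normr_eq0 eq_le normr_ge0 andbT (le_trans cab)// y0 mul0r.
  rewrite y0 !mulr0 !subr0 expr0n/= addr0 powR0; last by rewrite gt_eqF.
  rewrite !mulr0 add0r addr0 sqrt_powR// mulrDl (mulrC p) mulfVK ?gt_eqF//.
  by rewrite lerDr mulr_ge0 ?divr_ge0 ?powR_ge0// ltW.
set a := normv x in a0 cab *; set b := normv y in b0 cab y0 *.
set k := dotv y x in cab *.
have bp : 0 < b by rewrite lt_neqAle eq_sym y0.
have b2 : 0 < b ^+ 2 by rewrite exprn_gt0.
have bpp : 0 < b `^ p by rewrite powR_gt0.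
have t0 : 0 <= a / b by rewrite divr_ge0.
have [k1 k2] : k / b ^+ 2 <= a / b /\ - (a / b) <= k / b ^+ 2.
  have E : a / b = a * b / b ^+ 2 by field; rewrite gt_eqF.
  move: cab; rewrite ler_norml mulrC => /andP[ca cb].
  by rewrite E -mulNr !ler_pM2r ?invr_gt0.
have := key _ _ t0 k1 k2.
rewrite -(ler_pM2l bpp).
have -> : b `^ p * ((a / b) ^+ 2 + 1 - 2 * (k / b ^+ 2)) `^ (p / 2) =
   (a ^+ 2 - 2 * k + b ^+ 2) `^ (p / 2).
  rewrite -(sqrt_powR p b0) -powRM ?sqr_ge0//; last first.
    have -> : (a / b) ^+ 2 + 1 - 2 * (k / b ^+ 2) = (a / b - 1) ^+ 2 + 2 * (a / b - k / b ^+ 2) by ring.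
    by rewrite addr_ge0 ?sqr_ge0// mulr_ge0// subr_ge0.
  by congr (_ `^ _); field; rewrite gt_eqF.
move=> /le_trans; apply.
have -> : (a / b) `^ p = a `^ p / b `^ p.
  rewrite powRM ?invr_ge0//; congr (_ * _).
  by rewrite -powR_inv1// -powRrM mulrC powRrM powR_inv1// powR_ge0.
have -> : b `^ (p - 2) = b `^ p / b ^+ 2.
  by rewrite powRB ?(gt_eqF bp) ?implybT// powR_mulrn.
have -> : b `^ p * (eps + C * (a `^ p / b `^ p / p + (1 - p^-1) - k / b ^+ 2)) =
  eps * b `^ p + C * (a `^ p / p + (1 - p^-1) * b `^ p - b `^ p / b ^+ 2 * k).
  by field; rewrite !gt_eqF.
rewrite lerD2l ler_wpM2r ?lerDl ?(ltW p0)//.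
have -> : a `^ p / p + (1 - p^-1) * b `^ p - b `^ p / b ^+ 2 * k =
   b `^ p * ((a / b) `^ p / p + (1 - p^-1) - k / b ^+ 2).
  rewrite [(a / b) `^ p]powRM ?invr_ge0// -[b^-1]powR_inv1// -powRrM mulN1r powRN.
  by field; rewrite !gt_eqF.
by rewrite mulr_ge0 ?(ltW bpp)//; have := young _ t0; lra.
Qed.

End Vectors.

Lemma normv_const (a : R) : normv (fun _ : 'I_1 => a) = `|a|.
Proof. by rewrite /normv big_ord1 sqrtr_sqr. Qed.

Lemma powR_norm_taylor p eps : 1 < p -> 0 < eps ->
  exists2 C : R, 0 < C & forall a b : R,
  `| `|a + b| `^ p - `|a| `^ p - p * (`|a| `^ (p - 2) * (a * b))|
     <= eps * (`|a| `^ (p - 1) * `|b|) + C * `|b| `^ p.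
Proof.
move=> p1 e0; have [C C0 H] := @normv_powR_taylor 1 p eps p1 e0.
exists C => // a b; have := H (fun=> a) (fun=> b).
by rewrite /dotv big_ord1 !normv_const.
Qed.

Lemma powR_norm_sub_le p : 1 < p -> exists2 C : R, 0 < C & forall a b : R,
  `| `|a + b| `^ p - `|a| `^ p| <= C * (`|a| `^ (p - 1) * `|b| + `|b| `^ p).
Proof.
move=> p1; have [C C0 H] := powR_norm_taylor p1 ltr01.
exists (C + 1 + p) => [|a b]; first lra.
have := H a b; set X := `|a + b| `^ p - `|a| `^ p.
have -> : p * (`|a| `^ (p - 2) * (a * b)) = p * (`|a| `^ (p - 2) * a) * b by ring.
set Y := p * _ * b.
have YE : `|Y| = p * (`|a| `^ (p - 1) * `|b|).
  rewrite !normrM (gtr0_norm (x := p)); last lra.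
  rewrite (ger0_norm (powR_ge0 _ _)) -mulrA; congr (_ * (_ * _)).
  have [->|a0] := eqVneq `|a| 0; first by rewrite mulr0 powR0//; lra.
  rewrite -{2}(powRr1 (normr_ge0 a)) -powRD ?a0 ?implybT//; congr (_ `^ _); lra.
have : `|X| <= `|X - Y| + `|Y| by rewrite -{1}(subrK Y X) ler_normD.
rewrite YE.
have : 0 <= `|a| `^ (p - 1) * `|b| by rewrite mulr_ge0 ?powR_ge0.
have : 0 <= `|b| `^ p by rewrite powR_ge0.
by move: (`|a| `^ (p - 1) * `|b|) (`|b| `^ p) => U V; nra.
Qed.

Lemma powR_abs_sub_le p (a b : R) : 1 < p -> 0 <= a -> 0 <= b ->
  `|a `^ p - b `^ p| <= p * Num.max a b `^ (p - 1) * `|a - b|.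
Proof.
move=> p1; wlog ba : a b / b <= a.
  move=> H a0 b0; have [/H|/H] := orP (le_total b a); first by apply.
  by rewrite maxC distrC (distrC a); apply.
move=> a0 b0; rewrite (max_idPl ba) !ger0_norm ?subr_ge0//; first exact: powR_sub_le.
by rewrite ge0_ler_powR ?nnegrE//; lra.
Qed.

End Powers.

(** * Lebesgue spaces *)

(* Sealed: otherwise failed conversion tests unfold the integrals and the
   exponential function. *)
HB.lock Definition Lpmass d (T : measurableType d) (R : realType)
  (mu : {measure set T -> \bar R}) (a : R) (f : T -> R) : R :=
  \int[mu]_x (`|f x| `^ a).
HB.lock Definition Lpnorm d (T : measurableType d) (R : realType)
  (mu : {measure set T -> \bar R}) (a : R) (f : T -> R) : R :=
  Lpmass mu a f `^ a^-1.

Section LpSpaces.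
Context d (T : measurableType d) (R : realType).
Variable mu : {measure set T -> \bar R}.
Implicit Types (f g h : T -> R) (a b c p q t : R).

Definition integrableR f := mu.-integrable setT (EFin \o f).

Lemma integrableR_measurable f : integrableR f -> measurable_fun setT f.
Proof. by move/integrableP => [/measurable_EFinP]. Qed.

Lemma integrableR_le f g : measurable_fun setT f -> integrableR g ->
  (forall x, `|f x| <= g x) -> integrableR f.
Proof.
move=> mf ig fg; apply: le_integrable ig => //; first exact/measurable_EFinP.
by move=> x _; rewrite lee_fin (le_trans (fg x))// ler_norm.
Qed.

Lemma integrableRD f g : integrableR f -> integrableR g -> integrableR (fun x => f x + g x).
Proof. exact: integrableD. Qed.

Lemma integrableRB f g : integrableR f -> integrableR g -> integrableR (fun x => f x - g x).
Proof. exact: integrableB. Qed.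

Lemma integrableRZ t f : integrableR f -> integrableR (fun x => t * f x).
Proof. exact: integrableZl. Qed.

Lemma integrableR_norm f : integrableR f -> integrableR (fun x => `|f x|).
Proof. exact: integrable_norm. Qed.

Lemma integrableR0 : integrableR (fun=> 0).
Proof. exact: integrable0. Qed.

Lemma integrableR_ae f g : integrableR f -> measurable_fun setT g ->
  f = g %[ae mu] -> integrableR g.
Proof.
move=> sf mg fg; have mf := integrableR_measurable sf.
move/integrableP: sf => [_ fi]; apply/integrableP; split; first exact/measurable_EFinP.
rewrite -(ge0_ae_eq_integral measurableT _ _ _ _ _ (f := fun x => `|(f x)%:E|%E))//.
- by apply/measurable_EFinP; exact: measurableT_comp.
- by apply/measurable_EFinP; exact: measurableT_comp.
- by apply: filterS fg => x /= /(_ I) ->.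
Qed.

Lemma ae_eq_Rintegral f g : measurable_fun setT f -> measurable_fun setT g ->
  f = g %[ae mu] -> \int[mu]_x f x = \int[mu]_x g x.
Proof.
move=> mf mg fg; congr fine; apply: ae_eq_integral => //; try exact/measurable_EFinP.
by apply: filterS fg => x /= /(_ I) ->.
Qed.

Lemma ae_le_Rintegral f g : integrableR f -> integrableR g ->
  {ae mu, forall x, f x <= g x} -> \int[mu]_x f x <= \int[mu]_x g x.
Proof.
move=> sf sg fg.
have mf := integrableR_measurable sf; have mg := integrableR_measurable sg.
have mm : measurable_fun setT (f \max g) by exact: measurable_maxr.
have gm : g = f \max g %[ae mu].
  by apply: filterS fg => x fgx _ /=; rewrite (max_idPr fgx).
have sm := integrableR_ae sg mm gm.
by rewrite [leRHS](ae_eq_Rintegral mg mm gm) le_Rintegral// => x _ /=; rewrite le_max lexx.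
Qed.

Lemma integrableRE f : (forall x, 0 <= f x) -> integrableR f ->
  (\int[mu]_x (f x)%:E = (\int[mu]_x f x)%:E)%E.
Proof. by move=> f0 sf; rewrite /Rintegral fineK//; exact: integrable_fin_num sf. Qed.

Lemma integrableR_fin_integral f : measurable_fun setT f -> (forall x, 0 <= f x) ->
  (\int[mu]_x (f x)%:E < +oo)%E -> integrableR f.
Proof.
move=> mf f0 fi; apply/integrableP; split; first exact/measurable_EFinP.
by under eq_integral do rewrite /= ger0_norm//.
Qed.

Lemma Rintegral_eq0_ae f : (forall x, 0 <= f x) -> integrableR f ->
  \int[mu]_x f x = 0 -> f = (fun=> 0) %[ae mu].
Proof.
move=> f0 sf i0.
have /(ae_eq_integral_abs mu measurableT) : measurable_fun setT (EFin \o f).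
  exact/measurable_EFinP/integrableR_measurable.
move=> [+ _]; rewrite (_ : (\int[mu]_x `|(EFin \o f) x| = 0)%E).
  by move=> /(_ erefl); apply: filterS => x /= /(_ I) [fx] _.
under eq_integral do rewrite /= ger0_norm//.
by rewrite integrableRE// i0.
Qed.

Definition Lp a f := measurable_fun setT f /\ integrableR (fun x => `|f x| `^ a).
Local Notation Lpmass := (Lpmass mu).
Local Notation Lpnorm := (Lpnorm mu).

Lemma LpmassE a f : Lpmass a f = \int[mu]_x (`|f x| `^ a).
Proof. by rewrite Lpmass.unlock. Qed.

Lemma LpnormE a f : Lpnorm a f = Lpmass a f `^ a^-1.
Proof. by rewrite Lpnorm.unlock. Qed.

Lemma Lpmass_ge0 a f : 0 <= Lpmass a f.
Proof. by rewrite LpmassE; apply: Rintegral_ge0 => x _; exact: powR_ge0. Qed.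

Lemma Lpnorm_ge0 a f : 0 <= Lpnorm a f.
Proof. by rewrite LpnormE powR_ge0. Qed.

Lemma Lpnorm_powR a f : 0 < a -> Lpnorm a f `^ a = Lpmass a f.
Proof. by move=> a0; rewrite LpnormE -powRrM mulVf ?gt_eqF// powRr1// Lpmass_ge0. Qed.

Lemma measurable_powR_abs a f : measurable_fun setT f ->
  measurable_fun setT (fun x => `|f x| `^ a).
Proof.
move=> mf; apply: (measurableT_comp (measurable_powR a)).
exact: measurableT_comp.
Qed.

Lemma Lfun_LpP a f : 0 < a -> (f \in Lfun mu a%:E) <-> Lp a f.
Proof.
move=> a0; split.
  rewrite inE => /andP[]; rewrite !inE /= => mf fin; split=> //.
  apply: integrableR_fin_integral; first exact: measurable_powR_abs.
    by move=> x; exact: powR_ge0.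
  move: fin; rewrite /finite_norm => /(poweR_lty a).
  by rewrite powR_Lnorm ?gt_eqF//.
move=> [mf sf]; rewrite inE; apply/andP; split; rewrite inE//=.
rewrite /finite_norm unlock; apply: poweR_lty => /=.
by rewrite integrableRE ?ltry// => x; exact: powR_ge0.
Qed.

Lemma Lpnorm_Lnorm a f : 0 < a -> Lp a f ->
  ('N[mu]_a%:E[EFin \o f] = (Lpnorm a f)%:E)%E.
Proof.
move=> a0 [mf sf]; rewrite unlock /= LpnormE LpmassE.
by rewrite integrableRE// => x; exact: powR_ge0.
Qed.

Lemma Lp_le a f g : 0 < a -> measurable_fun setT f -> Lp a g ->
  (forall x, `|f x| <= `|g x|) -> Lp a f.
Proof.
move=> a0 mf [mg sg] fg; split=> //; apply: integrableR_le sg _.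
  exact: measurable_powR_abs.
by move=> x; rewrite ger0_norm ?powR_ge0// ge0_ler_powR ?nnegrE ?(ltW a0).
Qed.

Lemma Lpmass_le a f g : 0 < a -> Lp a f -> Lp a g ->
  {ae mu, forall x, `|f x| <= `|g x|} -> Lpmass a f <= Lpmass a g.
Proof.
move=> a0 [mf sf] [mg sg] fg; rewrite !LpmassE; apply: ae_le_Rintegral => //.
by apply: filterS fg => x fgx; rewrite ge0_ler_powR ?nnegrE ?(ltW a0).
Qed.

Lemma Lp_ae a f g : Lp a f -> measurable_fun setT g -> f = g %[ae mu] -> Lp a g.
Proof.
move=> [mf sf] mg fg; split=> //; apply: integrableR_ae sf _ _.
  exact: measurable_powR_abs.
by apply: filterS fg => x /= /(_ I) ->.
Qed.

Lemma Lpmass_ae a f g : measurable_fun setT f -> measurable_fun setT g ->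
  f = g %[ae mu] -> Lpmass a f = Lpmass a g.
Proof.
move=> mf mg fg; rewrite !LpmassE; apply: ae_eq_Rintegral; try exact: measurable_powR_abs.
by apply: filterS fg => x /= /(_ I) ->.
Qed.

Lemma LpD a f g : 0 < a -> Lp a f -> Lp a g -> Lp a (fun x => f x + g x).
Proof.
move=> a0 [mf sf] [mg sg]; split; first exact: measurable_funD.
apply: integrableR_le (integrableRZ (2 `^ a) (integrableRD sf sg)) _.
  exact/measurable_powR_abs/measurable_funD.
move=> x; rewrite ger0_norm ?powR_ge0//.
rewrite (le_trans _ (powR_add_le (normr_ge0 _) (normr_ge0 _) a0))//.
by rewrite ge0_ler_powR ?nnegrE ?(ltW a0)// ler_normD.
Qed.

Lemma powR_absM a t s : `|t * s| `^ a = `|t| `^ a * `|s| `^ a :> R.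
Proof. by rewrite normrM powRM. Qed.

Lemma LpZ a t f : Lp a f -> Lp a (fun x => t * f x).
Proof.
move=> [mf sf]; split; first exact: measurable_funM.
have := integrableRZ (`|t| `^ a) sf.
by apply: eq_integrable => // x _; rewrite /= powR_absM.
Qed.

Lemma LpmassZ a t f : Lp a f -> Lpmass a (fun x => t * f x) = `|t| `^ a * Lpmass a f.
Proof.
move=> [mf sf]; rewrite !LpmassE -RintegralZl//.
by apply: eq_Rintegral => x _; rewrite powR_absM.
Qed.

Lemma LpN a f : Lp a f -> Lp a (fun x => - f x).
Proof.
by move=> /(LpZ (-1)) h; rewrite (_ : (fun x => - f x) = (fun x => -1 * f x))//;
  apply/funext => x; rewrite mulN1r.
Qed.

Lemma LpB a f g : 0 < a -> Lp a f -> Lp a g -> Lp a (fun x => f x - g x).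
Proof. by move=> a0 Lf Lg; apply: LpD => //; exact: LpN. Qed.

Lemma Lp0 a : 0 < a -> Lp a (fun=> 0).
Proof.
move=> a0; split=> //; have := integrableR0; apply: eq_integrable => // x _ /=.
by rewrite normr0 powR0 ?gt_eqF.
Qed.

Lemma Lp_normv a n (F : T -> 'I_n -> R) : 0 < a ->
  (forall i, Lp a (fun x => F x i)) -> Lp a (fun x => normv (F x)).
Proof.
move=> a0 LF.
have LS : Lp a (fun x => \sum_(i < n) `|F x i|).
  have : forall i, Lp a (fun x => `|F x i|).
    move=> i; apply: (Lp_le a0) (LF i) _ => [|x]; last by rewrite normr_id.
    by apply: measurableT_comp => //; case: (LF i).
  pose G (i : 'I_n) (x : T) : R := `|F x i| => LG.
  rewrite (_ : (fun x => _) = \sum_(i < n) G i); last first.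
    by apply/funext => x; rewrite fct_sumE.
  by elim/big_rec : _ => [|i f _ Lf]; [exact: Lp0|exact: (LpD a0 (LG i) Lf)].
apply: (Lp_le a0) LS _.
  apply: measurableT_comp; first exact: continuous_measurable_fun (@sqrt_continuous R).
  by apply: measurable_sum => i; apply: measurable_funX; case: (LF i).
move=> x; rewrite !ger0_norm ?normv_ge0 ?sumr_ge0//.
rewrite -(ler_pXn2r (n := 2)) ?nnegrE ?normv_ge0 ?sumr_ge0//.
rewrite sqr_normv expr2 mulr_suml; apply: ler_sum => i _.
rewrite -real_normK ?num_real// expr2 ler_wpM2l//.
by rewrite (bigD1 i)//= lerDl sumr_ge0.
Qed.

Lemma hoelder_integrableR a b f g : 0 < a -> 0 < b -> a^-1 + b^-1 = 1 ->
  Lp a f -> Lp b g -> integrableR (fun x => f x * g x).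
Proof.
move=> a0 b0 ab [mf sf] [mg sg].
apply: integrableR_le (integrableRD (integrableRZ a^-1 sf) (integrableRZ b^-1 sg)) _.
  exact: measurable_funM.
move=> x; rewrite normrM (le_trans (conjugate_powR _ _ a0 b0 ab))//.
by rewrite mulrC (mulrC b^-1).
Qed.

Lemma hoelder_le a b f g : 0 < a -> 0 < b -> a^-1 + b^-1 = 1 ->
  Lp a f -> Lp b g -> \int[mu]_x `|f x * g x| <= Lpnorm a f * Lpnorm b g.
Proof.
move=> a0 b0 ab Lf Lg.
have sfg := integrableR_norm (hoelder_integrableR a0 b0 ab Lf Lg).
have := hoelder mu Lf.1 Lg.1 a0 b0 ab.
rewrite (Lpnorm_Lnorm a0 Lf) (Lpnorm_Lnorm b0 Lg) Lnorm1 /= -EFinM.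
by rewrite integrableRE.
Qed.

Lemma hoelder_abs_le a b f g : 0 < a -> 0 < b -> a^-1 + b^-1 = 1 ->
  Lp a f -> Lp b g -> `|\int[mu]_x (f x * g x)| <= Lpnorm a f * Lpnorm b g.
Proof.
move=> a0 b0 ab Lf Lg; rewrite (le_trans _ (hoelder_le a0 b0 ab Lf Lg))//.
by apply: le_normr_Rintegral => //; exact: hoelder_integrableR ab Lf Lg.
Qed.

Lemma Lpnorm_triangle a f g : 1 <= a -> Lp a f -> Lp a g ->
  Lpnorm a (fun x => f x + g x) <= Lpnorm a f + Lpnorm a g.
Proof.
move=> a1 Lf Lg; have a0 : 0 < a by lra.
have := minkowski mu Lf.1 Lg.1 a1.
by rewrite !(Lpnorm_Lnorm a0) -?EFinD ?lee_fin//; exact: LpD.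
Qed.

Lemma Lpnorm_mass_le a f g : 0 < a -> Lpmass a f <= Lpmass a g ->
  Lpnorm a f <= Lpnorm a g.
Proof. by move=> a0 fg; rewrite !LpnormE ge0_ler_powR ?nnegrE ?invr_ge0 ?(ltW a0)// Lpmass_ge0. Qed.

Lemma Lpmass_le_powR a f t : 0 < a -> 0 <= t -> (Lpnorm a f <= t) = (Lpmass a f <= t `^ a).
Proof.
move=> a0 t0; rewrite -Lpnorm_powR//; apply/idP/idP => h.
  by rewrite ge0_ler_powR ?nnegrE ?(ltW a0)// Lpnorm_ge0.
rewrite leNgt; apply: contraTN h => h; rewrite -ltNge.
by rewrite gt0_ltr_powR ?nnegrE// Lpnorm_ge0.
Qed.

Lemma LpnormZ a t f : 0 < a -> Lp a f -> Lpnorm a (fun x => t * f x) = `|t| * Lpnorm a f.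
Proof.
move=> a0 Lf; rewrite !LpnormE LpmassZ// powRM ?powR_ge0 ?Lpmass_ge0//.
by rewrite -powRrM divff ?gt_eqF// powRr1.
Qed.

Lemma Lp_abs_powR a b f : 0 < b -> Lp (b * a) f -> Lp a (fun x => `|f x| `^ b).
Proof.
move=> b0 [mf sf]; split; first exact: measurable_powR_abs.
by apply: eq_integrable sf => // x _; rewrite /= (ger0_norm (powR_ge0 _ _)) -powRrM.
Qed.

Lemma Lpnorm_abs_powR a b f : 0 < b -> 0 < a ->
  Lpnorm a (fun x => `|f x| `^ b) = Lpnorm (b * a) f `^ b.
Proof.
move=> b0 a0; rewrite !LpnormE -powRrM invfM mulrAC mulVf ?gt_eqF// mul1r.
by congr (_ `^ _); rewrite !LpmassE; apply: eq_Rintegral => x _; rewrite (ger0_norm (powR_ge0 _ _)) -powRrM.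
Qed.

Lemma Lp_interp a b c f : 0 < a -> a <= b <= c -> Lp a f -> Lp c f -> Lp b f.
Proof.
move=> a0 /andP[ab bc] [mf sa] [_ sc]; split=> //.
apply: integrableR_le (integrableRD sa sc) _; first exact: measurable_powR_abs.
move=> x; rewrite ger0_norm ?powR_ge0//.
have [f1|f1] := leP `|f x| 1.
  rewrite -[leLHS]addr0 lerD ?powR_ge0//.
  have [->|fx0] := eqVneq `|f x| 0; first by rewrite !powR0// gt_eqF//; lra.
  by rewrite ger_powR// f1 lt_neqAle eq_sym fx0 normr_ge0.
by rewrite -[leLHS]add0r lerD ?powR_ge0// ler_powR// ltW.
Qed.

(** A crude form of interpolation that suffices for embeddings: |f|^b is at most t^(b-a) |f|^a where
    |f| <= t, and at most t^(b-c) |f|^c elsewhere. The two masses add up to 2 t^b, and 2 <= 2^b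
    because b >= 1. *)
Lemma Lpnorm_interp a b c f t : 1 <= a -> a <= b <= c -> Lp a f -> Lp c f ->
  0 < t -> Lpnorm a f <= t -> Lpnorm c f <= t -> Lpnorm b f <= 2 * t.
Proof.
move=> a1 abc La Lc t0; have a0 : 0 < a by lra.
have Lb := Lp_interp a0 abc La Lc.
case/andP: abc => ab bc; have b0 : 0 < b by lra. have c0 : 0 < c by lra.
rewrite !Lpmass_le_powR ?mulr_ge0 ?(ltW t0)// => Ha Hc.
have key x : `|f x| `^ b <= t `^ (b - a) * `|f x| `^ a + t `^ (b - c) * `|f x| `^ c.
  have [ft|tf] := leP `|f x| t.
    rewrite -[leLHS]addr0 lerD ?mulr_ge0 ?powR_ge0//.
    have [->|fx0] := eqVneq `|f x| 0; first by rewrite !powR0 ?mulr0// gt_eqF.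
    have -> : `|f x| `^ b = `|f x| `^ (b - a) * `|f x| `^ a.
      by rewrite -powRD ?subrK// fx0 implybT.
    by rewrite ler_wpM2r ?powR_ge0// ge0_ler_powR ?nnegrE ?subr_ge0// ltW.
  rewrite -[leLHS]add0r lerD ?mulr_ge0 ?powR_ge0//.
  have fx0 : 0 < `|f x| by exact: lt_trans tf.
  have -> : `|f x| `^ b = `|f x| `^ (b - c) * `|f x| `^ c.
    by rewrite -powRD ?subrK// (gt_eqF fx0) implybT.
  rewrite ler_wpM2r ?powR_ge0// -opprB !powRN lef_pV2 ?posrE ?powR_gt0//.
  by rewrite ge0_ler_powR ?nnegrE ?subr_ge0// ltW.
have [[_ sa] [_ sb] [_ sc]] := And3 La Lb Lc.
apply: (@le_trans _ _ (t `^ (b - a) * Lpmass a f + t `^ (b - c) * Lpmass c f)).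
  rewrite !LpmassE.
  rewrite -!RintegralZl// -RintegralD//; try exact: integrableRZ.
  by apply: le_Rintegral => //; apply: integrableRD; exact: integrableRZ.
apply: (@le_trans _ _ (t `^ (b - a) * t `^ a + t `^ (b - c) * t `^ c)).
  by rewrite lerD// ler_wpM2l ?powR_ge0.
rewrite -!powRD ?(gt_eqF t0) ?implybT// !subrK powRM ?(ltW t0)//.
rewrite -[leLHS]mulr2n -[leLHS]mulr_natl ler_wpM2r ?powR_ge0// -{1}(powRr1 (ler0n R 2)).
by rewrite ler_powR ?ler1n//; lra.
Qed.

End LpSpaces.


(** * Completeness of the Lebesgue spaces *)

Section Completeness.
Context d (T : measurableType d) (R : realType).
Variable mu : {measure set T -> \bar R}.
Implicit Types (f g : T -> R) (a : R).
Local Notation Lpmass := (Lpmass mu).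
Local Notation Lpnorm := (Lpnorm mu).

Lemma EFin_Lpmass a f : Lp mu a f ->
  (\int[mu]_x (`|f x| `^ a)%:E = (Lpmass a f)%:E)%E.
Proof.
by move=> [_ sf]; rewrite LpmassE integrableRE// => x; exact: powR_ge0.
Qed.

Lemma continuous_powR_abs a : 1 < a -> continuous (fun x : R => `|x| `^ a).
Proof.
move=> a1 x; apply/cvgrPdist_le => e e0.
pose C := a * (`|x| + 1) `^ (a - 1).
have C0 : 0 < C by rewrite mulr_gt0 ?powR_gt0 ?ltr_wpDl//; lra.
have [d0 d1] : (0 < Num.min 1 (e / C) :> R) /\ (Num.min 1 (e / C) <= 1 :> R).
  by split; [rewrite lt_min ltr01 divr_gt0|rewrite ge_min lexx].
have : \forall y \near x, `|x - y| < Num.min 1 (e / C).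
  exact: (@cvgr_dist_lt _ _ _ _ _ id x cvg_id _ d0).
apply: filterS => y xy.
have yx1 : `|x - y| <= 1 by rewrite (le_trans (ltW xy)).
have yx : `|y| <= `|x| + 1.
  have -> : y = x - (x - y) by lra.
  by rewrite (le_trans (ler_normB _ _))// lerD2l.
rewrite (le_trans (powR_abs_sub_le a1 (normr_ge0 _) (normr_ge0 _)))//.
apply: (@le_trans _ _ (C * `|x - y|)).
  apply: ler_pM; rewrite ?mulr_ge0 ?powR_ge0//; first lra.
    rewrite ler_wpM2l//; first lra.
    have M1 : Num.max `|x| `|y| <= `|x| + 1 by rewrite ge_max lerDl ler01.
    have M0 : 0 <= Num.max `|x| `|y| by rewrite le_max normr_ge0.
    apply: ge0_ler_powR => //; [by rewrite subr_ge0 ltW|by rewrite nnegrE addr_ge0].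
  exact: ler_dist_dist.
rewrite mulrC -ler_pdivlMr// (le_trans (ltW xy))//.
by rewrite ge_min lexx orbT.
Qed.

Lemma limn_einf_le (u : nat -> \bar R) (b : \bar R) N :
  (forall n, (N <= n)%N -> (u n <= b)%E) -> (limn_einf u <= b)%E.
Proof.
move=> ub; rewrite limn_einf_lim; apply: lime_le; first exact: is_cvg_einfs.
apply: nearW => n; apply: (@le_trans _ _ (u (maxn n N))); last by rewrite ub ?leq_maxr.
by apply: ereal_inf_lbound; exists (maxn n N) => //=; rewrite leq_maxl.
Qed.

Lemma Lp_sum a (F : nat -> T -> R) K : 0 < a -> (forall k, Lp mu a (F k)) ->
  Lp mu a (fun x => \sum_(k < K) F k x).
Proof.
move=> a0 LF; elim: K => [|K IH].
  by rewrite (_ : (fun _ => _) = fun=> 0); [exact: Lp0|apply/funext => x; rewrite big_ord0].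
rewrite (_ : (fun _ => _) = fun x => \sum_(k < K) F k x + F K x); first exact: LpD.
by apply/funext => x; rewrite big_ord_recr.
Qed.

Lemma Lpnorm_sum a (F : nat -> T -> R) K : 1 <= a -> (forall k, Lp mu a (F k)) ->
  Lpnorm a (fun x => \sum_(k < K) F k x) <= \sum_(k < K) Lpnorm a (F k).
Proof.
move=> a1 LF; have a0 : 0 < a by lra.
elim: K => [|K IH].
  rewrite big_ord0 Lpmass_le_powR// LpmassE.
  under eq_Rintegral do rewrite big_ord0 normr0 powR0 ?gt_eqF//.
  by rewrite Rintegral_cst// mul0r powR_ge0.
rewrite big_ord_recr /= (_ : (fun _ => _) = fun x => \sum_(k < K) F k x + F K x).
  by rewrite (le_trans (Lpnorm_triangle a1 (Lp_sum K a0 LF) (LF K)))// lerD2r.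
by apply/funext => x; rewrite big_ord_recr.
Qed.

(** The partial sums of |F k| increase, and their a-th powers have integrals at most B^a by the
    triangle inequality. By monotone convergence the limit of these powers is integrable, hence
    finite almost everywhere. *)
Lemma Lp_abs_summable_ae a (F : nat -> T -> R) (B : R) : 1 < a ->
  (forall k, Lp mu a (F k)) -> (forall K, \sum_(k < K) Lpnorm a (F k) <= B) ->
  {ae mu, forall x, cvgn (series (fun k => F k x))}.
Proof.
move=> a1 LF sB; have a0 : 0 < a by lra. have a1' : 1 <= a by lra.
have B0 : 0 <= B by have := sB 0%N; rewrite big_ord0.
pose G K x : R := \sum_(k < K) `|F k x|.
have LF' k : Lp mu a (fun x => `|F k x|).
  apply: (Lp_le a0) (LF k) _ => [|x]; last by rewrite normr_id.
  by apply: measurableT_comp => //; case: (LF k).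
have LG K : Lp mu a (G K) by exact: (Lp_sum K a0 LF').
have G0 K x : 0 <= G K x by exact: sumr_ge0.
have Gnd x : nondecreasing_seq (G ^~ x).
  by apply/nondecreasing_seqP => n; rewrite /G big_ord_recr/= lerDl.
have normF k : Lpnorm a (fun x => `|F k x|) = Lpnorm a (F k).
  suff E : Lpmass a (fun x => `|F k x|) = Lpmass a (F k) by rewrite LpnormE E -LpnormE.
  by rewrite !LpmassE; under eq_Rintegral do rewrite normr_id.
have massG K : Lpmass a (G K) <= B `^ a.
  rewrite -Lpmass_le_powR// (le_trans _ (sB K))//.
  rewrite (le_trans (Lpnorm_sum K a1' LF'))//.
  by under eq_bigr do rewrite normF.
pose E K x := ((G K x) `^ a)%:E.
have mE K : measurable_fun setT (E K).
  by apply/measurable_EFinP; exact: (measurableT_comp (measurable_powR a) (LG K).1).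
have E0 K x : setT x -> (0 <= E K x)%E by move=> _; rewrite lee_fin powR_ge0.
have Emono x : setT x -> {homo E^~ x : n m / (n <= m)%N >-> (n <= m)%E}.
  move=> _ n m nm; rewrite lee_fin ge0_ler_powR ?nnegrE ?(ltW a0)//; exact: Gnd.
have cE := @cvg_monotone_convergence _ _ _ mu _ measurableT _ mE E0 Emono.
pose S x := limn (E ^~ x).
have mS : measurable_fun setT S.
  by apply: (emeasurable_fun_cvg E) => // x _; apply: ereal_nondecreasing_is_cvgn; exact: Emono.
have ES K x : (E K x <= S x)%E.
  rewrite /S (cvg_lim _ (ereal_nondecreasing_cvgn (Emono x I)))//.
  by apply: ereal_sup_ubound; exists K.
have S0 x : (0 <= S x)%E by rewrite (le_trans _ (ES 0%N x))// E0.
have IS : (\int[mu]_x S x <= (B `^ a)%:E)%E.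
  rewrite -(cvg_lim _ cE)//; apply: lime_le; first by apply/cvg_ex; eexists; exact: cE.
  apply: nearW => K; move: (massG K); rewrite -lee_fin -(EFin_Lpmass (LG K)).
  under eq_integral do rewrite /= ger0_norm//; exact.
have iS : mu.-integrable setT S.
  apply/integrableP; split=> //.
  under eq_integral do rewrite gee0_abs//.
  by rewrite (le_lt_trans IS)// ltry.
have := integrable_ae measurableT iS; apply: filterS => x /(_ I) Sfin.
apply: normed_cvg.
have -> : [normed series (fun k => F k x)] = G ^~ x.
  by apply/funext => n; rewrite /normed_series_of seriesEord.
apply: nondecreasing_is_cvgn; first exact: Gnd.
exists ((fine (S x)) `^ a^-1) => _ [K _ <-].
have : E K x = (fine (E K x))%:E by [].
rewrite -[leLHS]powRr1// -(mulfV (lt0r_neq0 a0)) powRrM.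
rewrite ge0_ler_powR ?nnegrE ?invr_ge0 ?(ltW a0) ?fine_ge0 ?powR_ge0//.
by rewrite -lee_fin fineK//; exact: ES.
Qed.

Lemma Lp_complete a (F : nat -> T -> R) : 1 < a -> (forall n, Lp mu a (F n)) ->
  (forall e : R, 0 < e -> exists N, forall m n, (N <= m)%N -> (N <= n)%N ->
     Lpnorm a (fun x => F m x - F n x) <= e) ->
  exists2 f, Lp mu a f &
    Lpnorm a (fun x => F n x - f x) @[n --> \oo] --> (0:R).
Proof.
move=> a1 LF FC; have a0 : 0 < a by lra. have a1' : 1 <= a by lra.
have /choice[N HN] : forall k : nat, exists N, forall m n, (N <= m)%N -> (N <= n)%N ->
     Lpnorm a (fun x => F m x - F n x) <= (2^-1) ^+ k.
  by move=> k; apply: FC; rewrite exprn_gt0 ?invr_gt0.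
(* The maximum puts both [nk k] and [nk k.+1] beyond [N k], so consecutive terms of the subsequence
   differ by at most 2^-k in norm. *)
pose nk k := (\max_(i < k.+1) N i)%N.
have Nnk j k : (j <= k)%N -> (N j <= nk k)%N.
  by rewrite -ltnS => jk; exact: (leq_bigmax (Ordinal jk)).
pose H k x := F (nk k.+1) x - F (nk k) x.
have LH k : Lp mu a (H k) by exact: LpB.
have nH k : Lpnorm a (H k) <= (2^-1) ^+ k by apply: HN; exact: Nnk.
have sH K : \sum_(k < K) Lpnorm a (H k) <= 2.
  apply: (@le_trans _ _ (\sum_(k < K) (2^-1) ^+ k)); first exact: ler_sum.
  suff -> : \sum_(k < K) (2^-1) ^+ k = 2 - 2 * (2^-1) ^+ K :> R.
    by rewrite lerBlDr lerDl mulr_ge0.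
  elim: K => [|K IH]; first by rewrite big_ord0 expr0; lra.
  by rewrite big_ord_recr/= IH exprS; lra.
have aeF : {ae mu, forall x, cvgn (fun k => F (nk k) x)}.
  have := Lp_abs_summable_ae a1 LH sH; apply: filterS => x cH.
  have -> : (fun k => F (nk k) x) = (fun k => F (nk 0%N) x + series (fun k => H k x) k).
    by apply/funext => k; rewrite [LHS](eq_sum_telescope (fun k => F (nk k) x)).
  by apply: is_cvgD => //; exact: is_cvg_cst.
(* An upper limit is measurable and is defined also at the points where the subsequence diverges. *)
pose f x : R := fine (limn_esup (fun k => (F (nk k) x)%:E)).
have mf : measurable_fun setT f.
  apply: measurableT_comp => //; apply: measurable_fun_limn_esup => k.
  by apply/measurable_EFinP; case: (LF (nk k)).
have cf : {ae mu, forall x, F (nk k) x @[k --> \oo] --> f x}.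
  apply: filterS aeF => x /cvg_ex[l Fl].
  have : (F (nk k) x)%:E @[k --> \oo] --> l%:E by apply: cvg_EFin => //; exact: nearW.
  by rewrite /f => /cvg_limn_einf_sup[_ ->].
(* Fatou along the subsequence: bounds on F (nk k) - F n for large k pass to F n - f. It is used
   twice, for membership of f with e = 1 and for convergence. *)
have key n : forall e : R, 0 < e -> (exists M, forall k, (M <= k)%N ->
    Lpnorm a (fun x => F (nk k) x - F n x) <= e) ->
    Lp mu a (fun x => F n x - f x) /\ Lpnorm a (fun x => F n x - f x) <= e.
  move=> e e0 [M HM].
  have mD : measurable_fun setT (fun x => F n x - f x).
    by apply: measurable_funB => //; case: (LF n).
  pose D k x := (`|F (nk k) x - F n x| `^ a)%:E.
  have LD k : Lp mu a (fun x => F (nk k) x - F n x) by exact: LpB.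
  have mDk k : measurable_fun setT (D k).
    by apply/measurable_EFinP; exact: measurable_powR_abs (LD k).1.
  have D0 k x : setT x -> (0 <= D k x)%E by rewrite lee_fin powR_ge0.
  have Dlim : {ae mu, forall x, (`|F n x - f x| `^ a)%:E = limn_einf (D ^~ x)}.
    apply: filterS cf => x Fx; apply/esym.
    suff /cvg_limn_einf_sup[-> _] : D ^~ x @ \oo --> (`|F n x - f x| `^ a)%:E by [].
    apply: cvg_EFin; first exact: nearW.
    rewrite distrC; apply: (@cvg_comp _ _ _ (fun k => F (nk k) x - F n x) (fun y => `|y| `^ a) _ (nbhs (f x - F n x))).
      by apply: cvgB => //; exact: cvg_cst.
    exact: continuous_powR_abs.
  have ID k : (\int[mu]_x D k x = (Lpmass a (fun x => F (nk k) x - F n x))%:E)%E.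
    exact: EFin_Lpmass.
  have Ie : (\int[mu]_x (`|F n x - f x| `^ a)%:E <= (e `^ a)%:E)%E.
    rewrite (ge0_ae_eq_integral measurableT _ _ _ _ (g := fun x => limn_einf (D ^~ x)))//.
    - apply: le_trans (fatou mu measurableT mDk D0) _.
      apply: (@limn_einf_le _ _ M) => k Mk.
      by rewrite ID lee_fin -Lpmass_le_powR ?(ltW e0)//; exact: HM.
    - by apply/measurable_EFinP; exact: measurable_powR_abs.
    - rewrite (_ : (fun x => limn_einf (D ^~ x)) = (fun x => - limn_esup (fun k => - D k x))%E)//.
      apply: measurableT_comp => //; apply: measurable_fun_limn_esup => k.
      exact: measurableT_comp.
    - by move=> x _; rewrite limn_einf_lim; apply: lime_ge; [exact: is_cvg_einfs|
        apply: nearW => k; apply: le_ereal_inf_tmp => _ [j _ <-]; exact: D0].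
    - by apply: filterS Dlim => x /= -> _.
  have LDf : Lp mu a (fun x => F n x - f x).
    split=> //; apply: integrableR_fin_integral; first exact: measurable_powR_abs.
      by move=> x; exact: powR_ge0.
    by rewrite (le_lt_trans Ie)// ltry.
  by split=> //; rewrite Lpmass_le_powR ?(ltW e0)// -lee_fin -EFin_Lpmass.
exists f.
  have [||L0 _] := key (nk 0%N) 1; [exact: ltr01| |].
    by exists 0%N => k _; rewrite (_ : 1 = (2^-1) ^+ 0)//; apply: HN; exact: Nnk.
  have := LpB a0 (LF (nk 0%N)) L0.
  by under [X in Lp _ _ X]eq_fun do rewrite opprB addrC subrK.
apply/cvgrPdist_le => e e0.
have [j je] : exists j, (2^-1) ^+ j <= e.
  have : (2^-1 : R) ^+ n @[n --> \oo] --> 0 by apply: cvg_expr; rewrite ger0_norm ?invf_lt1 ?ltr1n.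
  move=> /cvgrPdist_le /(_ _ e0) [j _ /(_ j (leqnn j))].
  by rewrite /= sub0r normrN ger0_norm ?exprn_ge0//; exists j.
exists (N j) => // n /= Nn; rewrite sub0r normrN ger0_norm ?Lpnorm_ge0//.
have [|_ //] := key n e e0; exists j => k jk.
by rewrite (le_trans _ je)//; apply: HN => //; exact: Nnk.
Qed.

End Completeness.

(** * Lebesgue measure on R^3 *)

Section Space.
Variable R : realType.
Local Notation lam := (@lebesgue_measure R).
Local Notation mu := (@leb3 R).


Lemma lebesgue_measure_translation (t : R) (A : set R) : measurable A ->
  lam A = lam ((fun x => x + t) @^-1` A).
Proof.
move=> mA; pose T : measurableTypeR R -> measurableTypeR R := fun x : R => x + t.
have mT : measurable_fun setT T by exact: measurable_funD.
pose TM := isMeasurableFun.Build _ _ _ _ _ mT.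
pose TF : {mfun measurableTypeR R >-> measurableTypeR R} := HB.pack T TM.
have := @lebesgue_measure_unique R (pushforward lam TF) _ A mA; apply.
move=> _ [[a b] _ <-]; rewrite /= /pushforward.
have -> : T @^-1` `]a, b] = `](a - t), (b - t)]%classic.
  by apply/seteqP; split=> x; rewrite /T /= !in_itv/=; lra.
rewrite !lebesgue_measure_itv/= !lte_fin ltrD2r; case: ifP => // _.
by rewrite -!EFinB; congr EFin; ring.
Qed.

Lemma lebesgue_integral_translation (t : R) (f : R -> \bar R) :
  measurable_fun setT f -> (forall x, 0 <= f x)%E ->
  (\int[lam]_x f (x + t)%R = \int[lam]_x f x)%E.
Proof.
move=> mf f0; pose T : measurableTypeR R -> measurableTypeR R := fun x : R => x + t.
have mT : measurable_fun setT T by exact: measurable_funD.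
have := @ge0_integral_pushforward _ _ (measurableTypeR R) (measurableTypeR R) R T mT lam setT f measurableT mf.
rewrite preimage_setT => <-; last by move=> x _; exact: f0.
apply: eq_measure_integral => A mA _; exact/esym/lebesgue_measure_translation.
Qed.

Lemma leb2_tonelli (f : R * R -> \bar R) : measurable_fun setT f ->
  (forall x, 0 <= f x)%E ->
  (\int[@leb2 R]_z f z = \int[lam]_x \int[lam]_y f (x, y))%E.
Proof. by move=> mf f0; exact: fubini_tonelli1. Qed.

Lemma leb3_tonelli (f : R3 R -> \bar R) : measurable_fun setT f -> (forall x, 0 <= f x)%E ->
  (\int[mu]_z f z = \int[lam]_x \int[lam]_y \int[lam]_z f (x, y, z))%E.
Proof.
move=> mf f0; rewrite [LHS](fubini_tonelli1 (m1 := @leb2 R) (m2 := lam))//.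
rewrite leb2_tonelli//; first exact: measurable_fun_fubini_tonelli_F.
by move=> x; exact: integral_ge0.
Qed.

Lemma measurable_translation (a : R3 R) : measurable_fun setT (fun x : R3 R => x + a).
Proof.
apply: measurable_fun_pair; first apply: measurable_fun_pair => /=.
- apply: measurable_funD => //; apply: measurableT_comp => //.
- apply: measurable_funD => //; apply: measurableT_comp => //.
- by apply: measurable_funD.
Qed.

Lemma measurable_line (e : R3 R) : measurable_fun setT (fun z : R3 R * R => z.1 + z.2 *: e).
Proof.
apply: measurable_fun_pair; first apply: measurable_fun_pair => /=.
- apply: measurable_funD; last exact: measurable_funM.
  by apply: measurableT_comp => //; apply: measurableT_comp.
- apply: measurable_funD; last exact: measurable_funM.
  by apply: measurableT_comp => //; apply: measurableT_comp.
- apply: measurable_funD; last exact: measurable_funM.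
  by apply: measurableT_comp.
Qed.

Lemma leb3_integral_translation (a : R3 R) (f : R3 R -> \bar R) : measurable_fun setT f ->
  (forall x, 0 <= f x)%E -> (\int[mu]_x f (x + a)%R = \int[mu]_x f x)%E.
Proof.
case: a => [[a b] c] mf f0.
have mg := measurableT_comp mf (measurable_translation (a, b, c)).
rewrite (leb3_tonelli mf f0) (leb3_tonelli mg (fun x => f0 _)).
have mz x y : measurable_fun setT (fun z => f (x, y, z)).
  exact: (measurableT_comp mf (measurable_pair1 (x, y))).
have m2 : measurable_fun setT (fun z => \int[lam]_w f (z, w))%E.
  exact: measurable_fun_fubini_tonelli_F.
have my x : measurable_fun setT (fun y => \int[lam]_z f (x, y, z))%E.
  exact: (measurableT_comp m2 (measurable_pair1 x)).
have mx : measurable_fun setT (fun x => \int[lam]_y \int[lam]_z f (x, y, z))%E.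
  apply: (@measurable_fun_fubini_tonelli_F _ _ _ _ _ lam _ m2) => z.
  exact: integral_ge0.
rewrite -(lebesgue_integral_translation a mx); last first.
  by move=> x; apply: integral_ge0 => y _; exact: integral_ge0.
apply: eq_integral => x _ /=.
rewrite -(lebesgue_integral_translation b (my _)); last by move=> y; exact: integral_ge0.
apply: eq_integral => y _ /=.
by rewrite -(lebesgue_integral_translation c (mz _ _)).
Qed.

Lemma compact_box (n : R) : compact (`[-n, n]%classic `*` `[-n, n]%classic `*` `[-n, n]%classic : set (R3 R)).
Proof. by do 2 (apply: compact_setX; last exact: segment_compact); exact: segment_compact. Qed.

Definition box (n : R) : set (R3 R) :=
  `[-n, n]%classic `*` `[-n, n]%classic `*` `[-n, n]%classic.

Lemma measurable_box n : measurable (box n).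
Proof. by do 2 (apply: measurableX; last exact: measurable_itv); exact: measurable_itv. Qed.

Lemma leb3_box_fin n : (mu (box n) < +oo)%E.
Proof.
have h : (lam `[(- n)%R, n]%classic < +oo)%E by rewrite lebesgue_measure_itv/=; case: ifP => // _; rewrite -EFinB ltry.
have mI : measurable (`[(- n)%R, n]%classic : set (measurableTypeR R)) by exact: measurable_itv.
have h2 : (@leb2 R (`[(- n)%R, n] `*` `[(- n)%R, n]) < +oo)%E.
  have -> : (@leb2 R (`[(- n)%R, n] `*` `[(- n)%R, n]) = (lam \x lam) (`[(- n)%R, n] `*` `[(- n)%R, n]))%E by [].
  by rewrite product_measure1E// lte_mul_pinfty// ge0_fin_numE.
rewrite /leb3 /box product_measure1E//; last exact: measurableX.
by rewrite lte_mul_pinfty// ge0_fin_numE.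
Qed.

Lemma compact_sub_box (K : set (R3 R)) : compact K -> exists n : nat, K `<=` box n%:R.
Proof.
move=> /compact_bounded [M [_ /(_ (`|M| + 1))]].
rewrite (le_lt_trans (ler_norm M)) ?ltrDl// => /(_ isT) KM.
exists (Num.truncn (`|M| + 1)).+1 => -[[x y] z] /KM /=.
rewrite /Num.norm /= !ge_max /= => /andP[/andP[hx hy] hz].
have hn : `|M| + 1 <= (Num.truncn (`|M| + 1)).+1%:R by rewrite ltW// truncnS_gt.
by split; [split|]; rewrite /= in_itv/= -ler_norml (le_trans _ hn).
Qed.

(** Topology and sigma-algebra of the iterated product are built independently; countably many cubes
    with rational centres and radii 1 / (n + 1) link them. *)
Lemma open_measurable3 (U : set (R3 R)) : open U -> measurable U.
Proof.
move=> oU.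
pose cube (q1 q2 q3 : rat) (n : nat) : set (R3 R) :=
  ball (ratr q1 : R) n.+1%:R^-1 `*` ball (ratr q2 : R) n.+1%:R^-1 `*` ball (ratr q3 : R) n.+1%:R^-1.
have mc q1 q2 q3 n : measurable (cube q1 q2 q3 n).
  by apply: measurableX; [apply: measurableX|]; exact: measurable_ball.
pose C q1 q2 q3 n := if `[< cube q1 q2 q3 n `<=` U >] then cube q1 q2 q3 n else set0.
have -> : U = \bigcup_q1 \bigcup_q2 \bigcup_q3 \bigcup_n C q1 q2 q3 n.
  apply/seteqP; split=> [[[x y] z] Uxyz|v [q1 _ [q2 _ [q3 _ [n _]]]]]; last first.
    by rewrite /C; case: ifPn => // /asboolP; exact.
  move: oU; rewrite openE => /(_ _ Uxyz) /nbhs_ballP [e /= e0 He].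
  pose n := Num.truncn (2 / e).
  have ne : 2 * n.+1%:R^-1 < e.
    by rewrite ltr_pdivrMr// mulrC -ltr_pdivrMr// truncnS_gt.
  have n0 : 0 < n.+1%:R^-1 :> R by rewrite invr_gt0.
  have rq (w : R) : exists q : rat, ball (ratr q : R) n.+1%:R^-1 w.
    have : w - n.+1%:R^-1 < w + n.+1%:R^-1 by move: n0; set d := n.+1%:R^-1; lra.
    move=> /rat_in_itvoo[q]; rewrite in_itv/= => /andP[q1 q2]; exists q.
    by rewrite /ball/= ltr_norml; move: n0 q1 q2; set d := n.+1%:R^-1; lra.
  have [[q1 h1] [q2 h2] [q3 h3]] := And3 (rq x) (rq y) (rq z).
  exists q1 => //; exists q2 => //; exists q3 => //; exists n => //.
  have sub : cube q1 q2 q3 n `<=` U.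
    move=> [[x' y'] z'] [[/= k1 k2] k3]; apply: He.
    have tri (w w' q : R) : ball q n.+1%:R^-1 w -> ball q n.+1%:R^-1 w' -> ball w e w'.
      by rewrite /ball/= !ltr_norml; move: n0 ne; set d := n.+1%:R^-1; lra.
    by split; [split|]; rewrite /=; [exact: tri h1 k1|exact: tri h2 k2|exact: tri h3 k3].
  by rewrite /C; case: ifPn => [_|/asboolP//]; split; [split|].
do 3 (apply: bigcupT_measurable_rat => ?).
by apply: bigcupT_measurable => n; rewrite /C; case: ifP.
Qed.

Lemma continuous_measurable3 (u : R3 R -> R) : continuous u -> measurable_fun setT u.
Proof.
move=> /continuousP cu; apply: (measurability _ (RGenOInfty.measurableE R)).
move=> /= _ [_ [a ->] <-]; rewrite setTI; apply: open_measurable3.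
by apply: cu; exact: rray_open.
Qed.

Lemma compact_measurable3 (K : set (R3 R)) : compact K -> measurable K.
Proof.
move=> cK; rewrite -(setCK K); apply: measurableC; apply: open_measurable3.
by apply: closed_openC; apply: compact_closed => //; exact: norm_hausdorff.
Qed.

End Space.

(** * Fubini's theorem for real-valued integrals *)

Section RealFubini.
Context d1 d2 (T1 : measurableType d1) (T2 : measurableType d2) (R : realType).
Variables (m1 : {sigma_finite_measure set T1 -> \bar R})
  (m2 : {sigma_finite_measure set T2 -> \bar R}).
Implicit Types k : T1 * T2 -> R.

(** A real inner integral is the finite part of an extended one, and the extended one is finite only
    for almost every parameter. Hence the almost-everywhere identities [FE] and [GE] through which
    the extended theorem is transported. *)
Lemma fubini_real k : integrableR (m1 \x m2)%E k ->
  [/\ integrableR m1 (fun x => \int[m2]_y k (x, y)),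
      integrableR m2 (fun y => \int[m1]_x k (x, y)),
      {ae m1, forall x, integrableR m2 (fun y => k (x, y))} &
      \int[m1]_x (\int[m2]_y k (x, y)) = \int[m2]_y (\int[m1]_x k (x, y))].
Proof.
move=> ik.
have iF := integrable_fubini_F ik.
have iG : m2.-integrable setT (fubini_G m1 (EFin \o k)).
  have mk : measurable_fun setT (EFin \o k) by case/integrableP : ik.
  have klty := (integrable21ltyP m1 m2 mk).1 ik.
  apply/integrableP; split; first exact: measurable_fubini_G ik.
  apply: le_lt_trans klty; apply: ge0_le_integral => //.
  - by apply: measurableT_comp => //; exact: measurable_fubini_G ik.
  - apply: (measurable_fun_fubini_tonelli_G (abse \o (EFin \o k))) => //=.
    exact: measurableT_comp.
  - by move=> y _; apply: le_abse_integral => //; exact: (measurableT_comp mk (measurable_pair2 y)).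
have FE : (EFin \o (fun x => \int[m2]_y k (x, y))) = fubini_F m2 (EFin \o k) %[ae m1].
  have := integrable_ae measurableT iF; apply: filterS => x /(_ I) Ffin _ /=.
  by rewrite /Rintegral fineK.
have GE : (EFin \o (fun y => \int[m1]_x k (x, y))) = fubini_G m1 (EFin \o k) %[ae m2].
  have := integrable_ae measurableT iG; apply: filterS => x /(_ I) Ffin _ /=.
  by rewrite /Rintegral fineK.
have mF : measurable_fun setT (EFin \o (fun x => \int[m2]_y k (x, y))).
  by apply/measurable_EFinP; apply: measurableT_comp => //; exact: measurable_fubini_F ik.
have mG : measurable_fun setT (EFin \o (fun y => \int[m1]_x k (x, y))).
  by apply/measurable_EFinP; apply: measurableT_comp => //; exact: measurable_fubini_G ik.
split.
- apply/integrableP; split=> //; have /integrableP[mF' h] := iF.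
  rewrite (ae_eq_integral (abse \o fubini_F m2 (EFin \o k)))//.
  + exact: measurableT_comp.
  + exact: measurableT_comp.
  + by apply: filterS FE => x /= /[apply] <-.
- apply/integrableP; split=> //; have /integrableP[mG' h] := iG.
  rewrite (ae_eq_integral (abse \o fubini_G m1 (EFin \o k)))//.
  + exact: measurableT_comp.
  + exact: measurableT_comp.
  + by apply: filterS GE => x /= /[apply] <-.
- exact: ae_integrable1 ik.
- rewrite {1}/Rintegral [X in fine X](ae_eq_integral (fubini_F m2 (EFin \o k)))//; last first.
    exact: measurable_fubini_F ik.
  rewrite [in RHS]/Rintegral [X in _ = fine X](ae_eq_integral (fubini_G m1 (EFin \o k)))//; last first.
    exact: measurable_fubini_G ik.
  by congr fine; exact: Fubini.
Qed.

Lemma integrableR_prod21 k (B : T2 -> R) : measurable_fun setT k ->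
  (forall y, integrableR m1 (fun x => k (x, y))) ->
  (forall y, \int[m1]_x `|k (x, y)| <= B y) -> integrableR m2 B ->
  integrableR (m1 \x m2)%E k.
Proof.
move=> mk ik kB iB; apply/integrable21ltyP; first exact/measurable_EFinP.
have /integrableP[mB] := iB; apply: le_lt_trans.
apply: ge0_le_integral => //.
- by move=> y _; exact: integral_ge0.
- apply: (measurable_fun_fubini_tonelli_G (abse \o (EFin \o k))) => //=.
  by apply/measurable_EFinP; exact: measurableT_comp.
- exact: measurableT_comp.
- move=> y _ /=; rewrite integrableRE//; last exact: integrableR_norm.
  by rewrite lee_fin (le_trans (kB y))// ler_norm.
Qed.

End RealFubini.

(** * Translations, local integrability and Fubini along lines *)

Section Lines.
Variable R : realType.
Local Notation lam := (@lebesgue_measure R).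
Local Notation mu := (@leb3 R).

Lemma integrableR_translation (a : R3 R) (f : R3 R -> R) :
  integrableR mu f -> integrableR mu (fun x => f (x + a)).
Proof.
move=> /integrableP[mf fi]; have mt := measurable_translation a.
apply/integrableP; split; first exact: (measurableT_comp mf mt).
rewrite (leb3_integral_translation a (f := fun x => `|(f x)%:E|%E))//.
exact: measurableT_comp.
Qed.

Lemma Rintegral_translation (a : R3 R) (f : R3 R -> R) : measurable_fun setT f ->
  \int[mu]_x f (x + a) = \int[mu]_x f x.
Proof.
move=> /measurable_EFinP mf; rewrite /Rintegral integralE [in RHS]integralE.
congr (fine (_ - _)).
- by rewrite -[RHS](leb3_integral_translation a (measurable_funepos mf) (funepos_ge0 _));
    apply: eq_integral => x _; rewrite !funeposE.
- by rewrite -[RHS](leb3_integral_translation a (measurable_funeneg mf) (funeneg_ge0 _));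
    apply: eq_integral => x _; rewrite !funenegE.
Qed.

(** [loc_integrable] with boxes in place of all compact sets and with a cutoff in place of the
    restricted domain, so that every integral is over the whole space. *)
Definition locint (g : R3 R -> R) := measurable_fun setT g /\
  forall n : nat, integrableR mu (fun x => \1_(box n%:R) x * g x).

Lemma loc_integrable_locint (g : R3 R -> R) : loc_integrable g -> locint g.
Proof.
move=> [mg ig]; split=> // n.
have := ig (box n%:R) (@compact_box R n%:R).
rewrite integrable_mkcond//; last exact: measurable_box.
apply: eq_integrable => // x _.
by rewrite patchE /= indicE; case: ifP => _; rewrite ?mul1r ?mul0r.
Qed.

Lemma locint_loc_integrable (g : R3 R -> R) : locint g -> loc_integrable g.
Proof.
move=> [mg ig]; split=> // K cK; have [n Kn] := compact_sub_box cK.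
have mK := compact_measurable3 cK.
have ib : mu.-integrable (box n%:R) (EFin \o g).
  rewrite integrable_mkcond//; last exact: measurable_box.
  apply: eq_integrable (ig n) => // x _.
  by rewrite patchE /= indicE; case: ifP => _; rewrite ?mul1r ?mul0r.
by apply: integrableS ib => //; exact: measurable_box.
Qed.

Definition bounded_support (b : R3 R -> R) := measurable_fun setT b /\
  exists n : nat, exists2 M : R, 0 <= M & forall x, `|b x| <= M * \1_(box n%:R) x.

Lemma integrableR_box n : integrableR mu (fun x => \1_(box n) x : R).
Proof.
apply: integrableR_fin_integral => //.
  by apply: measurable_indic; exact: measurable_box.
by rewrite integral_indic// ?setIT; [exact: leb3_box_fin|exact: measurable_box].
Qed.

Lemma bounded_support_integrable b : bounded_support b -> integrableR mu b.
Proof.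
move=> [mb [n [M _ bM]]].
by apply: integrableR_le (integrableRZ M (integrableR_box n%:R)) bM.
Qed.

Lemma locint_mul (g b : R3 R -> R) : locint g -> bounded_support b ->
  integrableR mu (fun x => g x * b x).
Proof.
move=> [mg ig] [mb [n [M M0 bM]]].
apply: integrableR_le (integrableRZ M (integrableR_norm (ig n))) _.
  exact: measurable_funM.
move=> x; rewrite !normrM [`|\1__ _|]ger0_norm// mulrC mulrA ler_wpM2r//.
Qed.

Lemma box_le (m n : R) : m <= n -> box m `<=` box n.
Proof.
move=> mn [[x y] z] [[/= h1 h2] h3]; move: h1 h2 h3; rewrite !in_itv/= => h1 h2 h3.
by split; [split|]; rewrite /= in_itv/=; lra.
Qed.

Lemma box_line n (t : R) (i : 'I_3) x (c : R) : box n x -> `|t| <= c -> box (n + c) (x + t *: basis3 R i).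
Proof.
case: x => -[x y] z [[/=]]; rewrite /= !in_itv/= -!ler_norml => hx hy hz tc.
have c0 : 0 <= c by exact: le_trans tc.
have H (b : bool) u : `|u| <= n -> `|u + t * b%:R| <= n + c.
  move=> un; rewrite (le_trans (ler_normD _ _))// lerD// normrM.
  by case: b; rewrite ?normr1 ?normr0 ?mulr1 ?mulr0.
by split; [split|]; rewrite /= in_itv/= -ler_norml; exact: H.
Qed.

Lemma bounded_support_translation b i (t : R) : bounded_support b ->
  bounded_support (fun x => b (x + t *: basis3 R i)).
Proof.
move=> [mb [n [M M0 bM]]]; split.
  exact: (measurableT_comp mb (measurable_translation _)).
exists (n + (Num.truncn `|t|).+1)%N, M => // x.
rewrite (le_trans (bM _))// ler_wpM2l// !indicE ler_nat.
case: (boolP (_ \in _)) => // /set_mem h; rewrite (_ : _ \in _)// inE.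
have -> : x = (x + t *: basis3 R i) + (- t) *: basis3 R i.
  by rewrite -addrA -scalerDl subrr scale0r addr0.
by rewrite natrD; apply: box_line h _; rewrite normrN ltW// truncnS_gt.
Qed.

Lemma locint_translation g i (t : R) : locint g ->
  locint (fun x => g (x + t *: basis3 R i)).
Proof.
move=> [mg ig].
have mt : measurable_fun setT (fun x : R3 R => g (x + t *: basis3 R i)).
  exact: (measurableT_comp mg (measurable_translation (t *: basis3 R i))).
split=> // n.
have := integrableR_translation (t *: basis3 R i) (ig (n + (Num.truncn `|t|).+1)%N).
move=> /integrableR_norm H; apply: (integrableR_le _ H).
  by apply: measurable_funM => //; apply: measurable_indic; exact: measurable_box.
move=> x; rewrite !normrM ler_wpM2r// !indicE !normr_nat ler_nat.
case: (boolP (x \in _)) => // /set_mem h; rewrite (_ : _ \in _)// inE.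
by rewrite natrD; apply: box_line h _; rewrite ltW// truncnS_gt.
Qed.

(* Fubini on lines: for [a], [b] one of which is locally integrable and the
   other bounded with compact support, [\int a(x) \int_0^c b(x + t e) dt dx]
   is computed in either order. *)
Lemma line_fubini (a b : R3 R -> R) (v : R3 R) (c B : R) : measurable_fun setT a ->
  measurable_fun setT b -> 0 <= c ->
  (forall t, `|t| <= c -> integrableR mu (fun x => a x * b (x + t *: v))) ->
  (forall t, `|t| <= c -> \int[mu]_x `|a x * b (x + t *: v)| <= B) ->
  [/\ integrableR mu (fun x => \int[lam]_(t in `[0, c]) (a x * b (x + t *: v))),
      {ae mu, forall x, lam.-integrable `[0, c] (EFin \o (fun t => a x * b (x + t *: v)))} &
  \int[mu]_x \int[lam]_(t in `[0, c]) (a x * b (x + t *: v)) =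
  \int[lam]_(t in `[0, c]) \int[mu]_x (a x * b (x + t *: v))].
Proof.
move=> ma mb c0 iab abB.
have mI : measurable (`[0%R, c]%classic : set (measurableTypeR R)) by exact: measurable_itv.
pose k (z : R3 (measurableTypeR R) * measurableTypeR R) : R := \1_(`[0, c]%classic : set R) z.2 * (a z.1 * b (z.1 + z.2 *: v)).
have mk : measurable_fun setT k.
  apply: measurable_funM.
    apply: measurableT_comp; first exact: measurable_indic.
  exact: measurable_snd.
  apply: measurable_funM; first exact: (measurableT_comp ma measurable_fst).
  exact: (measurableT_comp mb (measurable_line _)).
have kI t : t \in (`[0, c]%classic : set R) -> `|t| <= c.
  by rewrite inE/= in_itv/= => /andP[t0 tc]; rewrite ger0_norm.
have H1 t : integrableR mu (fun x => k (x, t)).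
  rewrite /k /= indicE; case: (boolP (_ \in _)) => [/kI tc|_].
    by under eq_fun do rewrite mul1r; exact: iab.
  by under eq_fun do rewrite mul0r; exact: integrableR0.
pose D t : R := B * \1_(`[0, c]%classic : set R) t.
have H2 t : \int[mu]_x `|k (x, t)| <= D t.
  rewrite /D /k /= indicE; case: (boolP (_ \in _)) => [/kI tc|_].
    by rewrite mulr1; under eq_Rintegral do rewrite mul1r; exact: abB.
  by under eq_Rintegral do rewrite mul0r normr0; rewrite Rintegral_cst// mul0r mulr0.
have H3 : integrableR lam D.
  apply: integrableRZ; apply: integrableR_fin_integral => //.
  have : (lam `[0%R, c]%classic < +oo)%E.
    by rewrite lebesgue_measure_itv/=; case: ifP => // _; rewrite -EFinB ltry.
  by rewrite integral_indic// setIT.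
have ik := integrableR_prod21 mk H1 H2 H3.
have [i1 i2 ae12 E] := fubini_real ik.
have kE x : (fun t => k (x, t)) = (fun t => a x * b (x + t *: v)) \_ `[0, c].
  by apply/funext => t; rewrite patchE /k indicE; case: ifP => _; rewrite ?mul1r ?mul0r.
have k1 x : \int[lam]_t k (x, t) = \int[lam]_(t in `[0, c]) (a x * b (x + t *: v)).
  by rewrite [RHS]Rintegral_mkcond -kE.
split.
- by have := i1; under [X in integrableR _ X]eq_fun do rewrite k1.
- apply: filterS ae12 => x; rewrite /integrableR kE [X in _ -> X]integrable_mkcond//.
  by apply: eq_integrable => // t _; rewrite /= !patchE; case: ifP.
- under eq_Rintegral do rewrite -k1.
  rewrite E [RHS]Rintegral_mkcond; apply: eq_Rintegral => t _.
  rewrite patchE /k /= indicE; case: ifP => _.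
    by apply: eq_Rintegral => x _; rewrite mul1r.
  by under eq_Rintegral do rewrite mul0r; rewrite Rintegral_cst// mul0r.
Qed.

End Lines.

(** * Test functions *)

Section Smooth.
Variable R : realType.
Implicit Types (u v : R3 R -> R) (i : 'I_3) (k : nat).

Lemma is_derive_line (u : R3 R -> R) (x e : R3 R) (d : R) :
  is_derive (0 : R) (1 : R) (fun h : R => u (h *: e + x)) d -> is_derive x e u d.
Proof.
move=> [dl el]; have du : derivable u x e by exact/derivable1P.
split=> //; rewrite -el /derive.
suff -> : (fun h : R => h^-1 *: ((u \o shift x) (h *: e) - u x)) =
  (fun h : R => h^-1 *: (((fun h : R => u (h *: e + x)) \o shift 0) (h *: (1 : R)) - u (0 *: e + x))) by [].
by apply/funext => h; rewrite /= !scale0r !add0r addr0 [h *: 1]mulr1.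
Qed.

Lemma is_derive_line_at (u : R3 R -> R) (x e : R3 R) (t : R) :
  derivable u (x + t *: e) e ->
  is_derive t 1 (fun s : R => u (x + s *: e)) ('D_e u (x + t *: e)).
Proof.
move=> du.
have E : (fun h : R => h^-1 *: (((fun s : R => u (x + s *: e)) \o shift t) (h *: (1:R)) - u (x + t *: e))) =
  (fun h : R => h^-1 *: ((u \o shift (x + t *: e)) (h *: e) - u (x + t *: e))).
  apply/funext => h /=; congr (_ *: (u _ - _)).
  by rewrite [h *: 1]mulr1 scalerDl addrCA.
by split; [rewrite /derivable E|rewrite /derive E].
Qed.

Lemma Ck_continuous k u : Ck k u -> continuous u.
Proof. by case: k => [//|k] []. Qed.

Lemma CkS k u : Ck k.+1 u -> Ck k u.
Proof.
elim: k u => [u|k IH u]; first by case.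
by move=> [cu du pu]; split=> // i; exact/IH.
Qed.

Lemma partialD i u v : (forall x, derivable u x (basis3 R i)) ->
  (forall x, derivable v x (basis3 R i)) ->
  partial i (fun x => u x + v x) = (fun x => partial i u x + partial i v x).
Proof. by move=> du dv; apply/funext => x; rewrite /partial deriveD. Qed.

Lemma partialM i u v : (forall x, derivable u x (basis3 R i)) ->
  (forall x, derivable v x (basis3 R i)) ->
  partial i (fun x => u x * v x) = (fun x => u x * partial i v x + v x * partial i u x).
Proof. by move=> du dv; apply/funext => x; rewrite /partial deriveM. Qed.

Lemma CkD k u v : Ck k u -> Ck k v -> Ck k (fun x => u x + v x).
Proof.
elim: k u v => [u v cu cv|k IH u v [cu du pu] [cv dv pv]].
  by move=> x; apply: cvgD; [exact: cu|exact: cv].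
split.
- by move=> x; apply: cvgD; [exact: cu|exact: cv].
- by move=> i x; apply: derivableD.
- by move=> i; rewrite partialD; [exact: IH (pu i) (pv i)|exact: du|exact: dv].
Qed.

Lemma CkM k u v : Ck k u -> Ck k v -> Ck k (fun x => u x * v x).
Proof.
elim: k u v => [u v cu cv|k IH u v Cu Cv].
  by move=> x; apply: cvgM; [exact: cu|exact: cv].
have [[cu du pu] [cv dv pv]] := (Cu, Cv); split.
- by move=> x; apply: cvgM; [exact: cu|exact: cv].
- by move=> i x; apply: derivableM.
- move=> i; rewrite partialM; [|exact: du|exact: dv].
  by apply: CkD; apply: IH; [exact: CkS|exact: pv|exact: CkS|exact: pu].
Qed.

Lemma Ck_cst k (c : R) : Ck k (fun=> c).
Proof.
elim: k c => [c x|k IH c]; first exact: cvg_cst.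
split; [by move=> x; exact: cvg_cst|by move=> i x; exact: derivable_cst|].
move=> i; rewrite (_ : partial i _ = fun=> 0); first exact: IH.
by apply/funext => x; rewrite /partial derive_cst.
Qed.

Lemma CkZ k (c : R) u : Ck k u -> Ck k (fun x => c * u x).
Proof. exact: CkM (Ck_cst k c). Qed.

Lemma partial_translation i u (a x : R3 R) :
  partial i (fun x => u (x + a)) x = partial i u (x + a).
Proof.
rewrite /partial /derive.
suff -> : (fun h : R => h^-1 *: (((fun x => u (x + a)) \o shift x) (h *: basis3 R i) - u (x + a))) =
  (fun h : R => h^-1 *: ((u \o shift (x + a)) (h *: basis3 R i) - u (x + a))) by [].
by apply/funext => h /=; rewrite addrA.
Qed.

Lemma derivable_translation u (a e x : R3 R) : derivable u (x + a) e ->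
  derivable (fun x => u (x + a)) x e.
Proof.
rewrite /derivable; suff -> : (fun h : R => h^-1 *: ((u \o shift (x + a)) (h *: e) - u (x + a))) =
  (fun h : R => h^-1 *: (((fun x => u (x + a)) \o shift x) (h *: e) - u (x + a))) by [].
by apply/funext => h /=; rewrite addrA.
Qed.

Lemma Ck_translation k u (a : R3 R) : Ck k u -> Ck k (fun x => u (x + a)).
Proof.
have ct (w : R3 R -> R) : continuous w -> continuous (fun x : R3 R => w (x + a)).
  move=> cw x; apply: continuous_comp; last exact: cw.
  by apply: cvgD; [exact: cvg_id|exact: cvg_cst].
elim: k u => [u cu|k IH u [cu du pu]]; first exact: ct.
split; first exact: ct.
  by move=> i x; exact: derivable_translation.
move=> i; rewrite (_ : partial i _ = fun x => partial i u (x + a)); first exact: IH (pu i).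
by apply/funext => x; exact: partial_translation.
Qed.

(** The partial derivatives of D n o l are constant multiples of D n.+1 o l, so a whole chain of
    derivatives has to be carried for the induction on k to close. *)
Lemma Ck_affine (D : nat -> R -> R) (l : R3 R -> R) (c : 'I_3 -> R) :
  (forall n x, is_derive x (1 : R) (D n) (D n.+1 x)) -> continuous l ->
  (forall i t x, l (t *: basis3 R i + x) = t * c i + l x) ->
  forall k n, Ck k (fun x => D n (l x)).
Proof.
move=> dD cl lE; elim=> [|k IH] n.
  move=> x; apply: continuous_comp; first exact: cl.
  by apply: differentiable_continuous; apply/derivable1_diffP; case: (dD n (l x)).
have der i x : is_derive x (basis3 R i) (fun x => D n (l x)) (c i * D n.+1 (l x)).
  apply: is_derive_line; under eq_fun do rewrite lE.
  have dl : is_derive (0 : R) (1 : R) (fun h : R => h * c i + l x) (c i).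
    have := is_deriveD (is_deriveZ (c i) (is_derive_id (0:R) (1:R))) (is_derive_cst (l x) (0:R) (1:R)).
    rewrite addr0 [_ *: 1]mulr1; congr is_derive.
    by apply/funext => h; rewrite /= mulrC.
  have := dD n (0 * c i + l x).
  move=> dn; have := @is_derive1_comp _ (D n) (fun h : R => h * c i + l x) 0 _ _ dn dl.
  by rewrite mul0r add0r mulrC.
split.
- exact: Ck_continuous (IH n).
- by move=> i x; case: (der i x).
- move=> i; rewrite (_ : partial i _ = fun x => c i * D n.+1 (l x)); first exact: CkZ.
  by apply/funext => x; rewrite /partial; case: (der i x).
Qed.

(** Read at y = 1/x, e^(-1/x) absorbs every polynomial in 1/x. Termwise, y^n e^(-y) <= n^n because
    y/n <= 1 + y/n <= e^(y/n). *)
Lemma horner_expR_bounded (P : {poly R}) :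
  exists2 C : R, 0 < C & forall y, 0 < y -> `|P.[y]| * expR (- y) <= C.
Proof.
have mono n (y : R) : 0 < y -> y ^+ n * expR (- y) <= n%:R ^+ n.
  move=> y0; case: n => [|n]; first by rewrite !expr0 mul1r -expR0 ler_expR oppr_le0 ltW.
  rewrite expRN ler_pdivrMr ?expR_gt0//.
  have n0 : 0 < n.+1%:R :> R by [].
  have -> : y = n.+1%:R * (y / n.+1%:R) by field; rewrite gt_eqF.
  rewrite exprMn ler_pM2l ?exprn_gt0// expRM_natl lerXn2r ?nnegrE ?expR_ge0 ?divr_ge0 ?(ltW y0)//.
  by rewrite (le_trans _ (expR_ge1Dx _))// lerDr.
elim/poly_ind : P => [|P c [C C0 HC]].
  by exists 1 => // y y0; rewrite horner0 normr0 mul0r.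
exists (\sum_(i < size (P * 'X + c%:P)) `|(P * 'X + c%:P)`_i| * i%:R ^+ i + 1).
  by rewrite ltr_wpDl// sumr_ge0// => i _; rewrite mulr_ge0 ?exprn_ge0.
move=> y y0; rewrite horner_coef.
apply: (@le_trans _ _ (\sum_(i < size (P * 'X + c%:P)) `|(P * 'X + c%:P)`_i| * i%:R ^+ i)); last by rewrite lerDl.
apply: le_trans (ler_wpM2r (expR_ge0 _) (ler_norm_sum _ _ _)) _.
rewrite mulr_suml ler_sum// => i _; rewrite normrM -mulrA ler_wpM2l//.
by rewrite normrX (gtr0_norm y0) mono.
Qed.

(** The family P(1/x) e^(-1/x), extended by 0 to x <= 0. The polynomial factor makes it stable under
    differentiation, which sends P to (P - P') X^2; P = 1 is the classical flat function. *)
Definition flat (P : {poly R}) (x : R) : R :=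
  if 0 < x then P.[x^-1] * expR (- x^-1) else 0.

Lemma is_derive_flat P x :
  is_derive x (1 : R) (flat P) (flat ((P - P^`()) * 'X^2) x).
Proof.
have [x0|x0|->] := ltgtP x 0.
- rewrite {2}/flat ltNge (ltW x0)/=.
  apply: (near_eq_is_derive (f := fun=> 0)).
    have : \forall y \near x, y < 0 by exact: lt_nbhsl.
    by apply: filterS => y y0; rewrite /flat ltNge (ltW y0).
- rewrite {2}/flat x0.
  have nE : \forall y \near x, P.[y^-1] * expR (- y^-1) = flat P y.
    have : \forall y \near x, 0 < y by exact: lt_nbhsr.
    by apply: filterS => y y0; rewrite /flat y0.
  apply: (near_eq_is_derive nE).
  have xn : x != 0 by rewrite gt_eqF.
  have dV : is_derive x (1:R) (fun y : R => y^-1) (- x ^- 2).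
    by have := is_deriveV xn (is_derive_id x (1:R)); rewrite [_ *: 1]mulr1.
  have dP : is_derive x (1:R) (fun y : R => P.[y^-1]) ((P^`()).[x^-1] * (- x ^- 2)).
    have := @is_derive1_comp _ (horner P) (fun y : R => y^-1) x _ _ (is_derive_poly P x^-1) dV.
    exact.
  have dE : is_derive x (1:R) (fun y : R => expR (- y^-1)) (expR (- x^-1) * x ^- 2).
    have dN := is_deriveN dV; rewrite opprK in dN.
    exact: (@is_derive1_comp _ expR (fun y : R => - y^-1) x _ _ (is_derive_expR (- x^-1)) dN).
  have := is_deriveM dP dE.
  congr is_derive; rewrite hornerM hornerXn hornerD hornerN /GRing.scale/=.
  by rewrite -exprVn; ring.
(* The factor X^2 yields |flat P y| <= C y^2, one order better than the difference quotient at 0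
   requires. *)
- have [C C0 HC] := horner_expR_bounded (P * 'X^2).
  rewrite {2}/flat ltxx.

  have F0 (y : R) : y != 0 -> `|flat P y / y| <= C * `|y|.
    move=> yn; have [y0|y0|y0] := ltgtP y 0; last by rewrite y0 eqxx in yn.
      by rewrite /flat ltNge (ltW y0)/= mul0r normr0 mulr_ge0// ltW.
    have := HC y^-1; rewrite invr_gt0 => /(_ y0); rewrite hornerM hornerXn => h.
    rewrite /flat y0 !normrM (gtr0_norm (expR_gt0 _)) normfV (gtr0_norm y0).
    rewrite ler_pdivrMr// -mulrA -expr2.
    have := ler_wpM2r (sqr_ge0 y) h; apply: le_trans.
    rewrite normrM [`|y^-1 ^+ 2|]ger0_norm ?sqr_ge0// mulrAC -!mulrA ler_wpM2l//.
    by rewrite le_eqVlt; apply/orP; left; apply/eqP; field.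
  have lim0 : (fun h : R => h^-1 *: ((flat P \o shift 0) (h *: (1:R)) - flat P 0)) @ 0^' --> (0:R).
    apply/cvgrPdist_le => e e0.
    have : \forall h \near (0:R)^', `|h| < e / C.
      by apply: dnbhs0_lt; rewrite divr_gt0.
    have : \forall h \near (0:R)^', h != 0 by exact: nbhs_dnbhs_neq.
    apply: filterS2 => h h0 he; rewrite sub0r normrN /= addr0 [h *: 1]mulr1.
    rewrite {2}/flat ltxx subr0 [_ *: _]mulrC (le_trans (F0 h h0))//.
    by rewrite mulrC -ler_pdivlMr// ltW.
  split; last by apply/cvg_lim.
  by apply/cvg_ex; exists 0.
Qed.

Lemma flat1_ge0 x : 0 <= flat 1 x.
Proof. by rewrite /flat; case: ifP => // _; rewrite hornerC mul1r expR_ge0. Qed.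

Lemma flat1_le1 x : flat 1 x <= 1.
Proof.
rewrite /flat; case: ifP => [x0|_]; last exact: ler01.
by rewrite hornerC mul1r -expR0 ler_expR oppr_le0 invr_ge0 ltW.
Qed.

Lemma flat1_cvg x : 0 < x -> (fun n : nat => flat 1 (n%:R * x)) @ \oo --> (1:R).
Proof.
move=> x0; apply/cvgrPdist_le => e e0.
have ce : (fun y : R => expR (- (y * x^-1))) @ (0:R) --> (1:R).
  have -> : 1 = expR (- (0 * x^-1)) :> R by rewrite mul0r oppr0 expR0.
  apply: continuous_comp; last exact: continuous_expR.
  by apply: cvgN; apply: cvgM; [exact: cvg_id|exact: cvg_cst].
have cn : (fun n : nat => expR (- (n.+1%:R^-1 * x^-1))) @ \oo --> (1:R).
  exact: (cvg_comp _ _ (@cvg_harmonic R) ce).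
move: cn => /cvgrPdist_le /(_ _ e0) [N _ HN].
exists N.+1 => // -[//|n] /= Nn.
rewrite /flat mulr_gt0// hornerC mul1r invfM.
exact: HN.
Qed.

Definition flat1_derivatives (m : nat) : R -> R :=
  flat (iter m (fun P => (P - P^`()) * 'X^2) 1).

Lemma Ck_flat1 (l : R3 R -> R) (c : 'I_3 -> R) : continuous l ->
  (forall i t x, l (t *: basis3 R i + x) = t * c i + l x) ->
  forall k, Ck k (fun x => flat 1 (l x)).
Proof.
move=> cl lE k; apply: (@Ck_affine flat1_derivatives l c _ cl lE k 0%N) => n x.
exact: is_derive_flat.
Qed.

Lemma continuous_x1 : continuous (fun x : R3 R => x.1.1).
Proof. by move=> x; apply: (@continuous_comp _ _ _ fst fst); exact: cvg_fst. Qed.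
Lemma continuous_x2 : continuous (fun x : R3 R => x.1.2).
Proof.
move=> x; apply: (@continuous_comp _ _ _ fst snd); [exact: cvg_fst|exact: cvg_snd].
Qed.

Lemma continuous_x3 : continuous (fun x : R3 R => x.2).
Proof. by move=> x; exact: cvg_snd. Qed.

Lemma Ck_flat1_coord (pr : R3 R -> R) (c : 'I_3 -> R) (s d : R) : continuous pr ->
  (forall i t x, pr (t *: basis3 R i + x) = t * c i + pr x) ->
  forall k, Ck k (fun x => flat 1 (s * (pr x) + d)).
Proof.
move=> cp pE; apply: (@Ck_flat1 (fun x => s * pr x + d) (fun i => s * c i)).
  by move=> x; apply: cvgD; [apply: cvgM; [exact: cvg_cst|exact: cp]|exact: cvg_cst].
by move=> i t x; rewrite pE; ring.
Qed.

(** As n grows these smooth bumps converge pointwise to the indicator of the open interval while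
    staying in [0, 1]: they are what lets test functions detect integrals over boxes. *)
Definition bump1 (n : nat) (a b x : R) : R := flat 1 (n%:R * (x - a)) * flat 1 (n%:R * (b - x)).

Lemma bump1_ge0 n a b x : 0 <= bump1 n a b x.
Proof. by rewrite mulr_ge0 ?flat1_ge0. Qed.

Lemma bump1_le1 n a b x : bump1 n a b x <= 1.
Proof. by rewrite mulr_ile1 ?flat1_ge0 ?flat1_le1. Qed.

Lemma bump1_out n a b x : ~ (a < x < b) -> bump1 n a b x = 0.
Proof.
move=> /negP; rewrite negb_and -!leNgt /bump1 /flat => /orP[h|h].
  by rewrite ltNge mulr_ge0_le0 ?subr_le0//= mul0r.
by rewrite [X in _ * X]ifF ?mulr0//; apply/negbTE; rewrite -leNgt mulr_ge0_le0 ?subr_le0.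
Qed.

Lemma bump1_cvg a b x : (fun n => bump1 n a b x) @ \oo --> (\1_(`]a, b[%classic : set R) x : R).
Proof.
rewrite indicE; case: (boolP (x \in _)) => [|/negP] xab.
  move: xab; rewrite inE/= in_itv/= => /andP[ax xb].
  rewrite -[X in _ --> X]mulr1; apply: cvgM; apply: flat1_cvg; lra.
rewrite (_ : (fun n => _) = fun=> 0); first exact: cvg_cst.
apply/funext => n; apply: bump1_out => h; apply: xab; by rewrite inE/= in_itv.
Qed.

Lemma Ck_bump1 n a b (pr : R3 R -> R) (c : 'I_3 -> R) : continuous pr ->
  (forall i t x, pr (t *: basis3 R i + x) = t * c i + pr x) ->
  forall k, Ck k (fun x => bump1 n a b (pr x)).
Proof.
move=> cp pE k; apply: CkM.
  have := Ck_flat1_coord n%:R (- n%:R * a) cp pE k; congr Ck.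
  by apply/funext => x; congr flat; ring.
have := Ck_flat1_coord (- n%:R) (n%:R * b) cp pE k; congr Ck.
by apply/funext => x; congr flat; ring.
Qed.

Definition bump3 (n : nat) (a b : R3 R) (x : R3 R) : R :=
  bump1 n a.1.1 b.1.1 x.1.1 * bump1 n a.1.2 b.1.2 x.1.2 * bump1 n a.2 b.2 x.2.

Lemma Ck_bump3 n a b k : Ck k (bump3 n a b).
Proof.
apply: CkM; first apply: CkM.
- by apply: (@Ck_bump1 _ _ _ _ (fun i => (val i == 0%N)%:R)) => //; exact: continuous_x1.
- by apply: (@Ck_bump1 _ _ _ _ (fun i => (val i == 1%N)%:R)) => //; exact: continuous_x2.
- by apply: (@Ck_bump1 _ _ _ _ (fun i => (val i == 2%N)%:R)) => //; exact: continuous_x3.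
Qed.

Lemma test_functionP u : test_function u <->
  (forall k, Ck k u) /\ exists n : nat, forall x, u x != 0 -> box n%:R x.
Proof.
split=> [[Cu cu]|[Cu [n un]]]; split=> //.
  have [n Kn] := compact_sub_box cu; exists n => x ux; apply: Kn.
  exact: subset_closure.
apply: (subclosed_compact _ (@compact_box R n%:R)); first exact: closed_closure.
suff : closure [set x | u x != 0] `<=` box n%:R by [].
have /closure_id -> : closed (box n%:R : set (R3 R)).
  by apply: compact_closed; [exact: norm_hausdorff|exact: compact_box].
by apply: closureS => x; exact: un.
Qed.

Definition obox (a b : R3 R) : set (R3 R) :=
  `]a.1.1, b.1.1[%classic `*` `]a.1.2, b.1.2[%classic `*` `]a.2, b.2[%classic.

Lemma bump3_out n a b x : ~ obox a b x -> bump3 n a b x = 0.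
Proof.
move=> xab; apply/eqP/negPn/negP; rewrite mulf_eq0 negb_or => /andP[+ hz].
rewrite mulf_eq0 negb_or => /andP[hx hy]; apply: xab.
have out s t w : bump1 n s t w != 0 -> s < w < t.
  by move=> h; apply: contrapT => /bump1_out h'; rewrite h' eqxx in h.
by split; [split|]; rewrite /= in_itv/=; exact: out.
Qed.

Lemma bump3_le_indic n a b x : `|bump3 n a b x| <= \1_(obox a b) x.
Proof.
rewrite indicE; case: (boolP (x \in _)) => [_|/negP xab].
  have b0 : 0 <= bump3 n a b x by do 2 (apply: mulr_ge0; last exact: bump1_ge0); exact: bump1_ge0.
  rewrite (ger0_norm b0) /bump3.
  suff : bump1 n a.1.1 b.1.1 x.1.1 * bump1 n a.1.2 b.1.2 x.1.2 * bump1 n a.2 b.2 x.2 <= 1 by [].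
  by apply: mulr_ile1; [apply: mulr_ge0; exact: bump1_ge0|exact: bump1_ge0|
    apply: mulr_ile1; rewrite ?bump1_ge0 ?bump1_le1|exact: bump1_le1].
by rewrite bump3_out ?normr0// => h; apply: xab; rewrite inE.
Qed.

Lemma bump3_cvg a b x : (fun n => bump3 n a b x) @ \oo --> (\1_(obox a b) x : R).
Proof.
have -> : \1_(obox a b) x = \1_(`]a.1.1, b.1.1[%classic : set R) x.1.1 *
   \1_(`]a.1.2, b.1.2[%classic : set R) x.1.2 * \1_(`]a.2, b.2[%classic : set R) x.2 :> R.
  by rewrite !indicE /obox !in_setX; do 3 case: (_ \in _) => //=; rewrite ?mulr1 ?mul1r ?mulr0 ?mul0r.
by apply: cvgM; [apply: cvgM|]; exact: bump1_cvg.
Qed.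

Lemma obox_sub_box a b : exists n : nat, obox a b `<=` box n%:R.
Proof.
pose M (s t : R) := (Num.truncn (`|s| + `|t|)).+1.
have MP (s t x : R) : s < x < t -> `|x| <= (M s t)%:R.
  move=> /andP[sx xt]; rewrite (le_trans _ (ltW (truncnS_gt _)))//.
  have := ler_norm t; have := ler_norm (- s); rewrite normrN ler_norml => h1 h2.
  have := normr_ge0 s; have := normr_ge0 t => h3 h4; apply/andP; split; lra.
exists (M a.1.1 b.1.1 + M a.1.2 b.1.2 + M a.2 b.2)%N => -[[x y] z] [[/=]].
rewrite !in_itv/= => hx hy hz.
have H (w : R) m : `|w| <= m%:R -> (m <= M a.1.1 b.1.1 + M a.1.2 b.1.2 + M a.2 b.2)%N ->
  `|w| <= (M a.1.1 b.1.1 + M a.1.2 b.1.2 + M a.2 b.2)%:R.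
  by move=> wm mM; rewrite (le_trans wm)// ler_nat.
split; [split|]; rewrite /= in_itv/= -ler_norml.
- by apply: H (MP _ _ _ hx) _; rewrite -addnA leq_addr.
- by apply: H (MP _ _ _ hy) _; rewrite addnAC leq_addl.
- by apply: H (MP _ _ _ hz) _; rewrite leq_addl.
Qed.

Lemma test_function_bump3 n a b : test_function (bump3 n a b).
Proof.
apply/test_functionP; split; first by move=> k; exact: Ck_bump3.
have [N abN] := obox_sub_box a b; exists N => x; apply: contraNP => xN.
by apply/eqP/bump3_out => /abN.
Qed.

Lemma test_functionD u v : test_function u -> test_function v ->
  test_function (fun x => u x + v x).
Proof.
move=> /test_functionP[Cu [m um]] /test_functionP[Cv [n vn]]; apply/test_functionP.
split; first by move=> k; exact: CkD.
exists (m + n)%N => x uv; have [u0|/um bx] := eqVneq (u x) 0.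
  have /vn : v x != 0 by apply: contra_neq uv => ->; rewrite u0 addr0.
  by apply: box_le; rewrite ler_nat leq_addl.
by apply: box_le bx; rewrite ler_nat leq_addr.
Qed.

Lemma test_functionZ (c : R) u : test_function u -> test_function (fun x => c * u x).
Proof.
move=> /test_functionP[Cu [m um]]; apply/test_functionP.
split; first by move=> k; exact: CkZ.
exists m => x cu; apply: um; apply: contra_neq cu => ->; exact: mulr0.
Qed.

Lemma test_function0 : test_function (fun=> 0 : R).
Proof.
apply/test_functionP; split; first by move=> k; exact: Ck_cst.
by exists 0%N => x; rewrite eqxx.
Qed.

Lemma test_functionM u v : test_function u -> test_function v ->
  test_function (fun x => u x * v x).
Proof.
move=> /test_functionP[Cu [m um]] /test_functionP[Cv [n vn]]; apply/test_functionP.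
split; first by move=> k; exact: CkM.
by exists m => x; rewrite mulf_eq0 negb_or => /andP[/um].
Qed.

Lemma test_function_translation u i (t : R) : test_function u ->
  test_function (fun x => u (x + t *: basis3 R i)).
Proof.
move=> /test_functionP[Cu [m um]]; apply/test_functionP.
split; first by move=> k; exact: Ck_translation.
exists (m + (Num.truncn `|t|).+1)%N => x /um bx.
have -> : x = (x + t *: basis3 R i) + (- t) *: basis3 R i.
  by rewrite -addrA -scalerDl subrr scale0r addr0.
by rewrite natrD; apply: box_line bx _; rewrite normrN ltW// truncnS_gt.
Qed.

Lemma test_function_partial u i : test_function u -> test_function (partial i u).
Proof.
move=> /test_functionP[Cu [m um]]; apply/test_functionP.
split; first by move=> k; have [_ _ p] := Cu k.+1; exact: p.
(* The box grows by one so that a point outside it has a whole ball on which u vanishes. *)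
exists m.+1 => x; apply: contraNP => xb.
rewrite /partial (@near_eq_derive _ _ _ _ (fun=> 0)) ?derive_cst//.
apply/nbhs_ballP; exists 1 => //= y xy; apply/eqP; apply/negPn/negP => /um ym.
apply: xb; case: x y xy ym => -[x1 x2] x3 [[y1 y2] y3] [[/= h1 h2] h3].
move=> [[/=]]; rewrite !in_itv/= -!ler_norml => k1 k2 k3.
have H (s t : R) : ball s 1 t -> `|t| <= m%:R -> `|s| <= m.+1%:R.
  rewrite /ball/= => st tm; have -> : s = t + (s - t) by ring.
  by rewrite -addn1 natrD (le_trans (ler_normD _ _))// lerD// ltW.
by split; [split|]; rewrite /= in_itv/= -ler_norml; [exact: H h1 k1|exact: H h2 k2|exact: H h3 k3].
Qed.

Lemma test_function_continuous u : test_function u -> continuous u.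
Proof. by move=> [Cu _]; exact: Cu 0%N. Qed.

Lemma test_function_bounded_support u : test_function u -> bounded_support u.
Proof.
move=> tu; have cu := test_function_continuous tu.
split; first exact: continuous_measurable3.
have /test_functionP[_ [n un]] := tu; exists n.
have cb : compact (u @` (box n%:R)).
  by apply: continuous_compact; [exact: continuous_subspaceT|exact: compact_box].
have [M [_ /(_ (`|M| + 1))]] := compact_bounded cb.
rewrite (le_lt_trans (ler_norm M)) ?ltrDl// => /(_ isT) uM.
exists (`|M| + 1) => [|x]; first by rewrite addr_ge0.
rewrite indicE; case: (boolP (x \in _)) => [/set_mem bx|/negP xb].
  by rewrite mulr1; apply: uM; exists x.
suff -> : u x = 0 by rewrite normr0 mulr0.
by apply/eqP; apply/negPn/negP => /un bx; apply: xb; rewrite inE.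
Qed.

End Smooth.

(** * The fundamental lemma of the calculus of variations *)

Section DynkinIntegral.
Context d (T : measurableType d) d' (T' : measurableType d') (R : realType).
Variable m : {measure set T -> \bar R}.

(** The sets S for which the integral vanishes form a lambda-system, by additivity and countable
    additivity. [phi] singles out one coordinate and [W] freezes conditions on the others, so the
    argument can be applied to one coordinate at a time. *)
Lemma dynkin_integral (f : T -> \bar R) (W : set T) (phi : T -> T')
    (G : set (set T')) : m.-integrable setT f -> measurable W ->
  measurable_fun setT phi -> @measurable _ T' = <<s G >> -> setI_closed G ->
  (\int[m]_(x in W) f x = 0)%E ->
  (forall S, G S -> \int[m]_(x in W `&` phi @^-1` S) f x = 0)%E ->
  (forall S, measurable S -> \int[m]_(x in W `&` phi @^-1` S) f x = 0)%E.
Proof.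
move=> fi mW mphi mG GI W0 G0 S; rewrite mG; move: S.
have mS S : measurable S -> measurable (W `&` phi @^-1` S).
  by move=> mS; apply: measurableI => //; rewrite -[X in measurable X]setTI; exact: mphi.
have fW V : measurable V -> m.-integrable V f by move=> mV; exact: integrableS fi.
apply: dynkin_induction => //.
- by rewrite preimage_setT setIT.
- move=> S mS' S0; move: W0.
  have {1}-> : W = (W `&` phi @^-1` S) `|` (W `&` phi @^-1` (~` S)).
    by rewrite -setIUr -preimage_setU setUv preimage_setT setIT.
  rewrite integral_setU; first by rewrite S0 add0e.
  + exact: mS.
  + by apply: mS; exact: measurableC.
  + by apply: measurable_funS (measurable_int _ fi) => //; apply: measurableU; apply: mS => //; exact: measurableC.
  + by apply/disj_setPS => x [[_ h1] [_ h2]]; exact: h2.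
- move=> F mF tF F0; rewrite preimage_bigcup setI_bigcupr.
  rewrite integral_bigcup//.
  + by rewrite eseries0// => i _ _; rewrite F0.
  + move/trivIsetP : tF => tF; apply/trivIsetP => i j _ _ ij.
    rewrite setIACA setIid -preimage_setI (tF i j)// preimage_set0 setI0//.
  + by move=> k; exact: mS.
  + by apply: fW; apply: bigcupT_measurable => k; exact: mS.
Qed.

End DynkinIntegral.

Section DominatedConvergence.
Context d (T : measurableType d) (R : realType).
Variable m : {measure set T -> \bar R}.
Implicit Types f g h : T -> R.

Lemma EFin_Rintegral f : integrableR m f ->
  (\int[m]_x (f x)%:E = (\int[m]_x f x)%:E)%E.
Proof. by move=> sf; rewrite /Rintegral fineK//; exact: integrable_fin_num sf. Qed.

Lemma Rintegral_dominated_cvg (F : nat -> T -> R) f h :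
  (forall n, measurable_fun setT (F n)) ->
  (forall x, F n x @[n --> \oo] --> f x) -> integrableR m h ->
  (forall n x, `|F n x| <= h x) ->
  integrableR m f /\ \int[m]_x F n x @[n --> \oo] --> \int[m]_x f x.
Proof.
move=> mF Ff ih Fh.
have mF' n : measurable_fun setT (fun x => (F n x)%:E) by exact/measurable_EFinP.
have Ff' x : setT x -> (fun n => (F n x)%:E) @ \oo --> (f x)%:E.
  by move=> _; apply: cvg_EFin; [exact: nearW|exact: Ff].
have mf : measurable_fun setT (EFin \o f).
  exact: (emeasurable_fun_cvg _ _ mF' Ff').
have Fh' n x : setT x -> (`|(F n x)%:E| <= (h x)%:E)%E by move=> _; rewrite lee_fin.
have [if_ _ cv] := @dominated_convergence _ _ R m setT measurableT
  (fun n x => (F n x)%:E) (EFin \o f) (EFin \o h) mF' mf (aeW _ Ff') ih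
  (aeW _ (fun x n => Fh' n x)).
split=> //; have iF n : integrableR m (F n) by exact: (integrableR_le (mF n) ih (Fh n)).
by move: cv; rewrite (EFin_Rintegral if_) => /fine_cvg.
Qed.


End DominatedConvergence.

Section FundamentalLemma.
Variable R : realType.
Local Notation mu := (@leb3 R).
Local Notation R1 := (measurableTypeR R).

Definition cube (n : R) : set (R3 R1) :=
  `]-n, n[%classic `*` `]-n, n[%classic `*` `]-n, n[%classic.

Lemma measurable_obox (a b : R3 R) : measurable (obox a b).
Proof. by apply: measurableX; [apply: measurableX|]; exact: measurable_itv. Qed.

Lemma integral_obox (g : R3 R -> R) (a b : R3 R) : locint g ->
  (forall eta, test_function eta -> \int[mu]_x (g x * eta x) = 0) ->
  (\int[mu]_(x in obox a b) (g x)%:E = 0)%E.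
Proof.
move=> lg g0; have mQ := measurable_obox a b.
have mg := lg.1.
have mI : measurable_fun setT (\1_(obox a b) : R3 R -> R) by exact: measurable_indic.
have sI : bounded_support (\1_(obox a b) : R3 R -> R).
  split=> //; have [n nab] := obox_sub_box a b; exists n, 1 => // x.
  rewrite mul1r !indicE normr_nat ler_nat.
  by case: (boolP (x \in obox a b)) => // /set_mem /nab ?; rewrite (_ : x \in box _)// inE.
have ig := locint_mul lg sI.
have mF n : measurable_fun setT (fun x => g x * bump3 n a b x).
  exact: (measurable_funM mg (test_function_bounded_support (test_function_bump3 n a b)).1).
have cF x : (fun n => g x * bump3 n a b x) @ \oo --> g x * \1_(obox a b) x.
  by apply: cvgM; [exact: cvg_cst|exact: bump3_cvg].
have bF n x : `|g x * bump3 n a b x| <= `|g x * \1_(obox a b) x|.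
  rewrite normrM [leRHS]normrM; apply: ler_wpM2l => //.
  by apply: le_trans (bump3_le_indic _ _ _ _) _; exact: ler_norm.
have ig' : integrableR mu (fun x => `|g x * \1_(obox a b) x|) by exact: (integrableR_norm ig).
have [_] := @Rintegral_dominated_cvg _ _ R mu _ _ _ mF cF ig' bF.
under eq_fun do rewrite (g0 _ (test_function_bump3 _ a b)).
move=> /(cvg_unique _ (cvg_cst 0)) => /(_ (@Rhausdorff R)) E.
rewrite integral_mkcond -[RHS]/(0%:E) E -EFin_Rintegral//.
apply: eq_integral => x _; rewrite patchE indicE.
by case: ifP; rewrite ?mulr1 ?mulr0.
Qed.


(** Upgrades one coordinate from rays to Borel sets. Since h lives where pr > c, the ray starting at
    c plays the role of the whole line, with which the lambda-system argument begins. *)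
Lemma integral_ray (h : R3 R -> R) (c : R) (pr : R3 R1 -> R1) (W : set (R3 R1)) :
  integrableR mu h -> measurable_fun setT pr -> measurable W ->
  (forall x, h x != 0 -> c < pr x) ->
  (forall a, \int[mu]_(x in W `&` pr @^-1` `]a, +oo[) (h x)%:E = 0)%E ->
  forall S, measurable S -> (\int[mu]_(x in W `&` pr @^-1` S) (h x)%:E = 0)%E.
Proof.
move=> ih mpr mW hc H0.
apply: (@dynkin_integral _ _ _ _ _ mu (EFin \o h) W pr (@RGenOInfty.G R)) => //.
- exact: RGenOInfty.measurableE.
- move=> _ _ [a ->] [b ->]; exists (Num.max a b); apply/seteqP; split=> x /=.
    by rewrite !in_itv/= !andbT gt_max => -[-> ->].
  by rewrite !in_itv/= !andbT gt_max => /andP[].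
- rewrite -[RHS](H0 c); rewrite [LHS]integral_mkcond [RHS]integral_mkcond.
  apply: eq_integral => x _; rewrite !patchE /=.
  have [->|/hc cx] := eqVneq (h x) 0; first by do 2 case: ifP.
  congr (if _ then _ else _); rewrite in_setI (_ : x \in pr @^-1` _ = true) ?andbT//.
  by apply: mem_set; rewrite /= in_itv/= cx.
- by move=> _ [a ->]; exact: H0.
Qed.

(** The support condition lets every upper end of a box be pushed to infinity, so rays in all three
    coordinates come for free; then the coordinates pass from rays to Borel sets one after the
    other. *)
Lemma integral_all_eq0 (h : R3 R -> R) (n : nat) : integrableR mu h ->
  (forall x, ~ obox (- n%:R, - n%:R, - n%:R) (n%:R, n%:R, n%:R) x -> h x = 0) ->
  (forall a b, (\int[mu]_(x in obox a b) (h x)%:E = 0)%E) ->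
  forall S, measurable S -> (\int[mu]_(x in S) (h x)%:E = 0)%E.
Proof.
move=> ih hn h0.
pose p1 (x : R3 R1) : R1 := x.1.1; pose p2 (x : R3 R1) : R1 := x.1.2; pose p3 (x : R3 R1) : R1 := x.2.
have m1 : measurable_fun setT p1 by apply: measurableT_comp => //; exact: measurable_fst.
have m2 : measurable_fun setT p2 by apply: measurableT_comp => //; exact: measurable_fst.
have m3 : measurable_fun setT p3 by exact: measurable_snd.
have mp (pr : R3 R1 -> R1) S : measurable_fun setT pr -> measurable S -> measurable (pr @^-1` S).
  by move=> mpr mS; rewrite -[X in measurable X]setTI; exact: mpr.
have hb x : h x != 0 -> obox (- n%:R, - n%:R, - n%:R) (n%:R, n%:R, n%:R) x.
  by apply: contraNP => /hn ->.
have b1 x : h x != 0 -> - n%:R < p1 x.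
  by move=> /hb[[/=]]; rewrite in_itv/= => /andP[].
have b2 x : h x != 0 -> - n%:R < p2 x.
  by move=> /hb[[/= _]]; rewrite in_itv/= => /andP[].
have b3 x : h x != 0 -> - n%:R < p3 x.
  by move=> /hb[[/= _ _]]; rewrite in_itv/= => /andP[].
have mr a : measurable (`]a, +oo[%classic : set R1) by exact: measurable_itv.
have H a b c : (\int[mu]_(x in (p2 @^-1` `]b, +oo[ `&` p3 @^-1` `]c, +oo[)
    `&` p1 @^-1` `]a, +oo[) (h x)%:E = 0)%E.
  rewrite -[RHS](h0 (a, b, c) (n%:R, n%:R, n%:R)) [LHS]integral_mkcond [RHS]integral_mkcond.
  apply: eq_integral => x _; rewrite !patchE /=.
  have [->|/hb hx] := eqVneq (h x) 0; first by do 2 case: ifP.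
  congr (if _ then _ else _); apply/idP/idP; rewrite !inE /= /p1 /p2 /p3 !in_itv/= !andbT.
    move=> [[x2 x3] x1]; move: hx => -[[/=]]; rewrite !in_itv/=.
    by move=> /andP[_ ?] /andP[_ ?] /andP[_ ?]; split; [split|]; rewrite /= in_itv/=; apply/andP; split.
  by move=> -[[/=]]; rewrite !in_itv/= => /andP[? _] /andP[? _] /andP[? _].
have H1 A b c : measurable A -> (\int[mu]_(x in (p3 @^-1` `]c, +oo[ `&` p1 @^-1` A)
    `&` p2 @^-1` `]b, +oo[) (h x)%:E = 0)%E.
  move=> mA; rewrite -[LHS](_ : \int[mu]_(x in (p2 @^-1` `]b, +oo[ `&` p3 @^-1` `]c, +oo[)
    `&` p1 @^-1` A) (h x)%:E = _)%E; last first.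
    by congr (integral _ _ _); rewrite [RHS]setIC setIA.
  by apply: (@integral_ray h (- n%:R) p1) => //; apply: measurableI; exact: mp.
have H2 A B c : measurable A -> measurable B -> (\int[mu]_(x in (p1 @^-1` A `&` p2 @^-1` B)
    `&` p3 @^-1` `]c, +oo[) (h x)%:E = 0)%E.
  move=> mA mB; rewrite -[LHS](_ : \int[mu]_(x in (p3 @^-1` `]c, +oo[ `&` p1 @^-1` A)
    `&` p2 @^-1` B) (h x)%:E = _)%E; last first.
    by congr (integral _ _ _); rewrite [RHS]setIC setIA.
  apply: (@integral_ray h (- n%:R) p2) => //; first by apply: measurableI; exact: mp.
  by move=> b; exact: H1.
have H3 A B C : measurable A -> measurable B -> measurable C ->
    (\int[mu]_(x in (p1 @^-1` A `&` p2 @^-1` B) `&` p3 @^-1` C) (h x)%:E = 0)%E.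
  move=> mA mB mC; apply: (@integral_ray h (- n%:R) p3) => //; first by apply: measurableI; exact: mp.
  by move=> c; exact: H2.
(* The sigma-algebra is an iterated product, so rectangles generate it in two rounds: the first pair
   of coordinates, then that pair with the third coordinate. *)
pose q (x : R3 R1) : R1 * R1 := x.1.
have mq : measurable_fun setT q by exact: measurable_fst.
have H4 D C : measurable D -> measurable C ->
    (\int[mu]_(x in p3 @^-1` C `&` q @^-1` D) (h x)%:E = 0)%E.
  move=> mD mC.
  apply: (@dynkin_integral _ _ _ _ _ mu (EFin \o h) (p3 @^-1` C) q
    [set A `*` B | A in measurable & B in measurable]) => //.
  - exact: mp.
  - exact: measurable_prod_measurableType.
  - move=> _ _ [A mA [B mB <-]] [A' mA' [B' mB' <-]]; rewrite -setXI.
    by exists (A `&` A'); [exact: measurableI|exists (B `&` B') => //; exact: measurableI].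
  - have := H3 setT setT C measurableT measurableT mC.
    by rewrite !preimage_setT !setTI.
  - move=> _ [A mA [B mB <-]]; rewrite -[RHS](H3 A B C)//; congr (integral _ _ _).
    by rewrite setIC.
move=> S mS; rewrite -[S]setTI -[X in _ `&` X]/(id @^-1` S).
apply: (@dynkin_integral _ _ _ _ _ mu (EFin \o h) setT id
    [set A `*` B | A in measurable & B in measurable]) => //.
- exact: measurable_prod_measurableType.
- move=> _ _ [A mA [B mB <-]] [A' mA' [B' mB' <-]]; rewrite -setXI.
  by exists (A `&` A'); [exact: measurableI|exists (B `&` B') => //; exact: measurableI].
- by have := H4 setT setT measurableT measurableT; rewrite !preimage_setT !setTI.
- move=> _ [A mA [B mB <-]]; rewrite setTI -[RHS](H4 A B)//; congr (integral _ _ _).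
  by rewrite setIC.
Qed.

(** g is cut off to the cube [Q n]. The intersection of two open boxes is an open box, over which
    [integral_obox] applies, so the cut-off function integrates to 0 over all boxes and then over
    all measurable sets. *)
Lemma du_bois_reymond (g : R3 R -> R) : locint g ->
  (forall eta, test_function eta -> \int[mu]_x (g x * eta x) = 0) ->
  g = (fun=> 0) %[ae mu].
Proof.
move=> lg g0.
pose Q (n : nat) : set (R3 R1) := obox (- n%:R, - n%:R, - n%:R) (n%:R, n%:R, n%:R).
have mQ n : measurable (Q n) by exact: measurable_obox.
pose h n x : R := g x * \1_(Q n) x.
have ih n : integrableR mu (h n).
  apply: locint_mul => //; split; first by apply: measurable_indic; exact: mQ.
  have [k nab] := @obox_sub_box R (- n%:R, - n%:R, - n%:R) (n%:R, n%:R, n%:R); exists k, 1 => // x.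
  rewrite mul1r !indicE normr_nat ler_nat.
  by case: (boolP (x \in Q n)) => // /set_mem /nab ?; rewrite (_ : x \in box _)// inE.
have hE n A : (\int[mu]_(x in A) (h n x)%:E = \int[mu]_(x in A `&` Q n) (g x)%:E)%E.
  rewrite [LHS]integral_mkcond [RHS]integral_mkcond; apply: eq_integral => x _.
  rewrite !patchE in_setI /h indicE.
  by case: (x \in A) => //=; case: (x \in Q n); rewrite ?mulr1 ?mulr0.
have h0 n A : measurable A -> (\int[mu]_(x in A) (h n x)%:E = 0)%E.
  move=> mA; apply: (@integral_all_eq0 _ n) => // [x xQ|a b].
    by rewrite /h indicE memNset// mulr0.
  rewrite hE -[RHS](@integral_obox g (Num.max a.1.1 (- n%:R), Num.max a.1.2 (- n%:R), Num.max a.2 (- n%:R))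
    (Num.min b.1.1 n%:R, Num.min b.1.2 n%:R, Num.min b.2 n%:R))//; congr (integral _ _ _).
  apply/seteqP; split=> x.
    move=> [[[/= + +] +] [[/= + +] +]]; rewrite !in_itv/=.
    move=> /andP[? ?] /andP[? ?] /andP[? ?] /andP[? ?] /andP[? ?] /andP[? ?].
    by split; [split|]; rewrite /= in_itv/= lt_min gt_max; apply/andP; split; apply/andP; split.
  move=> [[/= + +] +]; rewrite !in_itv/= !lt_min !gt_max.
  move=> /andP[/andP[? ?] /andP[? ?]] /andP[/andP[? ?] /andP[? ?]] /andP[/andP[? ?] /andP[? ?]].
  by split; split; [split| |split|]; rewrite /= in_itv/=; apply/andP.
have hae n : ae_eq mu setT (EFin \o h n) (cst 0%E).
  apply: integral_ae_eq => //; first exact: ih.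
  by move=> E _ mE; rewrite integral0 -(h0 n E mE).
have /ae_foralln := hae.
apply: filterS => x hx _.
have [k xk] : exists k, Q k x.
  have [k kx] := @compact_sub_box R [set x] (@compact_set1 _ _).
  exists k.+1; have [[/= + +] +] := kx x erefl; rewrite !in_itv/=.
  move=> /andP[? ?] /andP[? ?] /andP[? ?]; have ? : k%:R < k.+1%:R :> R by rewrite ltr_nat.
  have ? : - k.+1%:R < - k%:R :> R by rewrite ltrN2.
  by split; [split|]; rewrite /= in_itv/=; apply/andP; split; lra.
by have := hx k I => -[]; rewrite /h indicE mem_set// mulr1.
Qed.


End FundamentalLemma.

(** * Weak derivatives *)

Section AlmostEverywhere.
Context d (T : measurableType d) (R : realType) (m : {measure set T -> \bar R}).
Implicit Types P Q S U : T -> Prop.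

Lemma aeS P Q : (forall x, P x -> Q x) -> {ae m, forall x, P x} -> {ae m, forall x, Q x}.
Proof. by move=> PQ; apply: filterS. Qed.

Lemma aeS2 P Q S : (forall x, P x -> Q x -> S x) -> {ae m, forall x, P x} ->
  {ae m, forall x, Q x} -> {ae m, forall x, S x}.
Proof. by move=> PQ; apply: filterS2. Qed.

Lemma aeS3 P Q S U : (forall x, P x -> Q x -> S x -> U x) -> {ae m, forall x, P x} ->
  {ae m, forall x, Q x} -> {ae m, forall x, S x} -> {ae m, forall x, U x}.
Proof. by move=> PQ; apply: filterS3. Qed.

End AlmostEverywhere.

Section WeakDerivative.
Variable R : realType.
Local Notation lam := (@lebesgue_measure R).
Local Notation mu := (@leb3 R).
Local Notation R1 := (measurableTypeR R).
Local Notation e := (basis3 R).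
Implicit Types u v g h b eta : R3 R -> R.

Lemma line_continuous u (x d : R3 R) : continuous u -> continuous (fun t : R => u (x + t *: d)).
Proof.
move=> cu t; apply: (@continuous_comp _ _ _ (fun t : R => x + t *: d) u); last exact: cu.
by apply: cvgD; [exact: cvg_cst|exact: (cvgZ (@cvg_id _ _) (cvg_cst _))].
Qed.

Lemma line_ftc u i x (c : R) : Ck 1 u -> 0 < c ->
  \int[lam]_(t in `[0, c]) partial i u (x + t *: e i) = u (x + c *: e i) - u x.
Proof.
move=> [cu du cpu] c0; rewrite /Rintegral.
have cl := @line_continuous u x (e i) cu.
rewrite (@continuous_FTC2 R _ (fun t => u (x + t *: e i)))//=.
- by rewrite scale0r addr0.
- by apply: continuous_subspaceT; apply: line_continuous; exact: cpu.
- split => [t _||].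
  + by have [] := is_derive_line_at (du i (x + t *: e i)).
  + exact/cvg_at_right_filter/cl.
  + exact/cvg_at_left_filter/cl.
- move=> t _; rewrite derive1E.
  by have [] := is_derive_line_at (du i (x + t *: e i)).
Qed.

Lemma bounded_support_line_integral b i (t : R) : bounded_support b ->
  integrableR mu (fun x => 1 * b (x + t *: e i)).
Proof.
move=> sb; under eq_fun do rewrite mul1r.
exact/integrableR_translation/bounded_support_integrable.
Qed.

(** Integrate the derivative over all unit segments in direction e i. Integrating along the segments
    first gives eta (x + e i) - eta x, of integral 0; integrating over space first gives, by
    translation invariance, the integral of the derivative. *)
Lemma Rintegral_partial eta i : test_function eta -> \int[mu]_x partial i eta x = 0.
Proof.
move=> teta; have sp := test_function_bounded_support (test_function_partial i teta).
have mp := sp.1.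
have se := test_function_bounded_support teta.
have C1 : Ck 1 eta by exact: teta.1.
have ieta := bounded_support_integrable se.
have [_ _] := @line_fubini R (cst 1) (partial i eta) (e i) 1 (\int[mu]_x `|partial i eta x|)
  (measurable_cst _) mp ler01 (fun t _ => bounded_support_line_integral i t sp)
  (fun t _ => ltac:(under eq_Rintegral do rewrite mul1r;
    rewrite (Rintegral_translation (t *: e i) (f := fun x => `|partial i eta x|))//;
    exact: measurableT_comp)).
under eq_Rintegral do under eq_Rintegral do rewrite mul1r.
under eq_Rintegral do rewrite line_ftc//.
rewrite RintegralB//; last exact: integrableR_translation.
rewrite Rintegral_translation; last exact: se.1.
rewrite subrr => /esym.
under eq_Rintegral do under eq_Rintegral do rewrite mul1r.
under eq_Rintegral do rewrite Rintegral_translation//.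
rewrite Rintegral_cst// [X in fine X]lebesgue_measure_itv/= lte_fin ltr01 -EFinB/= subr0 mulr1.
by [].
Qed.

Lemma bounded_support_locint b : bounded_support b -> locint (b : R3 R -> R).
Proof.
move=> sb; split; first exact: sb.1.
move=> n; apply: integrableR_le (integrableR_norm (bounded_support_integrable sb)) _.
  apply: measurable_funM; last exact: sb.1.
  by apply: measurable_indic; exact: measurable_box.
move=> x; rewrite normrM indicE; case: (_ \in _); first by rewrite normr1 mul1r.
by rewrite normr0 mul0r.
Qed.

Lemma is_weak_partialP i u g : is_weak_partial i u g <-> [/\ locint u, locint g &
  forall eta, test_function eta ->
      \int[mu]_x (u x * partial i eta x) = - \int[mu]_x (g x * eta x)].
Proof.
split=> -[iu ig H]; split=> //.
- exact: loc_integrable_locint.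
- exact: loc_integrable_locint.
- exact: locint_loc_integrable.
- exact: locint_loc_integrable.
Qed.

Lemma test_weak_partial (eta : R3 R -> R) i : test_function eta -> is_weak_partial i eta (partial i eta).
Proof.
move=> teta; apply/is_weak_partialP; have tp := test_function_partial i teta.
have se := test_function_bounded_support teta.
have sp := test_function_bounded_support tp.
split=> [||z tz]; [exact: bounded_support_locint|exact: bounded_support_locint|].
have := Rintegral_partial i (test_functionM teta tz).
rewrite partialM; [|by have [] := teta.1 1%N|by have [] := tz.1 1%N].
have tpz := test_function_partial i tz.
rewrite RintegralD//=.
- move/eqP; rewrite addr_eq0 => /eqP ->; congr (- _).
  by apply: eq_Rintegral => x _; rewrite mulrC.
- apply: locint_mul; first exact: bounded_support_locint.
  exact: test_function_bounded_support.
- apply: locint_mul => //; apply: bounded_support_locint.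
  exact: test_function_bounded_support.
Qed.

Lemma locintD u v : locint u -> locint v -> locint (fun x => u x + v x).
Proof.
move=> [mmu iu] [mv iv]; split; first exact: measurable_funD.
by move=> n; under eq_fun do rewrite mulrDr; exact: integrableRD.
Qed.

Lemma locintZ (c : R) u : locint u -> locint (fun x => c * u x).
Proof.
move=> [mmu iu]; split; first exact: measurable_funM.
by move=> n; under eq_fun do rewrite mulrCA; exact: integrableRZ.
Qed.

Lemma locint_ae u v : locint u -> measurable_fun setT v -> u = v %[ae mu] -> locint v.
Proof.
move=> [mmu iu] mv uv; split=> // n; apply: integrableR_ae (iu n) _ _.
  by apply: measurable_funM => //; apply: measurable_indic; exact: measurable_box.
by apply: aeS uv => x h _; rewrite h.
Qed.

Lemma Lp_locint a u : 1 <= a -> Lp mu a u -> locint u.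
Proof.
move=> a1 [mmu iu]; split=> // n.
have J := integrableRD (integrableR_box (n%:R : R)) iu.
have mI : measurable_fun setT (fun x : R3 R1 => \1_(box n%:R) x * u x).
  by apply: measurable_funM => //; apply: measurable_indic; exact: measurable_box.
apply: (integrableR_le mI J).
move=> x; rewrite normrM indicE; case: (_ \in _); last first.
  by rewrite normr0 mul0r add0r powR_ge0.
rewrite normr1 mul1r; have [u1|u1] := leP `|u x| 1.
  by rewrite (le_trans u1)// lerDl powR_ge0.
rewrite -[leLHS]powRr1//; apply: le_trans (_ : `|u x| `^ a <= _); last by rewrite lerDr.
by apply: ler_powR => //; exact: ltW.
Qed.

Lemma locint_test u eta : locint u -> test_function eta ->
  integrableR mu (fun x => u x * eta x).
Proof. by move=> iu teta; apply: locint_mul => //; exact: test_function_bounded_support. Qed.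

Lemma weak_partial_unique i u g h : is_weak_partial i u g -> is_weak_partial i u h ->
  g = h %[ae mu].
Proof.
move=> /is_weak_partialP[_ lg Hg] /is_weak_partialP[_ lh Hh].
have lgh : locint (fun x => g x + -1 * h x) by apply: locintD => //; exact: locintZ.
have /(du_bois_reymond lgh) : forall eta, test_function eta -> \int[mu]_x ((g x + -1 * h x) * eta x) = 0.
  move=> eta teta; under eq_Rintegral do rewrite mulrDl -mulrA.
  have ih := locint_test lh teta.
  rewrite RintegralD//=; [|exact: locint_test|exact: integrableRZ].
  rewrite RintegralZl//= mulN1r; apply/eqP; rewrite subr_eq0; apply/eqP/oppr_inj.
  by rewrite -Hg// -Hh.
by apply: aeS => x /(_ I) E _; lra.
Qed.

Lemma weak_partialD i u v g h : is_weak_partial i u g -> is_weak_partial i v h ->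
  is_weak_partial i (fun x => u x + v x) (fun x => g x + h x).
Proof.
move=> /is_weak_partialP[lu lg Hg] /is_weak_partialP[lv lh Hh]; apply/is_weak_partialP.
split=> [||eta teta]; [exact: locintD|exact: locintD|].
have tp := test_function_partial i teta.
under eq_Rintegral do rewrite mulrDl.
under [in RHS]eq_Rintegral do rewrite mulrDl.
rewrite !RintegralD//=; try exact: locint_test.
by rewrite opprD Hg// Hh.
Qed.

Lemma weak_partialZ i (c : R) u g : is_weak_partial i u g ->
  is_weak_partial i (fun x => c * u x) (fun x => c * g x).
Proof.
move=> /is_weak_partialP[lu lg Hg]; apply/is_weak_partialP.
split=> [||eta teta]; [exact: locintZ|exact: locintZ|].
have tp := test_function_partial i teta.
under eq_Rintegral do rewrite -mulrA.
under [in RHS]eq_Rintegral do rewrite -mulrA.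
rewrite !RintegralZl//=; try exact: locint_test.
by rewrite Hg// mulrN.
Qed.

Lemma weak_partial_ae i u v g h : is_weak_partial i u g -> measurable_fun setT v ->
  measurable_fun setT h -> u = v %[ae mu] -> g = h %[ae mu] -> is_weak_partial i v h.
Proof.
move=> /is_weak_partialP[lu lg Hg] mv mh uv gh; apply/is_weak_partialP.
split=> [||eta teta]; [exact: locint_ae uv|exact: locint_ae gh|].
have mt z : test_function z -> measurable_fun setT z.
  by move=> tz; have [] := test_function_bounded_support tz.
have tp := test_function_partial i teta.
rewrite -(ae_eq_Rintegral _ _ (_ : (fun x => u x * partial i eta x) = _ %[ae mu])).
- rewrite Hg// (ae_eq_Rintegral _ _ (_ : (fun x => g x * eta x) = (fun x => h x * eta x) %[ae mu]))//.
  + by apply: measurable_funM; [exact: lg.1|exact: mt].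
  + by apply: measurable_funM => //; exact: mt.
  + by apply: aeS gh => x E _; rewrite E.
- by apply: measurable_funM; [exact: lu.1|exact: mt].
- by apply: measurable_funM => //; exact: mt.
- by apply: aeS uv => x E _; rewrite E.
Qed.

Lemma wpartialP i u g : is_weak_partial i u g ->
  is_weak_partial i u (wpartial i u) /\ wpartial i u = g %[ae mu].
Proof.
move=> H; have H' : is_weak_partial i u (wpartial i u).
  by apply: (@xgetPex _ (cst 0) [set g | is_weak_partial i u g]); exists g.
by split=> //; exact: weak_partial_unique H' H.
Qed.

(** Curried so that [normv (wgrad u x)] and [dotv (wgrad u x) (wgrad v x)] are convertible to
    [grad_norm u x] and [grad_dot u v x]. *)
Definition wgrad u (x : R3 R) (i : 'I_3) : R := wpartial i u x.

Lemma weak_grad_inP (a : R) u : 0 < a -> weak_grad_in a u <->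
  (forall i, is_weak_partial i u (wpartial i u) /\ Lp mu a (wpartial i u)).
Proof.
move=> a0; split=> H i.
  have [g /(Lfun_LpP mu _ a0) Lg /wpartialP[H1 H2]] := H i; split=> //.
  apply: Lp_ae Lg _ _.
    by have /is_weak_partialP[_ []] := H1.
  by apply: aeS H2 => x E /E.
have [H1 H2] := H i; exists (wpartial i u) => //.
exact/(Lfun_LpP mu _ a0).
Qed.

(** [wpartial] selects representatives by choice, so its linearity can only hold off a null set;
    three null sets, one per coordinate, are united here. *)
Lemma wgrad_lin (c : R) u v : (forall i, is_weak_partial i u (wpartial i u)) ->
  (forall i, is_weak_partial i v (wpartial i v)) ->
  {ae mu, forall x, wgrad (fun x => c * u x + v x) x = (fun i => c * wgrad u x i + wgrad v x i)}.
Proof.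
move=> wu wv.
have H i : wpartial i (fun x => c * u x + v x) = (fun x => c * wpartial i u x + wpartial i v x) %[ae mu].
  by have [] := wpartialP (weak_partialD (weak_partialZ c (wu i)) (wv i)).
apply: aeS3 (H ord0) (H (inord 1)) (H (inord 2)) => x h0 h1 h2.
apply/funext => -[[|[|[|//]]] k]; rewrite /wgrad.
- by rewrite (_ : Ordinal k = ord0) ?h0//; exact/val_inj.
- by rewrite (_ : Ordinal k = inord 1) ?h1//; apply/val_inj; rewrite /= inordK.
- by rewrite (_ : Ordinal k = inord 2) ?h2//; apply/val_inj; rewrite /= inordK.
Qed.

Lemma weak_grad_in_lin (a c : R) u v : 0 < a -> weak_grad_in a u -> weak_grad_in a v ->
  weak_grad_in a (fun x => c * u x + v x).
Proof.
move=> a0 /(weak_grad_inP _ a0) wu /(weak_grad_inP _ a0) wv i.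
exists (fun x => c * wpartial i u x + wpartial i v x).
  by apply/(Lfun_LpP mu _ a0); apply: LpD => //; [apply: LpZ|]; [exact: (wu i).2|exact: (wv i).2].
by apply: weak_partialD; [apply: weak_partialZ|]; [exact: (wu i).1|exact: (wv i).1].
Qed.

Lemma weak_grad_in_ae (a : R) u v : 0 < a -> weak_grad_in a u -> measurable_fun setT v ->
  u = v %[ae mu] -> weak_grad_in a v /\ {ae mu, forall x, wgrad v x = wgrad u x}.
Proof.
move=> a0 /(weak_grad_inP _ a0) wu mv uv.
have W i : is_weak_partial i v (wpartial i u).
  have /is_weak_partialP[_ [mg _] _] := (wu i).1.
  by apply: weak_partial_ae (wu i).1 _ _ uv _ => //; exact: aeW.
split.
  by move=> i; exists (wpartial i u) => //; apply/(Lfun_LpP mu _ a0); exact: (wu i).2.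
have H i := (wpartialP (W i)).2.
apply: aeS3 (H ord0) (H (inord 1)) (H (inord 2)) => x h0 h1 h2.
apply/funext => -[[|[|[|//]]] k]; rewrite /wgrad.
- by rewrite (_ : Ordinal k = ord0) ?h0//; exact/val_inj.
- by rewrite (_ : Ordinal k = inord 1) ?h1//; apply/val_inj; rewrite /= inordK.
- by rewrite (_ : Ordinal k = inord 2) ?h2//; apply/val_inj; rewrite /= inordK.
Qed.

End WeakDerivative.

(** * The Sobolev inequality *)

Section AbsolutelyContinuousLine.
Variable R : realType.
Local Notation lam := (@lebesgue_measure R).
Implicit Types (a b t T M : R) (F f g h : R -> R).

Lemma continuous_powR_norm a : 0 < a -> continuous (fun x : R => `|x| `^ a).
Proof.
move=> a0 x; have [->|x0] := eqVneq x 0.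
  apply/cvgrPdist_lt => /= eps eps0; rewrite normr0 powR0 ?gt_eqF//.
  have d0 : 0 < eps `^ a^-1 by rewrite powR_gt0.
  apply/nbhs_ballP; exists (eps `^ a^-1) => // y; rewrite /ball/= sub0r normrN => yd.
  rewrite sub0r normrN ger0_norm ?powR_ge0//.
  rewrite (_ : eps = (eps `^ a^-1) `^ a); last first.
    by rewrite -powRrM mulVf ?gt_eqF// powRr1// ltW.
  by apply: gt0_ltr_powR; rewrite ?nnegrE ?powR_ge0 ?normr_ge0.
have nx : 0 < `|x| by rewrite normr_gt0.
apply: (@continuous_comp _ _ _ (@Num.norm _ R) (fun y : R => y `^ a)).
  exact: norm_continuous.
apply/differentiable_continuous/derivable1_diffP.
by apply: derivable_powR; rewrite in_itv/= nx.
Qed.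

Lemma heine a b h (eps : R) : {within `[a, b], continuous h} -> 0 < eps ->
  exists2 d : R, 0 < d & forall x y, a <= x <= b -> a <= y <= b -> `|x - y| < d ->
    `|h x - h y| < eps.
Proof.
move=> ch eps0.
have cpt := @segment_compact R a b.
pose P (n : nat) (x : R) := forall y : R, a <= y <= b -> `|x - y| < n.+1%:R^-1 -> `|h x - h y| < eps.
have : \forall n \near \oo, `[a, b]%classic `<=` P n.
  move/compact_near_coveringP : cpt => /near_covering_withinP; apply => x xab.
  have /subspace_continuousP/(_ x xab)/cvgrPdist_lt/(_ (eps / 2)) := ch.
  rewrite divr_gt0// => /(_ isT) /nbhs_ballP[r/= r0 Hr].
  near=> z n => zab y yab zy.
  have xz : `|x - z| < r / 2.
    near: z; apply/nbhs_ballP; exists (r / 2); first by rewrite /= divr_gt0.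
    by move=> z.
  have nr : n.+1%:R^-1 < r / 2.
    by near: n; exact: near_infty_natSinv_lt (PosNum (divr_gt0 r0 (ltr0n _ 2))).
  have hz : `|h x - h z| < eps / 2 by apply: Hr => //; rewrite /ball/=; lra.
  have hy : `|h x - h y| < eps / 2.
    apply: Hr => //; rewrite /ball/= -(subrK z x) -addrA (le_lt_trans (ler_normD _ _))//.
    by rewrite (splitr r) ltrD//; exact: lt_trans zy nr.
  rewrite -(subrK (h x) (h z)) -addrA (le_lt_trans (ler_normD _ _))//.
  by rewrite (splitr eps) ltrD// distrC.
move=> [N _ HN]; exists (N.+1%:R^-1) => [|x y xab yab xy]; first by rewrite invr_gt0.
by apply: (HN N) => //=; rewrite in_itv.
Unshelve. all: by end_near. Qed.

Lemma min_norm_sub_le a b M : Num.min `|a| M - Num.min `|b| M <= `|a - b|.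
Proof.
rewrite lerBlDr; have [bM|bM] := leP `|b| M.
  by rewrite ge_min -lerBlDr lerB_dist.
by rewrite ge_min; apply/orP; right; rewrite lerDr.
Qed.

Lemma lerD_of_sub a b x y : a - b <= y - x -> a + x <= b + y.
Proof. lra. Qed.

Lemma subrBB a b x : x - a - (x - b) = b - a.
Proof. by rewrite opprB addrC subrKA. Qed.

Lemma mulr_div_le a b x : 0 < a -> 0 < b -> 0 <= x -> b * (a / (b * (x + 1)) * x) <= a.
Proof.
move=> a0 b0 x0; have x1 : 0 < x + 1 by lra.
rewrite (_ : b * _ = a * (x / (x + 1))); last by field; rewrite !gt_eqF.
by rewrite ger_pMr// ler_pdivrMr// mul1r lerDl.
Qed.

Lemma measurable_interval (i : interval R) : measurable ([set` i] : set (measurableTypeR R)).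
Proof. exact: measurable_itv. Qed.

Lemma integrable_itvS (i j : interval R) f : [set` i] `<=` [set` j] ->
  lam.-integrable [set` j] (EFin \o f) -> lam.-integrable [set` i] (EFin \o f).
Proof. by move=> ij; apply: integrableS => //; exact: measurable_interval. Qed.

Lemma integrable_itvZ (i : interval R) (k : R) f : lam.-integrable [set` i] (EFin \o f) ->
  lam.-integrable [set` i] (EFin \o (fun t => k * f t)).
Proof.
move=> /(integrableZl (measurable_interval i) k); apply: eq_integrable => //.
Qed.

Lemma integrable_itv_norm (i : interval R) f : lam.-integrable [set` i] (EFin \o f) ->
  lam.-integrable [set` i] (EFin \o (fun t => `|f t|)).
Proof. exact: integrable_abse. Qed.

Variables (F g : R -> R) (T M c : R).
Hypotheses (T0 : (0 : R) < T) (M0 : (0 : R) <= M) (c1 : (1 : R) < c).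
Hypothesis ig : lam.-integrable `[0, T] (EFin \o g).
Hypothesis FE : forall t, 0 <= t <= T -> F t = F 0 - \int[lam]_(s in `[0, t]) g s.

(** In the application F is almost everywhere t |-> u (x - t e); the cutoff at M bounds W^(c-1)
    whatever u is. *)
Let W t : R := Num.min `|F t| M.

Let W_ge0 t : 0 <= W t. Proof. by rewrite le_min normr_ge0. Qed.

Let cF : {within `[0, T], continuous F}.
Proof.
have cG := parameterized_integral_continuous (ltW T0) ig.
have cG' : {within `[0, T], continuous (fun t => F 0 - \int[lam]_(s in `[0, t]) g s)}.
  by move=> x; apply: cvgB; [exact: cvg_cst|exact: cG].
apply: subspace_eq_continuous cG' => t; rewrite inE/= in_itv/= => tT.
exact/esym/FE.
Qed.

Let cH : {within `[0, T], continuous (fun t => W t `^ (c - 1))}.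
Proof.
have cm : continuous (fun x : R => Num.min `|x| M `^ (c - 1)).
  move=> x; have -> : (fun x : R => Num.min `|x| M `^ (c - 1)) = (fun x => `|Num.min `|x| M| `^ (c - 1)).
    by apply/funext => y; rewrite (ger0_norm (_ : 0 <= Num.min _ _))// le_min normr_ge0.
  apply: (@continuous_comp _ _ _ (fun x : R => Num.min `|x| M) (fun y => `|y| `^ (c - 1))).
    by apply: continuous_min; [exact: norm_continuous|exact: cvg_cst].
  by apply: continuous_powR_norm; rewrite subr_gt0.
apply: (@within_continuous_comp _ _ _ _ F (fun x : R => Num.min `|x| M `^ (c - 1))) => //.
Qed.

Let iK (e : R) : lam.-integrable `[0, T] (EFin \o (fun t => c * (W t `^ (c - 1) + e) * `|g t|)).
Proof.
have mK : measurable_fun `[0, T] (fun t => c * (W t `^ (c - 1) + e) * `|g t|).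
  have mg : measurable_fun `[0, T] g by have := measurable_int _ ig => /measurable_EFinP.
  apply: measurable_funM; last exact: measurableT_comp.
  apply: measurable_funM => //; apply: measurable_funD => //.
  exact: (@subspace_continuous_measurable_fun R _ _ (measurable_itv `[0, T]) cH).
have ig' : lam.-integrable `[0, T] (EFin \o (fun t => (c * (M `^ (c - 1) + `|e|)) * `|g t|)).
  by apply: integrable_itvZ; exact: integrable_itv_norm.
apply: (le_integrable _ _ _ ig') => //=; first exact/measurable_EFinP.
move=> t _; rewrite lee_fin !normrM normr_id ler_wpM2r// ler_wpM2l//.
rewrite [leRHS]ger0_norm ?addr_ge0 ?powR_ge0//.
rewrite (le_trans (ler_normD _ _))// lerD2r ger0_norm ?powR_ge0//.
by apply: ge0_ler_powR; rewrite ?nnegrE ?W_ge0 ?ge_min ?lexx ?orbT// subr_ge0 ltW.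
Qed.

(** Integrated form of (W^c)' >= - c W^(c-1) |g| that never differentiates F. On a fine partition
    the tangent inequality bounds each decrement of W^c by c W(t_k)^(c-1) times the integral of |g|
    over the cell; uniform continuity replaces W(t_k) by W(t) up to an error e, which finally tends
    to 0. *)
Lemma line_chain : W 0 `^ c <= W T `^ c + c * \int[lam]_(t in `[0, T]) (W t `^ (c - 1) * `|g t|).
Proof.
have c0 : 0 < c := lt_trans ltr01 c1.
have iabs : lam.-integrable `[0, T] (EFin \o (fun t => `|g t|)) by exact: integrable_itv_norm.
have step (e : R) : 0 < e ->
    W 0 `^ c <= W T `^ c + \int[lam]_(t in `[0, T]) (c * (W t `^ (c - 1) + e) * `|g t|).
  move=> e0; have [d d0 Hd] := heine cH e0.
  pose n := (Num.truncn (T / d)).+1; pose tk (k : nat) := k%:R * (T / n%:R).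
  have n0 : 0 < n%:R :> R by rewrite ltr0n.
  have nd : T / n%:R < d.
    by rewrite ltr_pdivrMr// mulrC -ltr_pdivrMr// truncnS_gt.
  have tk0 k : 0 <= tk k by rewrite mulr_ge0// divr_ge0// ltW.
  have tkT k : (k <= n)%N -> tk k <= T.
    move=> kn; rewrite /tk mulrCA ger_pMr// ler_pdivrMr// mul1r ler_nat//.
  have tkS k : tk k.+1 = tk k + T / n%:R by rewrite /tk -natr1 mulrDl mul1r.
  have tn : tk n = T by rewrite /tk mulrCA divff ?mulr1// gt_eqF.
  have H k : (k <= n)%N -> W 0 `^ c <= W (tk k) `^ c
      + \int[lam]_(t in `[0, tk k]) (c * (W t `^ (c - 1) + e) * `|g t|).
    elim: k => [_|k IH kn].
      rewrite /tk mul0r lerDl; apply: Rintegral_ge0 => t _.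
      by rewrite mulr_ge0// mulr_ge0 ?addr_ge0 ?powR_ge0// ltW.
    apply: le_trans (IH (ltnW kn)) _.
    have kT := tkT _ (ltnW kn); have k1T := tkT _ kn.
    have kk1 : tk k <= tk k.+1 by rewrite tkS lerDl divr_ge0// ltW.
    have sub1 : `[0, tk k.+1]%classic `<=` ( `[0, T]%classic : set R).
      by move=> t /=; rewrite !in_itv/= => /andP[-> /le_trans]; exact.
    have ig1 := integrable_itvS sub1 ig.
    have iK1 := integrable_itvS sub1 (iK e).
    have b1 : (BLeft (0 : R) <= BRight (tk k))%O by rewrite bnd_simp.
    have b2 : (BRight (tk k) <= BRight (tk k.+1))%O by rewrite bnd_simp.
    have EK := Rintegral_itvB iK1 b1 b2.
    have Eg := Rintegral_itvB ig1 b1 b2.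
    have sub2 : `]tk k, tk k.+1]%classic `<=` ( `[0, tk k.+1]%classic : set R).
      by move=> t /=; rewrite !in_itv/= => /andP[/ltW /(le_trans (tk0 k)) -> ->].
    have ig2 := integrable_itvS sub2 ig1.
    have iK2 := integrable_itvS sub2 iK1.
    suff : W (tk k) `^ c - W (tk k.+1) `^ c <=
      \int[lam]_(t in `]tk k, tk k.+1]) (c * (W t `^ (c - 1) + e) * `|g t|).
      by rewrite -EK => /lerD_of_sub.
    apply: le_trans (powR_sub_le (W_ge0 _) (W_ge0 _) c1) _.
    have A0 : 0 <= c * W (tk k) `^ (c - 1) by rewrite mulr_ge0 ?powR_ge0// ltW.
    apply: le_trans (ler_wpM2l A0 (min_norm_sub_le _ _ _)) _.
    rewrite (FE (t := tk k)) ?tk0// (FE (t := tk k.+1)) ?tk0//.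
    rewrite subrBB Eg.
    apply: le_trans (ler_wpM2l A0 (le_normr_Rintegral (measurable_interval _) ig2)) _.
    rewrite -RintegralZl//; last exact: integrable_itv_norm.
    apply: le_Rintegral => //.
      by apply: integrable_itvZ; exact: integrable_itv_norm.
    move=> t /=; rewrite in_itv/= => /andP[kt tk1]; rewrite ler_wpM2r// ler_wpM2l ?ltW//.
    have := Hd (tk k) t; rewrite tk0 kT (ltW (le_lt_trans (tk0 k) kt)) (le_trans tk1 k1T).
    move=> /(_ isT isT); rewrite ltr0_norm ?subr_lt0// opprB => Hh.
    have /Hh : t - tk k < d by rewrite (le_lt_trans _ nd)// lerBlDl -tkS.
    by rewrite ltr_norml => /andP[_]; rewrite ltrBlDl.
  by have := H n (leqnn n); rewrite tn.
have iWg : lam.-integrable `[0, T] (EFin \o (fun t => W t `^ (c - 1) * `|g t|)).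
  have := integrable_itvZ c^-1 (iK 0); apply: eq_integrable => // t _ /=.
  by rewrite addr0 -mulrA mulKf// gt_eqF.
apply/ler_addgt0Pr => e e0; set I := \int[lam]_(t in `[0, T]) `|g t|.
have I0 : 0 <= I by exact: Rintegral_ge0.
(* [k] is the uniform-continuity error; it enters multiplied by c times the integral of |g|. *)
have [k k0 kI] : exists2 k : R, 0 < k & c * (k * I) <= e.
  by exists (e / (c * (I + 1))); [rewrite divr_gt0// mulr_gt0// ltr_wpDl|exact: mulr_div_le].
apply: le_trans (step _ k0) _; rewrite -addrA lerD2l.
under eq_Rintegral do rewrite mulrDr mulrDl -!mulrA.
rewrite RintegralD//=; last 2 first.
  exact: integrable_itvZ.
  by apply: integrable_itvZ; exact: integrable_itvZ.
rewrite !RintegralZl//; last exact: integrable_itvZ.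
by rewrite lerD2l.
Qed.

End AbsolutelyContinuousLine.

Section Sections.
Context d1 d2 (T1 : measurableType d1) (T2 : measurableType d2) (R : realType).
Variable m2 : {sigma_finite_measure set T2 -> \bar R}.

Lemma measurable_Rintegral_param (k : T1 * T2 -> R) : measurable_fun setT k ->
  measurable_fun setT (fun x => \int[m2]_y k (x, y)).
Proof.
move=> mk; have mk' : measurable_fun setT (EFin \o k) by exact/measurable_EFinP.
apply: measurableT_comp => //=.
under eq_fun do rewrite integralE.
apply: emeasurable_funB.
  have := @measurable_fun_fubini_tonelli_F _ _ T1 T2 R m2 _ (measurable_funepos mk') (funepos_ge0 _).
  congr (measurable_fun _ _); apply/funext => x; apply: eq_integral => y _.
  by rewrite !funeposE.
have := @measurable_fun_fubini_tonelli_F _ _ T1 T2 R m2 _ (measurable_funeneg mk') (funeneg_ge0 _).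
congr (measurable_fun _ _); apply/funext => x; apply: eq_integral => y _.
by rewrite !funenegE.
Qed.

Variable m1 : {sigma_finite_measure set T1 -> \bar R}.

(** Tonelli for the indicator of N. It turns a statement holding, for each y, for almost every x
    into one holding, for almost every x, at almost every y. *)
Lemma ae_sections (N : set (T1 * T2)) : measurable N ->
  (forall y, m1 [set x | N (x, y)] = 0%E) -> {ae m1, forall x, {ae m2, forall y, ~ N (x, y)}}.
Proof.
move=> mN N0.
have mI : measurable_fun setT (EFin \o (\1_N : T1 * T2 -> R)).
  by apply/measurable_EFinP; exact: measurable_indic.
have E := @fubini_tonelli _ _ T1 T2 R m1 m2 (EFin \o \1_N) mI (fun x => ltac:(by rewrite lee_fin)).
have mx x : measurable [set y | N (x, y)].
  by have := measurable_xsection x mN; rewrite /xsection; under eq_set do rewrite inE.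
have my y : measurable [set x | N (x, y)].
  by have := measurable_ysection y mN; rewrite /ysection; under eq_set do rewrite inE.
have Ix x : (\int[m2]_y (EFin \o \1_N) (x, y) = m2 [set y | N (x, y)])%E.
  rewrite -[[set y | N (x, y)]]setIT -(integral_indic _ measurableT (mx x)).
  by apply: eq_integral => y _; rewrite /= !indicE; congr ((_%:R)%:E); apply/idP/idP; rewrite !inE.
have Iy y : (\int[m1]_x (EFin \o \1_N) (x, y) = m1 [set x | N (x, y)])%E.
  rewrite -[[set x | N (x, y)]]setIT -(integral_indic _ measurableT (my y)).
  by apply: eq_integral => x _; rewrite /= !indicE; congr ((_%:R)%:E); apply/idP/idP; rewrite !inE.
have mF := @measurable_fun_fubini_tonelli_F _ _ T1 T2 R m2 (EFin \o \1_N) mI (fun x => ltac:(by rewrite lee_fin)).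
have Z : (\int[m1]_x `|\int[m2]_y (EFin \o \1_N) (x, y)| = 0)%E.
  transitivity (\int[m1]_x \int[m2]_y (EFin \o \1_N) (x, y))%E.
    by apply: eq_integral => x _; rewrite Ix gee0_abs.
  by rewrite E; under eq_integral do rewrite Iy N0; rewrite integral0.
have [/(_ Z) + _] := ae_eq_integral_abs m1 measurableT mF.
apply: aeS => x /(_ I); rewrite /fubini_F Ix /= => mx0.
by exists [set y | N (x, y)]; split => // y /= /contrapT.
Qed.

End Sections.

(** * Weak differences along lines *)

Section Lines.
Variable R : realType.
Local Notation lam := (@lebesgue_measure R).
Local Notation mu := (@leb3 R).
Local Notation R1 := (measurableTypeR R).
Local Notation e := (basis3 R).
Implicit Types (u g h a b eta : R3 R -> R) (v : R3 R) (c : R).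

Lemma line_opp (x v : R3 R) c : x + c *: - v = x + (- c) *: v.
Proof. by rewrite scalerN scaleNr. Qed.

Lemma measurable_primitive g v : measurable_fun setT g ->
  measurable_fun setT (fun z : R3 R1 * R1 => \int[lam]_(s in `[0, z.2]) g (z.1 + s *: v)).
Proof.
move=> mg.
pose I0 : R1 -> R := \1_(`[0, +oo[%classic).
(* The two indicators encode 0 <= s <= t, so that the domain of integration no longer depends on the
   parameter t. *)
pose k (w : (R3 R1 * R1) * R1) : R := I0 w.2 * I0 (w.1.2 - w.2) * g (w.1.1 + w.2 *: v).
have mI0 : measurable_fun setT I0 by exact: measurable_indic.
have m1 : measurable_fun setT (fun w : (R3 R1 * R1) * R1 => w.1.2).
  exact: (measurableT_comp measurable_snd measurable_fst).
have m2 : measurable_fun setT (fun w : (R3 R1 * R1) * R1 => w.1.1).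
  exact: (measurableT_comp measurable_fst measurable_fst).
have mk : measurable_fun setT k.
  apply: measurable_funM; [apply: measurable_funM|].
  - exact: (measurableT_comp mI0 measurable_snd).
  - by apply: (measurableT_comp mI0); apply: measurable_funB => //; exact: measurable_snd.
  - apply: (measurableT_comp mg).
    have mp : measurable_fun setT (fun w : (R3 R1 * R1) * R1 => (w.1.1, w.2)).
      by apply: measurable_fun_pair => //; exact: measurable_snd.
    exact: (measurableT_comp (measurable_line v) mp).
have := measurable_Rintegral_param lam mk.
congr (measurable_fun _ _); apply/funext => z; rewrite [RHS]Rintegral_mkcond.
apply: eq_Rintegral => s _; rewrite patchE /k /I0 /= !indicE.
rewrite !mem_setE !in_itv/= !andbT subr_ge0.
by case: (0 <= s) => /=; rewrite ?mul0r// mul1r; case: (s <= z.2); rewrite ?mul0r ?mul1r.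
Qed.

(** For |t| <= c the shifted points remain in one fixed box, whence a bound uniform in t, as
    [line_fubini] demands. *)
Lemma line_bound a b i c : bounded_support a -> locint b -> 0 <= c ->
  exists B, forall t, `|t| <= c ->
    integrableR mu (fun x => a x * b (x + t *: e i)) /\
    \int[mu]_x `|a x * b (x + t *: e i)| <= B.
Proof.
move=> sa lb c0; have [ma [n [M M0 aM]]] := sa.
pose N := (Num.truncn (n%:R + c)).+1.
exists (\int[mu]_x (M * `|\1_(box N%:R) x * b x|)) => t tc.
have ib : integrableR mu (fun x => a x * b (x + t *: e i)).
  under eq_fun do rewrite mulrC.
  by apply: locint_mul => //; exact: locint_translation.
split=> //.
have iN : integrableR mu (fun x => M * `|\1_(box N%:R) x * b x|).
  by apply: integrableRZ; apply: integrableR_norm; exact: lb.2.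
rewrite -(Rintegral_translation (t *: e i) (integrableR_measurable iN)).
apply: le_Rintegral => //; first exact: integrableR_norm.
  exact: (integrableR_translation (t *: e i) iN).
move=> x _; rewrite !normrM mulrA; apply: ler_wpM2r => //.
apply: le_trans (aM x) _; apply: ler_wpM2l => //.
rewrite !indicE normr_nat ler_nat.
case: (boolP (x \in _)) => // /set_mem xn; rewrite mem_set//.
apply: box_le (box_line _ xn tc); rewrite /N.
by apply/ltW; exact: truncnS_gt.
Qed.

Lemma line_bound_loc a b i c : locint a -> bounded_support b -> 0 <= c ->
  exists B, forall t, `|t| <= c ->
    integrableR mu (fun x => a x * b (x + t *: e i)) /\
    \int[mu]_x `|a x * b (x + t *: e i)| <= B.
Proof.
move=> la sb c0; have [B HB] := line_bound i sb la c0; exists B => t tc.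
have ntc : `|- t| <= c by rewrite normrN.
have [iB bB] := HB _ ntc.
have E x : b (x + t *: e i) * a (x + t *: e i + (- t) *: e i) = a x * b (x + t *: e i).
  by rewrite scaleNr addrK mulrC.
split.
  by have := integrableR_translation (t *: e i) iB; under eq_fun do rewrite E.
apply: le_trans bB; rewrite -[leRHS](Rintegral_translation (t *: e i)).
  by under [leRHS]eq_Rintegral do rewrite E.
exact: (integrableR_measurable (integrableR_norm iB)).
Qed.

Lemma locint_line_integral g i c : locint g -> 0 <= c ->
  locint (fun x => \int[lam]_(t in `[0, c]) g (x + t *: - e i)).
Proof.
move=> lg c0; split.
  have mc : measurable_fun setT (fun x : R3 R1 => (x, c : R1)) by exact: measurable_pair2.
  exact: (measurableT_comp (measurable_primitive (- e i) lg.1) mc).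
move=> n.
have sI : bounded_support (\1_(box n%:R) : R3 R -> R).
  split; first by apply: measurable_indic; exact: measurable_box.
  by exists n, 1 => // x; rewrite mul1r indicE normr_nat.
have [B HB] := line_bound i sI lg c0.
have [] := @line_fubini R (\1_(box n%:R)) g (- e i) c B sI.1 lg.1 c0.
- by move=> t tc; under eq_fun do rewrite line_opp; apply: (HB _ _).1; rewrite normrN.
- by move=> t tc; under eq_Rintegral do rewrite line_opp; apply: (HB _ _).2; rewrite normrN.
move=> + _ _; congr (integrableR _ _); apply/funext => x; rewrite indicE.
case: (_ \in _); last first.
  by under eq_Rintegral do rewrite mul0r; rewrite mul0r Rintegral_cst ?mul0r//; exact: measurable_interval.
by rewrite mul1r; under eq_Rintegral do rewrite mul1r.
Qed.

(** Boxes for x and lengths for the segment each range over a countable family, so the exceptional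
    sets unite in a single null set. *)
Lemma line_integrable_ae g i : locint g ->
  {ae mu, forall x, forall n : nat, lam.-integrable `[0, n%:R] (EFin \o (fun t => g (x + t *: - e i)))}.
Proof.
move=> lg.
have H (n k : nat) : {ae mu, forall x, box k%:R x ->
    lam.-integrable `[0, n%:R] (EFin \o (fun t => g (x + t *: - e i)))}.
  have sI : bounded_support (\1_(box k%:R) : R3 R -> R).
    split; first by apply: measurable_indic; exact: measurable_box.
    by exists k, 1 => // x; rewrite mul1r indicE normr_nat.
  have [B HB] := line_bound i sI lg (ler0n _ n).
  have [] := @line_fubini R (\1_(box k%:R)) g (- e i) n%:R B sI.1 lg.1 (ler0n _ n).
  - by move=> t tc; under eq_fun do rewrite line_opp; apply: (HB _ _).1; rewrite normrN.
  - by move=> t tc; under eq_Rintegral do rewrite line_opp; apply: (HB _ _).2; rewrite normrN.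
  move=> _ + _; apply: aeS => x + xk; rewrite indicE mem_set//.
  by congr (_.-integrable _ _); apply/funext => t /=; rewrite mul1r.
have /ae_foralln := fun n => ae_foralln (H n).
apply: aeS => x Hx n.
have [k xk] := @compact_sub_box R [set x] (@compact_set1 _ _).
by apply: (Hx n k); exact: xk.
Qed.

(** Since g is known only through test functions, the shift is moved onto eta. The difference eta x
    - eta (x + c e) is the line integral of a derivative of -eta, and for each t the weak derivative
    can be transferred to u. Fubini and [du_bois_reymond] conclude. *)
Lemma weak_difference i u g c : 0 < c -> is_weak_partial i u g ->
  {ae mu, forall x, u x - u (x + c *: - e i) = \int[lam]_(t in `[0, c]) g (x + t *: - e i)}.
Proof.
move=> c0 /is_weak_partialP[lu lg Hg]; have c0' := ltW c0.
have lI := locint_line_integral i lg c0'.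
have lt : locint (fun x => u (x + c *: - e i)).
  by under eq_fun do rewrite line_opp; exact: locint_translation.
have lD : locint (fun x => u x + -1 * (u (x + c *: - e i) + \int[lam]_(t in `[0, c]) g (x + t *: - e i))).
  by apply: locintD => //; apply: locintZ; exact: locintD.
suff : forall eta, test_function eta -> \int[mu]_x ((u x + -1 * (u (x + c *: - e i) +
    \int[lam]_(t in `[0, c]) g (x + t *: - e i))) * eta x) = 0.
  by move=> /(du_bois_reymond lD); apply: aeS => x /(_ I) E; lra.
move=> eta teta.
under eq_Rintegral do rewrite mulrDl -mulrA mulrDl.
have iu := locint_test lu teta.
have it := locint_test lt teta.
have iI := locint_test lI teta.
rewrite RintegralD//=; last by apply: integrableRZ; exact: integrableRD.
rewrite RintegralZl//=; last exact: integrableRD.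
rewrite RintegralD//=.
(* The sign makes the line integral of the derivative of [z] equal to eta x - eta (x + c e) in this
   order. *)
pose z x := -1 * eta x; have tz : test_function z := test_functionZ _ teta.
have tpz := test_function_partial i tz.
have sz := test_function_bounded_support tz.
have se := test_function_bounded_support teta.
have spz := test_function_bounded_support tpz.
have Et : \int[mu]_x (u (x + c *: - e i) * eta x) = \int[mu]_x (u x * eta (x + c *: e i)).
  rewrite -(Rintegral_translation (c *: e i)); last exact: integrableR_measurable it.
  by apply: eq_Rintegral => x _; rewrite scalerN addrK.
have EI : \int[mu]_x ((\int[lam]_(t in `[0, c]) g (x + t *: - e i)) * eta x) =
    \int[lam]_(t in `[0, c]) \int[mu]_x (eta x * g (x + t *: - e i)).
  have [B HB] := line_bound i se lg c0'.
  have [||_ _ <-] := @line_fubini R eta g (- e i) c B se.1 lg.1 c0'.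
  - by move=> t tc; under eq_fun do rewrite line_opp; apply: (HB _ _).1; rewrite normrN.
  - by move=> t tc; under eq_Rintegral do rewrite line_opp; apply: (HB _ _).2; rewrite normrN.
  apply: ae_eq_Rintegral.
  - exact: integrableR_measurable iI.
  - have [+ _ _] := @line_fubini R eta g (- e i) c B se.1 lg.1 c0'
      (fun t tc => ltac:(under eq_fun do rewrite line_opp; apply: (HB _ _).1; rewrite normrN//))
      (fun t tc => ltac:(under eq_Rintegral do rewrite line_opp; apply: (HB _ _).2; rewrite normrN//)).
    exact: integrableR_measurable.
  apply: aeS (line_integrable_ae i lg) => x /(_ (Num.truncn c).+1) ig _.
  rewrite RintegralZl//; first by rewrite mulrC.
  apply: integrable_itvS ig => t /=; rewrite !in_itv/= => /andP[-> /le_trans]; apply.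
  exact/ltW/truncnS_gt.
have Ez x : eta x - eta (x + c *: e i) = \int[lam]_(t in `[0, c]) partial i z (x + t *: e i).
  by rewrite line_ftc//; [rewrite /z; lra|exact: tz.1].
have Eu : \int[mu]_x (u x * eta x) - \int[mu]_x (u x * eta (x + c *: e i)) =
    \int[lam]_(t in `[0, c]) \int[mu]_x (eta x * g (x + t *: - e i)).
  rewrite -RintegralB//; last first.
    exact/(locint_mul lu)/bounded_support_translation.
  have [B HB] := line_bound_loc i lu spz c0'.
  have [||_ _ E] := @line_fubini R u (partial i z) (e i) c B lu.1 spz.1 c0'.
  - by move=> t tc; apply: (HB _ _).1.
  - by move=> t tc; apply: (HB _ _).2.
  transitivity (\int[mu]_x \int[lam]_(t in `[0, c]) (u x * partial i z (x + t *: e i))).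
    apply: eq_Rintegral => x _; rewrite -mulrBr Ez RintegralZl//.
    apply: continuous_compact_integrable; first exact: segment_compact.
    apply: continuous_subspaceT; apply: line_continuous; exact: test_function_continuous tpz.
  rewrite E; apply: eq_Rintegral => t _.
  have tzt := test_function_translation i t tz.
  under eq_Rintegral do rewrite -partial_translation.
  rewrite Hg//.
  have igz : integrableR mu (fun x => g x * eta (x + t *: e i)).
    exact/(locint_mul lg)/bounded_support_translation.
  under eq_Rintegral do rewrite /z mulrCA.
  rewrite RintegralZl// mulN1r opprK.
  rewrite -[LHS](Rintegral_translation (t *: - e i)); last exact: integrableR_measurable igz.
  by apply: eq_Rintegral => x _; rewrite scalerN subrK mulrC.
by rewrite Et EI -Eu; lra.
Qed.

End Lines.

(** * Pointwise bounds by line integrals *)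

Section LineInequality.
Variable R : realType.
Local Notation lam := (@lebesgue_measure R).
Local Notation mu := (@leb3 R).
Local Notation R1 := (measurableTypeR R).
Local Notation e := (basis3 R).
Implicit Types (u g h : R3 R -> R) (v x : R3 R) (c a t M : R).

Lemma measurable_along h v : measurable_fun setT h ->
  measurable_fun setT (fun z : R3 R1 * R1 => h (z.1 + z.2 *: v)).
Proof. by move=> mh; exact: (measurableT_comp mh (measurable_line v)). Qed.

Lemma measurable_at h v (x : R3 R) : measurable_fun setT h ->
  measurable_fun setT (fun t : R1 => h (x + t *: v)).
Proof.
move=> mh; exact: (measurableT_comp (measurable_along v mh) (measurable_pair1 (x : R3 R1))).
Qed.

(** In [weak_difference] the exceptional set depends on the length of the segment. Working on one
    line requires x to be fixed first, at the price of an exceptional null set of lengths. *)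
Lemma weak_difference_ae i u g : is_weak_partial i u g ->
  {ae mu, forall x, {ae lam, forall t, 0 < t ->
    u x - u (x + t *: - e i) = \int[lam]_(s in `[0, t]) g (x + s *: - e i)}}.
Proof.
move=> H; have /is_weak_partialP[lu lg _] := H.
pose D (z : R3 R1 * R1) : R := u z.1 - u (z.1 + z.2 *: - e i)
  - \int[lam]_(s in `[0, z.2]) g (z.1 + s *: - e i).
have mD : measurable_fun setT D.
  apply: measurable_funB; last exact: (measurable_primitive (- e i) lg.1).
  apply: measurable_funB; last exact: measurable_along lu.1.
  exact: (measurableT_comp lu.1 measurable_fst).
pose N : set (R3 R1 * R1) := (snd @^-1` `]0, +oo[) `&` (D @^-1` (~` [set 0])).
have mN : measurable N.
  apply: measurableI.
    rewrite -[X in measurable X]setTI; apply: measurable_snd => //; exact: measurable_interval.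
  rewrite -[X in measurable X]setTI; apply: mD => //; exact: measurableC.
have N0 t : mu [set x | N (x, t)] = 0%E.
  have [t0|t0] := ltP 0 t; last first.
    rewrite (_ : [set x | _] = set0) ?measure0//; apply/seteqP; split=> // x [/=].
    by rewrite in_itv/= andbT ltNge t0.
  have mNt : measurable [set x | N (x, t)].
    have := measurable_ysection (t : R1) mN; congr (measurable _).
    by apply/seteqP; split=> x; rewrite /ysection/= inE.
  apply: measure_negligible => //.
  have [B [mB B0 sB]] := weak_difference t0 H.
  exists B; split=> //; apply: subset_trans sB => x [/= _] Dx E; apply: Dx.
  by rewrite /D /= E subrr.
have := ae_sections lam mN N0; apply: aeS => x; apply: aeS => t Nt t0.
apply: contrapT => E; apply: Nt; split; first by rewrite /= in_itv/= t0.
by move=> /= Dx; apply: E; apply/eqP; rewrite -subr_eq0; apply/eqP.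
Qed.

Lemma box_line_diam n i x s t : box n (x + s *: e i) -> box n (x + t *: e i) ->
  `|s - t| <= 2 * n.
Proof.
have H (b y z : R) : - n <= y + s * b <= n -> - n <= y + t * b <= n -> b = 1 -> `|s - t| <= 2 * n.
  move=> /andP[? ?] /andP[? ?] b1; subst b; rewrite ler_norml; apply/andP; split; lra.
case: x => -[x y] z [[/=]]; rewrite /= !in_itv/= => x1 y1 z1 [[/=]]; rewrite /= !in_itv/= => x2 y2 z2.
case: i x1 y1 z1 x2 y2 z2 => -[|[|[|//]]] ki /= x1 y1 z1 x2 y2 z2.
- exact: H x1 x2 _.
- exact: H y1 y2 _.
- exact: H z1 z2 _.
Qed.

Lemma line_box_measure (n : nat) i x :
  (\int[lam]_t (\1_(box n%:R) (x + t *: e i) : R)%:E <= (4 * n%:R)%:E)%E.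
Proof.
have [[t0 xt0]|nt] := pselect (exists t, box n%:R (x + t *: e i)); last first.
  rewrite integral0_eq ?lee_fin ?mulr_ge0// => t _.
  by rewrite indicE memNset// => xt; apply: nt; exists t.
have -> : (4 * n%:R)%:E = lam (`[t0 - 2 * n%:R, t0 + 2 * n%:R]%classic : set R1) :> \bar R.
  rewrite lebesgue_measure_itv/= lte_fin.
  case: ifPn => [_|]; first by rewrite -EFinB; congr EFin; ring.
  have n0 := ler0n R n.
  by rewrite -leNgt => h; congr EFin; lra.
rewrite -[X in (_ <= lam X)%E]setIT -(integral_indic _ measurableT (measurable_interval _)).
apply: ge0_le_integral => //.
- apply/measurable_EFinP; apply: (@measurable_at (\1_(box n%:R))).
  by apply: measurable_indic; exact: measurable_box.
- by apply/measurable_EFinP; apply: measurable_indic; exact: measurable_interval.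
move=> t _; rewrite lee_fin !indicE ler_nat.
case: (boolP (_ \in _)) => // /set_mem /(box_line_diam xt0); rewrite ler_norml => h.
by rewrite mem_set//= in_itv/=; lra.
Qed.

(** Let x range over a box and exchange the integrals. After a translation, a point y is weighted by
    the length of the set of t for which y + t e lies in the box, at most 4 times its half-width k,
    so the total is finite. *)
Lemma line_finite h i : (forall x, 0 <= h x) -> integrableR mu h ->
  {ae mu, forall x, (\int[lam]_t (h (x + t *: - e i))%:E < +oo)%E}.
Proof.
move=> h0 ih; have mh := integrableR_measurable ih.
have mI k : measurable_fun setT (\1_(box k%:R) : R3 R1 -> R).
  by apply: measurable_indic; exact: measurable_box.
pose K (k : nat) (z : R3 R1 * R1) : \bar R := (\1_(box k%:R) z.1 * h (z.1 + z.2 *: - e i))%:E.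
have mK k : measurable_fun setT (K k).
  apply/measurable_EFinP; apply: measurable_funM; last exact: measurable_along.
  exact: (measurableT_comp (mI k) measurable_fst).
have K0 k z : (0 <= K k z)%E by rewrite lee_fin mulr_ge0.
have fin k : (\int[mu]_x \int[lam]_t K k (x, t) < +oo)%E.
  rewrite (@fubini_tonelli _ _ _ _ R mu lam (K k) (mK k) (K0 k)).
  pose K' (z : R3 R1 * R1) : \bar R := (\1_(box k%:R) (z.1 + z.2 *: e i) * h z.1)%:E.
  have mK' : measurable_fun setT K'.
    apply/measurable_EFinP; apply: measurable_funM; last exact: (measurableT_comp mh measurable_fst).
    exact: (measurable_along (e i) (mI k)).
  have K'0 z : (0 <= K' z)%E by rewrite lee_fin mulr_ge0.
  have E t : (\int[mu]_x K k (x, t) = \int[mu]_x K' (x, t))%E.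
    have mKt := measurableT_comp (mK k) (measurable_pair2 (t : R1)).
    rewrite -(leb3_integral_translation (t *: e i) mKt (fun x => K0 k (x, t))).
    by apply: eq_integral => x _; rewrite /K /K' /= scalerN addrK.
  under eq_integral do rewrite E.
  rewrite -(@fubini_tonelli _ _ _ _ R mu lam K' mK' K'0).
  apply: (@le_lt_trans _ _ (\int[mu]_x (4 * k%:R * h x)%:E)%E).
    apply: ge0_le_integral => //.
    - by move=> x _; exact: integral_ge0.
    - exact: (@measurable_fun_fubini_tonelli_F _ _ _ _ R lam K' mK' K'0).
    - by apply/measurable_EFinP; exact: measurable_funM.
    move=> x _; rewrite /K' /=; under eq_integral do rewrite EFinM muleC.
    rewrite ge0_integralZl//; last 2 first.
    - by apply/measurable_EFinP; exact: (measurable_at (e i) x (mI k)).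
    - by rewrite lee_fin.
    rewrite muleC EFinM; apply: lee_wpmul2r; first by rewrite lee_fin.
    exact: line_box_measure.
  have ih' := integrableRZ (4 * k%:R) ih.
  have := integrable_fin_num measurableT ih'.
  by rewrite fin_numElt => /andP[].
have H k : {ae mu, forall x, setT x -> (\int[lam]_t K k (x, t))%E \is a fin_num}.
  apply: integrable_ae => //; apply/integrableP; split.
    exact: (@measurable_fun_fubini_tonelli_F _ _ _ _ R lam (K k) (mK k) (K0 k)).
  apply: le_lt_trans (fin k); rewrite le_eqVlt; apply/orP; left; apply/eqP.
  by apply: eq_integral => x _; rewrite gee0_abs// integral_ge0.
have /ae_foralln := H; apply: aeS => x Hx.
have [k xk] := @compact_sub_box R [set x] (@compact_set1 _ _).
have := Hx k I; rewrite ge0_fin_numE; last exact: integral_ge0.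
congr (_ < _)%E; apply: eq_integral => t _; rewrite /K /= indicE mem_set ?mul1r//.
exact: xk.
Qed.

Lemma lebesgue_integral_opp (f : R -> \bar R) : measurable_fun setT f ->
  (forall t, 0 <= f t)%E -> (\int[lam]_t f (- t)%R = \int[lam]_t f t)%E.
Proof.
move=> mf f0; pose T : measurableTypeR R -> measurableTypeR R := fun x : R => - x.
have mT : measurable_fun setT T by exact: oppr_measurable.
have := @ge0_integral_pushforward _ _ (measurableTypeR R) (measurableTypeR R) R T mT lam setT f measurableT mf.
rewrite preimage_setT => <-; last by move=> x _; exact: f0.
by apply: eq_measure_integral => A mA _; exact: lebesgue_measureN.
Qed.

Lemma fine_le_ereal (r : \bar R) : (0 <= r -> (fine r)%:E <= r)%E.
Proof. by case: r => [r| |] //= _; rewrite leey. Qed.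

(** For almost every x, t |-> u (x - t e) agrees for almost every t with a primitive F whose value
    at 0 is exactly u x. [line_chain] is applied between 0 and a point T where |F| is tiny, and the
    integral over [0, T] is enlarged to the whole line. *)
Lemma sobolev_line i u g a c M : is_weak_partial i u g -> Lp mu a u -> 0 < a ->
  1 < c -> 0 <= M ->
  {ae mu, forall x, ((Num.min `|u x| M `^ c)%:E <= c%:E *
    \int[lam]_t (Num.min `|u (x + t *: e i)| M `^ (c - 1) * `|g (x + t *: e i)|)%:E)%E}.
Proof.
move=> H [mu_ iu] a0 c1 M0; have /is_weak_partialP[lu lg _] := H.
have c0 : 0 < c by lra.
pose V x : R := Num.min `|u x| M `^ (c - 1) * `|g x|.
have mg := lg.1.
have mmin (f : R1 -> R) : measurable_fun setT f -> measurable_fun setT (fun t => Num.min `|f t| M `^ (c - 1)).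
  move=> mf; have mm : measurable_fun setT (fun t : R1 => Num.min `|f t| M).
    by apply: measurable_minr => //; exact: measurableT_comp.
  have := measurable_powR_abs (c - 1) mm; congr (measurable_fun _ _).
  by apply/funext => t; rewrite ger0_norm// le_min normr_ge0.
have := line_finite i (fun x => powR_ge0 `|u x| a) iu.
apply: aeS3 (weak_difference_ae H) (line_integrable_ae i lg) => x Hd Hi Hf.
pose U t : R := u (x + t *: - e i); pose G t : R := g (x + t *: - e i).
have mU : measurable_fun (setT : set R1) U by exact: measurable_at.
have mG : measurable_fun (setT : set R1) G by exact: measurable_at.
pose F t : R := u x - \int[lam]_(s in `[0, t]) G s.
have mF : measurable_fun (setT : set R1) F.
  apply: measurable_funB => //.
  exact: (measurableT_comp (measurable_primitive (- e i) mg) (measurable_pair1 (x : R3 R1))).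
have F0 : F 0 = u x.
  rewrite /F set_itv1 Rintegral_set1 subr0//.
have UF : {ae lam, forall t, 0 < t -> U t = F t}.
  by apply: aeS Hd => t Ht t0; rewrite /F -(Ht t0) /U; lra.
have K0 t : 0 <= Num.min `|U t| M `^ (c - 1) * `|G t| by rewrite mulr_ge0 ?powR_ge0.
pose KU t : \bar R := (Num.min `|U t| M `^ (c - 1) * `|G t|)%:E.
pose KF t : \bar R := (Num.min `|F t| M `^ (c - 1) * `|G t|)%:E.
have mKU : measurable_fun (setT : set R1) KU.
  by apply/measurable_EFinP; apply: measurable_funM; [exact: mmin|exact: measurableT_comp].
have mKF : measurable_fun (setT : set R1) KF.
  by apply/measurable_EFinP; apply: measurable_funM; [exact: mmin|exact: measurableT_comp].
have KU0 t : (0 <= KU t)%E by rewrite lee_fin.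
have KF0 t : (0 <= KF t)%E by rewrite lee_fin mulr_ge0 ?powR_ge0.
suff main (eps : R) : 0 < eps ->
    ((Num.min `|u x| M `^ c)%:E <= eps%:E + c%:E * \int[lam]_t KU t)%E.
  (* The difference identity runs in direction -e; the reflection t |-> -t restores +e. *)
  have -> : (\int[lam]_t (V (x + t *: e i))%:E = \int[lam]_t KU t)%E.
    rewrite -(@lebesgue_integral_opp (fun t => (V (x + t *: e i))%:E)).
    - by apply: eq_integral => t _; rewrite /KU /U /G /V line_opp.
    - apply/measurable_EFinP; apply: measurable_funM.
        by apply: mmin; exact: measurable_at.
      by apply: measurableT_comp => //; exact: measurable_at.
    - by move=> t; rewrite lee_fin mulr_ge0 ?powR_ge0.
  by apply/lee_addgt0Pr => eps /main; rewrite addeC.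
move=> eps0.
(* Otherwise |U| would be at least d at almost every positive t, and the integral of |U|^a over the
   line would be infinite. T must also avoid the null set where U and F differ. *)
have [T [T0 UT UTe]] : exists T : R, [/\ 0 < T, U T = F T & Num.min `|U T| M `^ c <= eps].
  apply: contrapT => nT.
  pose d := eps `^ c^-1; have d0 : 0 < d by rewrite powR_gt0.
  have : {ae lam, forall t, 0 < t -> d <= `|U t|}.
    apply: aeS UF => t UFt t0; rewrite leNgt; apply/negP => Ud; apply: nT.
    exists t; split; [by []|exact: UFt|].
    apply: (@le_trans _ _ (d `^ c)); last first.
      by rewrite /d -powRrM mulVf ?gt_eqF// powRr1// ltW.
    apply: ge0_ler_powR; [exact: ltW|by rewrite nnegrE le_min normr_ge0| |].
      by rewrite nnegrE ltW.
    by rewrite ge_min (ltW Ud).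
  move=> dU.
  have : (\int[lam]_(t in `]0%R, +oo[) (d `^ a)%:E <= \int[lam]_t (`|U t| `^ a)%:E)%E.
    have mUa : measurable_fun (setT : set R1) (fun t => (`|U t| `^ a)%:E).
      by apply/measurable_EFinP; exact: measurable_powR_abs.
    apply: (@le_trans _ _ (\int[lam]_(t in `]0%R, +oo[) (`|U t| `^ a)%:E)%E); last first.
      by apply: ge0_subset_integral.
    apply: ae_ge0_le_integral => //.
    - by move=> t _; rewrite lee_fin powR_ge0.
    - exact: measurable_funS mUa.
    apply: aeS dU => t dt; rewrite /= in_itv/= andbT => /dt dUt.
    by rewrite lee_fin ge0_ler_powR ?nnegrE// ltW.
  rewrite integral_cst; last exact: measurable_interval.
  rewrite [X in (_ * X)%E]lebesgue_measure_itv/= ltry /= gt0_muley ?lte_fin ?powR_gt0// leye_eq => /eqP E.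
  by move: Hf; rewrite -/(U) E ltxx.
have iG : lam.-integrable `[0, T] (EFin \o G).
  apply: integrable_itvS (Hi (Num.truncn T).+1) => t /=; rewrite !in_itv/= => /andP[-> /le_trans]; apply.
  exact/ltW/truncnS_gt.
have FE t : 0 <= t <= T -> F t = F 0 - \int[lam]_(s in `[0, t]) G s by rewrite F0.
have := line_chain T0 M0 c1 iG FE; rewrite F0 -lee_fin => /le_trans; apply.
rewrite EFinD; apply: leeD; first by rewrite lee_fin -UT.
rewrite EFinM; apply: lee_wpmul2l; first by rewrite lee_fin ltW.
apply: le_trans (fine_le_ereal _) _; first by apply: integral_ge0 => t _; exact: KF0.
rewrite (_ : (\int[lam]_(t in `[0%R, T]) _ = \int[lam]_(t in `[0%R, T]) KU t)%E); last first.
  rewrite -(integral_itv_obnd_cbnd (measurable_funS measurableT (@subsetT _ _) mKF)).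
  rewrite -(integral_itv_obnd_cbnd (measurable_funS measurableT (@subsetT _ _) mKU)).
  apply: ge0_ae_eq_integral => //.
  - exact: measurable_funS mKF.
  - exact: measurable_funS mKU.
  by apply: aeS UF => t UFt; rewrite /= in_itv/= => /andP[/UFt E _]; rewrite /KU /KF E.
exact: ge0_subset_integral.
Qed.

End LineInequality.

(** * The Loomis-Whitney inequality *)

Section CauchySchwarz.
Context d (T : measurableType d) (R : realType).
Variable m : {measure set T -> \bar R}.
Local Open Scope ereal_scope.
Local Notation "'rt' x" := (x `^ (2^-1))%E (at level 10).

Lemma rt_mul_le (s : R) (x y : \bar R) : (0 < s)%R -> 0 <= x -> 0 <= y ->
  rt x * rt y <= (s / 2)%:E * x + (2 * s)^-1%:E * y.
Proof.
move=> s0; have s2 : (0 < s / 2)%R by rewrite divr_gt0.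
have s3 : (0 < (2 * s)^-1)%R by rewrite invr_gt0 mulr_gt0.
case: x => [a| |] //; case: y => [b| |] //.
- rewrite !lee_fin => a0 b0; rewrite !powR12_sqrt//.
  have -> : (s / 2 * a + (2 * s)^-1 * b = Num.sqrt a * Num.sqrt b +
      (2 * s)^-1 * (s * Num.sqrt a - Num.sqrt b) ^+ 2)%R.
    rewrite -{1}(sqr_sqrtr a0) -{1}(sqr_sqrtr b0); field.
    by rewrite gt_eqF.
  by rewrite lerDl mulr_ge0 ?sqr_ge0// ltW.
- move=> a0 _; rewrite gt0_muley ?lte_fin// addey ?leey//.
- move=> _ b0; rewrite gt0_muley ?lte_fin// addye ?leey//.
- by move=> _ _; rewrite !gt0_muley ?lte_fin// leey.
Qed.

Lemma measurable_rt (f : T -> \bar R) : measurable_fun setT f ->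
  measurable_fun setT (fun x => rt (f x)).
Proof. by move=> mf; exact: (measurableT_comp (measurable_poweR (2^-1)) mf). Qed.

(** The degenerate case of [cauchy_schwarz], where no optimal weight exists. Where f vanishes the
    product is 0 even if g is infinite. *)
Lemma rt_integral_eq0 (f g : T -> \bar R) : measurable_fun setT f -> measurable_fun setT g ->
  (forall x, 0 <= f x) -> \int[m]_x f x = 0 -> \int[m]_x (rt (f x) * rt (g x)) = 0.
Proof.
move=> mf mg f0 If; have [+ _] := ae_eq_integral_abs m measurableT mf.
rewrite (eq_integral f); last by move=> x _; rewrite gee0_abs.
move=> /(_ If) f0ae; rewrite -(integral0 m setT); apply: ge0_ae_eq_integral => //.
- by apply: emeasurable_funM; exact: measurable_rt.
- by move=> x _; rewrite mule_ge0 ?poweR_ge0.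
- by apply: aeS f0ae => x /(_ I) -> _; rewrite poweR0r ?mul0e// gt_eqF.
Qed.

(** Extended values are kept because inner integrals in the Loomis-Whitney inequality may be
    infinite. The finite case minimizes the weighted arithmetic-geometric bound [rt_mul_le] over its
    weight. *)
Lemma cauchy_schwarz (f g : T -> \bar R) : measurable_fun setT f -> measurable_fun setT g ->
  (forall x, 0 <= f x) -> (forall x, 0 <= g x) ->
  \int[m]_x (rt (f x) * rt (g x)) <= rt (\int[m]_x f x) * rt (\int[m]_x g x).
Proof.
move=> mf mg f0 g0.
have F0 : 0 <= \int[m]_x f x by exact: integral_ge0.
have G0 : 0 <= \int[m]_x g x by exact: integral_ge0.
have [F00|Fn0] := eqVneq (\int[m]_x f x) 0.
  by rewrite rt_integral_eq0// mule_ge0 ?poweR_ge0.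
have [G00|Gn0] := eqVneq (\int[m]_x g x) 0.
  under eq_integral do rewrite muleC.
  by rewrite rt_integral_eq0// mule_ge0 ?poweR_ge0.
have Fp : 0 < \int[m]_x f x by rewrite lt_neqAle eq_sym Fn0.
have Gp : 0 < \int[m]_x g x by rewrite lt_neqAle eq_sym Gn0.
have [Foo|Ffin] := eqVneq (\int[m]_x f x) +oo.
  by rewrite Foo poweRyr// gt0_mulye ?leey// poweR_gt0.
have [Goo|Gfin] := eqVneq (\int[m]_x g x) +oo.
  by rewrite Goo poweRyr// gt0_muley ?leey// poweR_gt0.
have main (s : R) : (0 < s)%R -> \int[m]_x (rt (f x) * rt (g x)) <=
    (s / 2)%:E * \int[m]_x f x + (2 * s)^-1%:E * \int[m]_x g x.
  move=> s0; have s2 : (0 <= s / 2)%R by rewrite divr_ge0// ltW.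
  have s3 : (0 <= (2 * s)^-1)%R by rewrite invr_ge0 mulr_ge0// ltW.
  rewrite -!ge0_integralZl// -ge0_integralD//.
  - apply: ge0_le_integral => //.
    + by move=> x _; rewrite mule_ge0 ?poweR_ge0.
    + by apply: emeasurable_funM; exact: measurable_rt.
    + by apply: emeasurable_funD; exact: measurable_funeM.
    + by move=> x _; exact: rt_mul_le.
  - by move=> x _; rewrite mule_ge0.
  - exact: measurable_funeM.
  - by move=> x _; rewrite mule_ge0.
  - exact: measurable_funeM.
move: Fp Gp Ffin Gfin main; case: (\int[m]_x f x) => [a| |]//; case: (\int[m]_x g x) => [b| |]//.
rewrite !lte_fin => a0 b0 _ _ main.
have sa : (0 < Num.sqrt a)%R by rewrite sqrtr_gt0.
have sb : (0 < Num.sqrt b)%R by rewrite sqrtr_gt0.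
(* This weight makes the two summands equal, each being half of the product of the square roots. *)
have := main (Num.sqrt b / Num.sqrt a)%R (divr_gt0 sb sa).
move=> /le_trans; apply; rewrite -!EFinM -EFinD lee_fin (powR12_sqrt (ltW a0)) (powR12_sqrt (ltW b0)) le_eqVlt.
apply/orP; left; apply/eqP; rewrite -{2}(sqr_sqrtr (ltW a0)) -{3}(sqr_sqrtr (ltW b0)).
by field; rewrite !gt_eqF.
Qed.

End CauchySchwarz.

Lemma measurableT_comp_fun d1 d2 d3 (T1 : measurableType d1) (T2 : measurableType d2)
    (T3 : measurableType d3) (f : T2 -> T3) (g : T1 -> T2) :
  measurable_fun setT f -> measurable_fun setT g -> measurable_fun setT (fun x => f (g x)).
Proof. exact: measurableT_comp. Qed.

Section LoomisWhitney.
Variable R : realType.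
Local Notation lam := (@lebesgue_measure R).
Local Notation mu := (@leb3 R).
Local Notation R1 := (measurableTypeR R).
Local Notation e := (basis3 R).
Local Open Scope ereal_scope.
Local Notation "'rt' x" := (x `^ (2^-1))%E (at level 10).
Local Notation i0 := (@Ordinal 3 0 isT).
Local Notation i1 := (@Ordinal 3 1 isT).
Local Notation i2 := (@Ordinal 3 2 isT).

Lemma ge0_le_integralT d (T : measurableType d) (m : {measure set T -> \bar R}) (f g : T -> \bar R) :
  measurable_fun setT f -> measurable_fun setT g -> (forall x, 0 <= f x) ->
  (forall x, f x <= g x) -> \int[m]_x f x <= \int[m]_x g x.
Proof.
move=> mf mg f0 fg; apply: ge0_le_integral => //.
Qed.

(** Cauchy-Schwarz in z, then in y, then in x: each variable occurs in exactly two of the three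
    factors, and the third factor comes out of the integral. *)
Lemma loomis_whitney_sections (A B C : R1 * R1 -> \bar R) (I : \bar R) :
  measurable_fun setT A -> measurable_fun setT B -> measurable_fun setT C ->
  (forall z, 0 <= A z) -> (forall z, 0 <= B z) -> (forall z, 0 <= C z) ->
  \int[lam]_y \int[lam]_z A (y, z) = I -> \int[lam]_x \int[lam]_z B (x, z) = I ->
  \int[lam]_x \int[lam]_y C (x, y) = I ->
  \int[lam]_x \int[lam]_y \int[lam]_z (rt (A (y, z)) * rt (B (x, z)) * rt (C (x, y)))
  <= rt I * (rt I * rt I).
Proof.
move=> mA mB mC A0 B0 C0 IA IB IC.
pose a y := \int[lam]_z A (y, z); pose b x := \int[lam]_z B (x, z); pose c x := \int[lam]_y C (x, y).
have ma : measurable_fun (setT : set R1) a := @measurable_fun_fubini_tonelli_F _ _ R1 R1 R lam A mA A0.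
have mb : measurable_fun (setT : set R1) b := @measurable_fun_fubini_tonelli_F _ _ R1 R1 R lam B mB B0.
have mc : measurable_fun (setT : set R1) c := @measurable_fun_fubini_tonelli_F _ _ R1 R1 R lam C mC C0.
have a0 y : 0 <= a y by exact: integral_ge0.
have b0 y : 0 <= b y by exact: integral_ge0.
have c0 y : 0 <= c y by exact: integral_ge0.
have mAy y : measurable_fun (setT : set R1) (fun z => A (y, z)) := measurableT_comp mA (measurable_pair1 y).
have mBx x : measurable_fun (setT : set R1) (fun z => B (x, z)) := measurableT_comp mB (measurable_pair1 x).
have mCx x : measurable_fun (setT : set R1) (fun y => C (x, y)) := measurableT_comp mC (measurable_pair1 x).
pose P (w : (R1 * R1) * R1) := rt (A (w.1.2, w.2)) * rt (B (w.1.1, w.2)) * rt (C w.1).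
have mP : measurable_fun setT P.
  apply: emeasurable_funM; [apply: emeasurable_funM|]; apply: measurable_rt.
  - apply: (measurableT_comp_fun mA (g := fun w : (R1 * R1) * R1 => (w.1.2, w.2))).
    apply: measurable_fun_pair; last exact: measurable_snd.
    exact: (measurableT_comp measurable_snd measurable_fst).
  - apply: (measurableT_comp_fun mB (g := fun w : (R1 * R1) * R1 => (w.1.1, w.2))).
    apply: measurable_fun_pair; last exact: measurable_snd.
    exact: (measurableT_comp measurable_fst measurable_fst).
  - exact: (measurableT_comp mC measurable_fst).
have P0 w : 0 <= P w by rewrite !mule_ge0// poweR_ge0.
have step1 x y : \int[lam]_z P (x, y, z) <= rt (C (x, y)) * (rt (a y) * rt (b x)).
  rewrite /P /=; under eq_integral do rewrite muleC.
  rewrite ge0_integralZl//.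
  - by apply: lee_wpmul2l; [exact: poweR_ge0|exact: cauchy_schwarz].
  - by apply: emeasurable_funM; exact: measurable_rt.
  - by move=> z _; rewrite mule_ge0 ?poweR_ge0.
  - exact: poweR_ge0.
have mPz : measurable_fun setT (fun z : R1 * R1 => \int[lam]_w P (z, w)).
  exact: (@measurable_fun_fubini_tonelli_F _ _ (R1 * R1)%type R1 R lam P mP P0).
have Pz0 (z : R1 * R1) : 0 <= \int[lam]_w P (z, w) by exact: integral_ge0.
have mPy x : measurable_fun (setT : set R1) (fun y => \int[lam]_w P (x, y, w)).
  exact: (measurableT_comp mPz (measurable_pair1 x)).
have mPx : measurable_fun (setT : set R1) (fun x => \int[lam]_y \int[lam]_w P (x, y, w)).
  exact: (@measurable_fun_fubini_tonelli_F _ _ R1 R1 R lam _ mPz Pz0).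
have PE : \int[lam]_x \int[lam]_y \int[lam]_z (rt (A (y, z)) * rt (B (x, z)) * rt (C (x, y))) =
  \int[lam]_x \int[lam]_y \int[lam]_z P (x, y, z) by [].
rewrite PE; clear PE; clearbody P.
have mrM (f g : R1 -> \bar R) (k : \bar R) : measurable_fun setT f -> measurable_fun setT g ->
    measurable_fun setT (fun x => k * (rt (f x) * rt (g x))).
  by move=> mf mg; apply: measurable_funeM; apply: emeasurable_funM; exact: measurable_rt.
have rtZ (f g : R1 -> \bar R) (k : \bar R) : measurable_fun setT f -> measurable_fun setT g ->
    (forall x, 0 <= f x) -> (forall x, 0 <= g x) ->
    \int[lam]_x (rt k * (rt (f x) * rt (g x))) <= rt k * (rt (\int[lam]_x f x) * rt (\int[lam]_x g x)).
  move=> mf mg f0 g0; rewrite ge0_integralZl//.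
  - by apply: lee_wpmul2l; [exact: poweR_ge0|exact: cauchy_schwarz].
  - by apply: emeasurable_funM; exact: measurable_rt.
  - by move=> z _; rewrite mule_ge0 ?poweR_ge0.
  - exact: poweR_ge0.
have step2 x : \int[lam]_y \int[lam]_z P (x, y, z) <= rt (b x) * (rt (c x) * rt I).
  apply: (@le_trans _ _ (\int[lam]_y (rt (b x) * (rt (C (x, y)) * rt (a y))))).
    apply: (@ge0_le_integralT _ _ lam _ _ (mPy x) (mrM _ _ (rt (b x)) (mCx x) ma) (fun y => Pz0 (x, y))) => y.
    by rewrite muleC -muleA.
  by rewrite -IA; exact: (rtZ _ _ (b x) (mCx x) ma (fun y => C0 (x, y)) a0).
apply: (@le_trans _ _ (\int[lam]_x (rt I * (rt (b x) * rt (c x))))).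
  apply: (@ge0_le_integralT _ _ lam _ _ mPx (mrM _ _ (rt I) mb mc)) => x.
    by apply: integral_ge0 => y _.
  by rewrite muleC -muleA.
by have := rtZ _ _ I mb mc b0 c0; rewrite IB IC.
Qed.

(** f^(3/2) is the product of three square roots of f, each bounded by the line integral in one
    direction. The integral in direction i no longer depends on coordinate i, which yields the three
    functions of two variables, all with the same total integral. *)
Lemma loomis_whitney (V f : R3 R -> R) : (forall x, (0 <= V x)%R) -> (forall x, (0 <= f x)%R) ->
  measurable_fun setT V -> measurable_fun setT f ->
  (forall i, {ae mu, forall x, (f x)%:E <= \int[lam]_t (V (x + t *: e i)%R)%:E}) ->
  \int[mu]_x (f x `^ (3 / 2))%:E <= (\int[mu]_x (V x)%:E) `^ (3 / 2).
Proof.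
move=> V0 f0 mV mf H.
pose S i x := \int[lam]_t (V (x + t *: e i)%R)%:E.
have mVE : measurable_fun setT (EFin \o V) by exact/measurable_EFinP.
have VE0 x : 0 <= (EFin \o V) x by rewrite lee_fin.
have mS i : measurable_fun setT (S i).
  apply: (@measurable_fun_fubini_tonelli_F _ _ (R3 R1) R1 R lam (fun z => (V (z.1 + z.2 *: e i)%R)%:E)).
    by apply/measurable_EFinP; exact: measurable_along.
  by move=> z; rewrite lee_fin.
have S0 i x : 0 <= S i x by apply: integral_ge0 => t _; rewrite lee_fin.
have mrt := measurable_rt.
have mP : measurable_fun setT (fun x => rt (S i0 x) * rt (S i1 x) * rt (S i2 x)).
  by apply: emeasurable_funM; [apply: emeasurable_funM|]; exact: mrt.
have P0 x : 0 <= rt (S i0 x) * rt (S i1 x) * rt (S i2 x).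
  by rewrite !mule_ge0// poweR_ge0.
apply: (@le_trans _ _ (\int[mu]_x (rt (S i0 x) * rt (S i1 x) * rt (S i2 x)))).
  apply: ae_ge0_le_integral => //.
  - by move=> x _; rewrite lee_fin powR_ge0.
  - have := measurable_powR_abs (3 / 2) mf => mfp; apply/measurable_EFinP.
    by move: mfp; congr (measurable_fun _ _); apply/funext => x; rewrite ger0_norm.
  apply: aeS3 (H i0) (H i1) (H i2) => x h0 h1 h2 _.
  have -> : (f x `^ (3 / 2))%:E = rt (f x)%:E * rt (f x)%:E * rt (f x)%:E.
    rewrite !poweR_EFin -!EFinM -powRD; last by rewrite gt_eqF// addr_gt0.
    rewrite -powRD; last by rewrite gt_eqF// !addr_gt0.
    by congr (_ `^ _)%:E; lra.
  have hh (r : \bar R) : (f x)%:E <= r -> rt (f x)%:E <= rt r.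
    by move=> fr; apply: gt0_ler_poweR => //; rewrite in_itv/= leey andbT ?lee_fin// (le_trans _ fr)// lee_fin.
  by apply: lee_pmul; rewrite ?mule_ge0 ?poweR_ge0//; [apply: lee_pmul; rewrite ?poweR_ge0//|]; exact: hh.
rewrite (leb3_tonelli mP P0).
pose A (z : R1 * R1) := \int[lam]_t (V (t, z.1, z.2))%:E.
pose B (z : R1 * R1) := \int[lam]_t (V (z.1, t, z.2))%:E.
pose C (z : R1 * R1) := \int[lam]_t (V (z.1, z.2, t))%:E.
have mA : measurable_fun setT A.
  apply: (@measurable_fun_fubini_tonelli_F _ _ (R1 * R1)%type R1 R lam
    (fun w => (V (w.2, w.1.1, w.1.2))%:E)); last by move=> w; rewrite lee_fin.
  apply: (measurableT_comp_fun mVE (g := fun w : (R1 * R1) * R1 => (w.2, w.1.1, w.1.2) : R3 R1)).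
  apply: measurable_fun_pair; [apply: measurable_fun_pair|]; first exact: measurable_snd.
    exact: (measurableT_comp measurable_fst measurable_fst).
  exact: (measurableT_comp measurable_snd measurable_fst).
have mB : measurable_fun setT B.
  apply: (@measurable_fun_fubini_tonelli_F _ _ (R1 * R1)%type R1 R lam
    (fun w => (V (w.1.1, w.2, w.1.2))%:E)); last by move=> w; rewrite lee_fin.
  apply: (measurableT_comp_fun mVE (g := fun w : (R1 * R1) * R1 => (w.1.1, w.2, w.1.2) : R3 R1)).
  apply: measurable_fun_pair; [apply: measurable_fun_pair|].
  - exact: (measurableT_comp measurable_fst measurable_fst).
  - exact: measurable_snd.
  - exact: (measurableT_comp measurable_snd measurable_fst).
have mC : measurable_fun setT C.
  apply: (@measurable_fun_fubini_tonelli_F _ _ (R1 * R1)%type R1 R lam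
    (fun w => (V (w.1.1, w.1.2, w.2))%:E)); last by move=> w; rewrite lee_fin.
  apply: (measurableT_comp_fun mVE (g := fun w : (R1 * R1) * R1 => (w.1.1, w.1.2, w.2) : R3 R1)).
  apply: measurable_fun_pair; [apply: measurable_fun_pair|].
  - exact: (measurableT_comp measurable_fst measurable_fst).
  - exact: (measurableT_comp measurable_snd measurable_fst).
  - exact: measurable_snd.
have A0 z : 0 <= A z by apply: integral_ge0 => t _; rewrite lee_fin.
have B0 z : 0 <= B z by apply: integral_ge0 => t _; rewrite lee_fin.
have C0 z : 0 <= C z by apply: integral_ge0 => t _; rewrite lee_fin.
have translate (h : R -> R) (x : R) : (forall t, (0 <= h t)%R) -> measurable_fun (setT : set R1) h ->
    \int[lam]_t (h (x + t * 1)%R)%:E = \int[lam]_t (h t)%:E.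
  move=> h0 mh; rewrite -(@lebesgue_integral_translation R x (fun t => (h t)%:E)).
  - by apply: eq_integral => t _; rewrite mulr1 addrC.
  - exact/measurable_EFinP.
  - by move=> t; rewrite lee_fin.
have mV1 y z : measurable_fun (setT : set R1) (fun t => V (t, y, z)).
  apply: (measurableT_comp_fun mV (g := fun t : R1 => (t, y, z) : R3 R1)).
  exact: (measurableT_comp (measurable_pair2 z) (measurable_pair2 y)).
have mV2 x z : measurable_fun (setT : set R1) (fun t => V (x, t, z)).
  apply: (measurableT_comp_fun mV (g := fun t : R1 => (x, t, z) : R3 R1)).
  exact: (measurableT_comp (measurable_pair2 z) (measurable_pair1 x)).
have mV3 x y : measurable_fun (setT : set R1) (fun t => V (x, y, t)).
  exact: (measurableT_comp mV (measurable_pair1 (x, y) : measurable_fun setT (fun t : R1 => (x, y, t) : R3 R1))).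
have z0 (y t : R) : (y + t * 0%:R = y)%R by rewrite mulr0 addr0.
have SA x y z : S i0 (x, y, z) = A (y, z).
  rewrite -[RHS](translate (fun t => V (t, y, z)) x)//.
  apply: eq_integral => t _; congr (V _)%:E; congr (_, _, _); by [|exact: z0].
have SB x y z : S i1 (x, y, z) = B (x, z).
  rewrite -[RHS](translate (fun t => V (x, t, z)) y)//.
  apply: eq_integral => t _; congr (V _)%:E; congr (_, _, _); by [|exact: z0].
have SC x y z : S i2 (x, y, z) = C (x, y).
  rewrite -[RHS](translate (fun t => V (x, y, t)) z)//.
  apply: eq_integral => t _; congr (V _)%:E; congr (_, _, _); by [|exact: z0].
set I := \int[mu]_x (V x)%:E.
have I0 : 0 <= I by apply: integral_ge0 => x _; rewrite lee_fin.
have IT : I = \int[lam]_x \int[lam]_y \int[lam]_z (V (x, y, z))%:E := leb3_tonelli mVE VE0.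
have IC : \int[lam]_x \int[lam]_y C (x, y) = I by rewrite IT.
have IB : \int[lam]_x \int[lam]_z B (x, z) = I.
  rewrite IT; apply: eq_integral => x _.
  rewrite /B /=; apply: (@fubini_tonelli _ _ R1 R1 R lam lam (fun w => (V (x, w.2, w.1))%:E)).
    apply: (measurableT_comp_fun mVE (g := fun w : R1 * R1 => (x, w.2, w.1) : R3 R1)).
    apply: measurable_fun_pair; last exact: measurable_fst.
    exact: (measurableT_comp (measurable_pair1 x) measurable_snd).
  by move=> w; rewrite lee_fin.
have IA : \int[lam]_y \int[lam]_z A (y, z) = I.
  transitivity (\int[lam]_y \int[lam]_t \int[lam]_z (V (t, y, z))%:E).
    apply: eq_integral => y _; rewrite /A /=.
    apply: (@fubini_tonelli _ _ R1 R1 R lam lam (fun w => (V (w.2, y, w.1))%:E)).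
      apply: (measurableT_comp_fun mVE (g := fun w : R1 * R1 => (w.2, y, w.1) : R3 R1)).
      apply: measurable_fun_pair; last exact: measurable_fst.
      exact: (measurableT_comp (measurable_pair2 y) measurable_snd).
    by move=> w; rewrite lee_fin.
  rewrite IT.
  apply: (@fubini_tonelli _ _ R1 R1 R lam lam (fun w => C (w.2, w.1))) => //.
  apply: (measurableT_comp_fun mC (g := fun w : R1 * R1 => (w.2, w.1))).
  by apply: measurable_fun_pair; [exact: measurable_snd|exact: measurable_fst].
under eq_integral do under eq_integral do under eq_integral do rewrite SA SB SC.
apply: le_trans (loomis_whitney_sections mA mB mC A0 B0 C0 IA IB IC) _.
move: I0; case: I {IT IA IB IC} => [r| |] //.
  rewrite lee_fin => r0; rewrite !poweR_EFin -!EFinM lee_fin -powRD; last by rewrite gt_eqF// addr_gt0.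
  rewrite -powRD; last by rewrite gt_eqF// !addr_gt0.
  by rewrite le_eqVlt; apply/orP; left; apply/eqP; congr (_ `^ _)%R; lra.
by move=> _; rewrite [X in _ <= X]poweRyr ?leey// gt_eqF.
Qed.

End LoomisWhitney.

Section Truncation.
Context d (T : measurableType d) (R : realType).
Variable m : {measure set T -> \bar R}.

(** Monotone convergence in the truncation level, with a bound K independent of the level. *)
Lemma Lp_truncation_bound (a : R) (u : T -> R) (K : R) : 0 < a -> measurable_fun setT u ->
  (forall n : nat, Lp m a (fun x => Num.min `|u x| n%:R) /\
    Lpmass m a (fun x => Num.min `|u x| n%:R) <= K) ->
  Lp m a u /\ Lpmass m a u <= K.
Proof.
move=> a0 mu_ H; pose D (n : nat) x := (`|Num.min `|u x| n%:R| `^ a)%:E.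
have min0 n x : 0 <= Num.min `|u x| n%:R :> R by rewrite le_min normr_ge0/=.
have mD n : measurable_fun setT (D n).
  by apply/measurable_EFinP; exact: measurable_powR_abs (H n).1.1.
have D0 n x : setT x -> (0 <= D n x)%E by move=> _; rewrite lee_fin powR_ge0.
have ndD x : setT x -> nondecreasing_seq (D ^~ x).
  move=> _ k n kn; rewrite lee_fin !(ger0_norm (min0 _ _)); apply: ge0_ler_powR; rewrite ?nnegrE ?min0 ?(ltW a0)//.
  by rewrite le_min ge_min lexx/= ge_min ler_nat kn orbT.
have lD x : limn (D ^~ x) = (`|u x| `^ a)%:E.
  apply: cvg_lim => //; apply: cvg_near_cst.
  exists (Num.truncn `|u x|).+1 => // n /= un; rewrite /D min_l ?normr_id//.
  by apply: le_trans (ltW (truncnS_gt _)) _; rewrite ler_nat.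
have := cvg_monotone_convergence (mu := m) measurableT mD D0 ndD.
under [X in _ --> X]eq_integral do rewrite lD.
move=> cv; have leK : (\int[m]_x (`|u x| `^ a)%:E <= K%:E)%E.
  rewrite -(cvg_lim _ cv)//; apply: lime_le; first exact: cvgP cv.
  by apply: nearW => n; rewrite (EFin_Lpmass (H n).1) lee_fin; exact: (H n).2.
have Lu : Lp m a u.
  split=> //; apply: integrableR_fin_integral; first exact: measurable_powR_abs.
    by move=> x; exact: powR_ge0.
  by apply: le_lt_trans leK _; rewrite ltry.
by split=> //; rewrite -lee_fin -EFin_Lpmass.
Qed.

End Truncation.

Section Sobolev.
Variable R : realType.
Local Notation lam := (@lebesgue_measure R).
Local Notation mu := (@leb3 R).
Local Notation R1 := (measurableTypeR R).
Local Notation e := (basis3 R).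
Implicit Types (u : R3 R -> R) (p q a M : R).

Lemma Lp_grad_norm p u : 0 < p -> weak_grad_in p u -> Lp mu p (grad_norm u).
Proof.
move=> p0 /(weak_grad_inP _ p0) H.
exact: (@Lp_normv _ _ R mu p 3 (fun x => wgrad u x) p0 (fun i => (H i).2)).
Qed.

Lemma sobolev_conj_gt p : 1 < p < 3 -> p < sobolev_conj p.
Proof.
move=> /andP[p1 p3]; rewrite /sobolev_conj ltr_pdivlMr ?subr_gt0//; nra.
Qed.

(** The exponent c = 2p / (3 - p) satisfies both p-star = 3c / 2 and p-star = (c - 1) p / (p - 1).
    The first makes Loomis-Whitney bound the p-star norm B of the truncation, and the second makes
    Hoelder reproduce a power of the same B on the right, leaving B^c <= c B^(c-1) K. Dividing by
    B^(c-1) needs B finite, which the truncation guarantees. *)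
Lemma sobolev_truncated p a u M : 1 < p < 3 -> 0 < a <= sobolev_conj p -> 0 <= M ->
  Lp mu a u -> weak_grad_in p u ->
  Lp mu (sobolev_conj p) (fun x => Num.min `|u x| M) /\
  Lpnorm mu (sobolev_conj p) (fun x => Num.min `|u x| M)
    <= 2 * p / (3 - p) * Lpnorm mu p (grad_norm u).
Proof.
move=> hp /andP[a0 aps] M0 Lu wu; have pps := sobolev_conj_gt hp.
have /andP[p1 p3] := hp; have p0 : 0 < p by lra.
set ps := sobolev_conj p in aps pps *; set c := 2 * p / (3 - p).
have ps0 : 0 < ps by lra.
have p3' : 3 - p != 0 by rewrite gt_eqF// subr_gt0.
have p1' : p - 1 != 0 by rewrite gt_eqF// subr_gt0.
have c1 : 1 < c by rewrite /c ltr_pdivlMr ?subr_gt0//; lra.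
have c0 : 0 < c by lra.
pose p' := p / (p - 1); have p'0 : 0 < p' by rewrite divr_gt0// subr_gt0.
have pp' : p'^-1 + p^-1 = 1 by rewrite /p'; field; rewrite p1' gt_eqF.
have cp' : (c - 1) * p' = ps by rewrite /c /p' /ps /sobolev_conj; field; rewrite p1' p3'.
have psc : ps = c * (3 / 2) by rewrite /ps /c /sobolev_conj; field.
pose w x : R := Num.min `|u x| M.
have w0 x : 0 <= w x by rewrite le_min normr_ge0.
have mw : measurable_fun setT w.
  by apply: measurable_minr => //; apply: measurableT_comp => //; exact: Lu.1.
have LN := Lp_grad_norm p0 wu.
set N := grad_norm u in LN *; have N0 x : 0 <= N x by exact: normv_ge0.
(* Bounded by M and a-th power integrable with a <= p-star: the truncation has finite p-star norm
   before any gradient is involved. *)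
have Lw : Lp mu ps w.
  split=> //; apply: integrableR_le (integrableRZ (M `^ (ps - a)) Lu.2) _.
    exact: measurable_powR_abs.
  move=> x; rewrite ger0_norm ?powR_ge0// ger0_norm//.
  have [->|wx0] := eqVneq (w x) 0.
    by rewrite powR0 ?gt_eqF// mulr_ge0 ?powR_ge0.
  have -> : w x `^ ps = w x `^ (ps - a) * w x `^ a.
    by rewrite -powRD ?subrK//; apply/implyP => _.
  apply: ler_pM; rewrite ?powR_ge0//.
    by apply: ge0_ler_powR; rewrite ?nnegrE ?subr_ge0// ge_min lexx orbT.
  by apply: ge0_ler_powR; rewrite ?nnegrE ?(ltW a0)// ge_min lexx.
split=> //.
have Lwc : Lp mu p' (fun x => `|w x| `^ (c - 1)).
  by apply: Lp_abs_powR; [rewrite subr_gt0|rewrite cp'].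
have iV := hoelder_integrableR p'0 p0 pp' Lwc LN.
have hV := hoelder_le p'0 p0 pp' Lwc LN.
rewrite Lpnorm_abs_powR ?subr_gt0// cp' in hV.
set B := Lpnorm mu ps w in hV *; set K := Lpnorm mu p N in hV *.
have B0 : 0 <= B by exact: Lpnorm_ge0.
have K0 : 0 <= K by exact: Lpnorm_ge0.
pose V x : R := c * (`|w x| `^ (c - 1) * N x).
have V0 x : 0 <= V x.
  by apply: mulr_ge0; [exact: ltW|apply: mulr_ge0; [exact: powR_ge0|exact: N0]].
have ifV : integrableR mu V by exact: integrableRZ.
have mf : measurable_fun setT (fun x => w x `^ c).
  have := measurable_powR_abs c mw; congr (measurable_fun _ _).
  by apply/funext => x; rewrite ger0_norm.
have mV : measurable_fun setT (fun x => c * (w x `^ (c - 1) * N x)).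
  have := integrableR_measurable ifV; congr (measurable_fun _ _).
  by apply/funext => x; rewrite /V ger0_norm.
have /(loomis_whitney V0 (fun x => powR_ge0 (w x) c) (integrableR_measurable ifV) mf) LW :
    forall i, {ae mu, forall x, ((w x `^ c)%:E <= \int[lam]_t (V (x + t *: e i))%:E)%E}.
  move=> i; have /(weak_grad_inP _ p0) wi := wu; have [wi1 wi2] := wi i.
  have := sobolev_line wi1 Lu a0 c1 M0; apply: aeS => x /le_trans; apply.
  have mg := wi2.1.
  have mwt : measurable_fun (setT : set R1) (fun t => w (x + t *: e i) `^ (c - 1)).
    have := measurable_powR_abs (c - 1) (measurable_at (e i) x mw); congr (measurable_fun _ _).
    by apply/funext => t; rewrite ger0_norm.
  have mk : measurable_fun (setT : set R1) (fun t => (w (x + t *: e i) `^ (c - 1) * `|wpartial i u (x + t *: e i)|)%:E).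
    apply/measurable_EFinP; apply: measurable_funM => //.
    by apply: measurableT_comp => //; exact: measurable_at.
  rewrite -ge0_integralZl//; last 2 first.
  - by move=> t _; rewrite lee_fin mulr_ge0 ?powR_ge0.
  - by rewrite lee_fin ltW.
  apply: (@ge0_le_integralT R _ _ lam).
  - exact: measurable_funeM.
  - by apply/measurable_EFinP; exact: (measurable_at (e i) x (integrableR_measurable ifV)).
  - move=> t; apply: mule_ge0; rewrite lee_fin; first exact: ltW.
    by rewrite mulr_ge0 ?powR_ge0.
  move=> t; rewrite -EFinM lee_fin /V; apply: ler_wpM2l; first exact: ltW.
  rewrite [`|w _|]ger0_norm//; apply: ler_wpM2l; first exact: powR_ge0.
  exact: (le_normv_coord (wgrad u (x + t *: e i)) i).
have BE : (\int[mu]_x ((w x `^ c) `^ (3 / 2))%:E = (B `^ ps)%:E)%E.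
  rewrite /B Lpnorm_powR// -(EFin_Lpmass Lw); apply: eq_integral => x _.
  by rewrite -powRrM -psc ger0_norm.
have VE : (\int[mu]_x (V x)%:E = (\int[mu]_x V x)%:E)%E by exact: integrableRE.
rewrite BE VE poweR_EFin lee_fin in LW.
have VB : \int[mu]_x V x <= c * (B `^ (c - 1) * K).
  rewrite /V RintegralZl//; apply: ler_wpM2l; first exact: ltW.
  apply: le_trans hV; apply: le_Rintegral => //; first exact: integrableR_norm.
  by move=> x _; exact: ler_norm.
have iV0 : 0 <= \int[mu]_x V x by exact: Rintegral_ge0.
have cBK0 : 0 <= c * (B `^ (c - 1) * K).
  by apply: mulr_ge0; [exact: ltW|apply: mulr_ge0 => //; exact: powR_ge0].
have B1 : B `^ ps <= (c * (B `^ (c - 1) * K)) `^ (3 / 2).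
  by apply: le_trans LW _; apply: ge0_ler_powR; rewrite ?nnegrE.
(* B = 0 is set apart because B^(c-1) is cancelled below. *)
have [B00|Bn0] := eqVneq B 0; first by rewrite B00; apply: mulr_ge0 => //; exact: ltW.
have Bp : 0 < B by rewrite lt_neqAle eq_sym Bn0.
rewrite psc powRrM in B1.
have B2 : B `^ c <= c * (B `^ (c - 1) * K).
  rewrite leNgt; apply/negP => lt; move: B1; rewrite leNgt => /negP; apply.
  by apply: gt0_ltr_powR; rewrite ?nnegrE ?powR_ge0.
rewrite -(mulr_powRB1 B0 c0) in B2.
have Bc : 0 < B `^ (c - 1) by rewrite powR_gt0.
rewrite -(ler_pM2r Bc); apply: le_trans B2 _.
by rewrite [_ * K]mulrC mulrA.
Qed.

(** [a] records the integrability known beforehand: it will be p on W^{1,p} and the conjugate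
    exponent q-star itself on D^{1,q}. *)
Lemma sobolev p a u : 1 < p < 3 -> 0 < a <= sobolev_conj p ->
  Lp mu a u -> weak_grad_in p u -> Lp mu (sobolev_conj p) u /\
  Lpnorm mu (sobolev_conj p) u <= 2 * p / (3 - p) * Lpnorm mu p (grad_norm u).
Proof.
move=> hp ha Lu wu; have pps := sobolev_conj_gt hp.
have /andP[p1 p3] := hp; have ps0 : 0 < sobolev_conj p by lra.
have c0 : 0 <= 2 * p / (3 - p) by rewrite divr_ge0//; lra.
have K0 : 0 <= 2 * p / (3 - p) * Lpnorm mu p (grad_norm u) by rewrite mulr_ge0// Lpnorm_ge0.
rewrite Lpmass_le_powR//; apply: Lp_truncation_bound => //; first exact: Lu.1.
move=> n; rewrite -Lpmass_le_powR//.
exact: (sobolev_truncated hp ha (ler0n _ n) Lu wu).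
Qed.

End Sobolev.

(** * Integrals of vector fields *)

Section VectorFields.
Context d (T : measurableType d) (R : realType).
Variable m : {measure set T -> \bar R}.
Variable n : nat.

Lemma le_RintegralT (f g : T -> R) : integrableR m f -> integrableR m g ->
  (forall x, f x <= g x) -> \int[m]_x f x <= \int[m]_x g x.
Proof. by move=> i1 i2 fg; apply: le_Rintegral. Qed.

Lemma RintD (f g : T -> R) : integrableR m f -> integrableR m g ->
  \int[m]_x (f x + g x) = \int[m]_x f x + \int[m]_x g x.
Proof. exact: RintegralD. Qed.

Lemma RintB (f g : T -> R) : integrableR m f -> integrableR m g ->
  \int[m]_x (f x - g x) = \int[m]_x f x - \int[m]_x g x.
Proof. exact: RintegralB. Qed.

Lemma RintZ (k : R) (f : T -> R) : integrableR m f ->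
  \int[m]_x (k * f x) = k * \int[m]_x f x.
Proof. exact: RintegralZl. Qed.

Implicit Types (f g h : T -> R) (F G H : T -> 'I_n -> R) (p s r eps : R).

Lemma bregman_ge0 p (x y : 'I_n -> R) : 1 < p -> 0 <= bregman p x y.
Proof.
move=> p1; have p0 : 0 < p by lra.
have hx := normv_ge0 x; have hy := normv_ge0 y.
have Y := young_le hy hx p1.
have D : normv y `^ (p - 2) * dotv y x <= normv y `^ (p - 1) * normv x.
  have [y0|yn0] := eqVneq (normv y) 0.
    have -> : dotv y x = 0.
      by rewrite /dotv big1// => i _; rewrite normv_eq0// mul0r.
    by rewrite mulr0 mulr_ge0 ?powR_ge0.
  have -> : normv y `^ (p - 1) = normv y `^ (p - 2) * normv y.
    rewrite -[X in _ * X](powRr1 hy) -powRD; last by rewrite yn0 implybT.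
    by congr (_ `^ _); lra.
  rewrite -mulrA; apply: ler_wpM2l; first exact: powR_ge0.
  exact: le_trans (ler_norm _) (dotv_le _ _).
rewrite /bregman subr_ge0; apply: le_trans D _.
rewrite -(ler_pM2l p0); apply: le_trans Y _.
by rewrite le_eqVlt; apply/orP; left; apply/eqP; field; rewrite gt_eqF.
Qed.

(** Hoelder with exponents s / (s - 1) and s for the r-th powers. The case r = 1 serves the gradient
    and power terms, the case of the dual exponent of q-star the nonlocal term. *)
Lemma pow_holder s r f g : 1 < s -> 0 < r -> Lp m (s * r) f -> Lp m (s * r) g ->
  Lp m r (fun x => `|f x| `^ (s - 1) * `|g x|) /\
  Lpnorm m r (fun x => `|f x| `^ (s - 1) * `|g x|)
    <= Lpnorm m (s * r) f `^ (s - 1) * Lpnorm m (s * r) g.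
Proof.
move=> s1 r0 Lf Lg; have s0 : 0 < s by lra.
have s10 : 0 < s - 1 by lra.
have sr0 : 0 < s * r by rewrite mulr_gt0.
pose s' := s / (s - 1); have s'0 : 0 < s' by rewrite divr_gt0.
have ss' : s'^-1 + s^-1 = 1 by rewrite /s'; field; rewrite !gt_eqF.
have E1 : (s - 1) * r * s' = s * r by rewrite /s'; field; rewrite gt_eqF.
have E2 : r * s = s * r by rewrite mulrC.
have L1 : Lp m s' (fun x => `|f x| `^ ((s - 1) * r)).
  by apply: Lp_abs_powR; [exact: mulr_gt0|rewrite E1].
have L2 : Lp m s (fun x => `|g x| `^ r) by apply: Lp_abs_powR; rewrite ?E2.
have iH := hoelder_integrableR s'0 s0 ss' L1 L2.
have H := hoelder_abs_le s'0 s0 ss' L1 L2.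
have E x : `| `|f x| `^ (s - 1) * `|g x| | `^ r = `|f x| `^ ((s - 1) * r) * `|g x| `^ r.
  by rewrite ger0_norm ?mulr_ge0 ?powR_ge0// powRM ?powR_ge0// -powRrM.
have mfg : measurable_fun setT (fun x => `|f x| `^ (s - 1) * `|g x|).
  apply: measurable_funM; first exact: measurable_powR_abs Lf.1.
  by apply: measurableT_comp => //; exact: Lg.1.
have Lfg : Lp m r (fun x => `|f x| `^ (s - 1) * `|g x|).
  by split=> //; under eq_fun do rewrite E.
split=> //; rewrite Lpmass_le_powR//; last by rewrite mulr_ge0 ?powR_ge0// Lpnorm_ge0.
rewrite LpmassE; under eq_Rintegral do rewrite E.
apply: le_trans (ler_norm _) _; apply: le_trans H _.
rewrite (Lpnorm_abs_powR _ _ (mulr_gt0 s10 r0) s'0) E1 (Lpnorm_abs_powR _ _ r0 s0) E2.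
by rewrite powRM ?powR_ge0 ?Lpnorm_ge0// -powRrM.
Qed.

Definition Lpv p F := forall i, Lp m p (fun x => F x i).
Definition Nv p F := Lpnorm m p (fun x => normv (F x)).

Lemma Nv_ge0 p F : 0 <= Nv p F. Proof. exact: Lpnorm_ge0. Qed.

Lemma Lpv_normv p F : 0 < p -> Lpv p F -> Lp m p (fun x => normv (F x)).
Proof. by move=> p0 LF; exact: Lp_normv. Qed.

Lemma LpvD p F G : 0 < p -> Lpv p F -> Lpv p G -> Lpv p (fun x => F x \+ G x).
Proof. by move=> p0 LF LG i; exact: LpD. Qed.

Lemma LpvB p F G : 0 < p -> Lpv p F -> Lpv p G -> Lpv p (fun x => F x \- G x).
Proof. by move=> p0 LF LG i; exact: LpB. Qed.

Lemma LpvZ p (t : R) F : Lpv p F -> Lpv p (fun x i => t * F x i).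
Proof. by move=> LF i; exact: LpZ. Qed.

Lemma measurable_dotv F G : (forall i, measurable_fun setT (fun x => F x i)) ->
  (forall i, measurable_fun setT (fun x => G x i)) ->
  measurable_fun setT (fun x => dotv (F x) (G x)).
Proof.
move=> mF mG; apply: measurable_sum => i; exact: measurable_funM.
Qed.

Lemma NvE p F : 0 < p -> Nv p F `^ p = \int[m]_x (normv (F x) `^ p).
Proof.
move=> p0; rewrite /Nv Lpnorm_powR// LpmassE.
by apply: eq_Rintegral => x _; rewrite ger0_norm ?normv_ge0.
Qed.

Lemma integrable_normv p F : 0 < p -> Lpv p F -> integrableR m (fun x => normv (F x) `^ p).
Proof.
move=> p0 /(Lpv_normv p0)[_]; congr (integrableR _ _).
by apply/funext => x; rewrite ger0_norm ?normv_ge0.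
Qed.

Lemma NvD p F G : 1 <= p -> Lpv p F -> Lpv p G ->
  Nv p (fun x => F x \+ G x) <= Nv p F + Nv p G.
Proof.
move=> p1 LF LG; have p0 : 0 < p by lra.
have L1 := Lpv_normv p0 LF; have L2 := Lpv_normv p0 LG.
apply: le_trans (Lpnorm_triangle p1 L1 L2).
apply: (Lpnorm_mass_le p0); apply: (Lpmass_le p0 (Lpv_normv p0 (LpvD p0 LF LG)) (LpD p0 L1 L2)).
apply: aeW => x; rewrite !ger0_norm ?normv_ge0 ?addr_ge0 ?normv_ge0//.
exact: normvD_le.
Qed.

Lemma NvZ p t F : 0 < p -> Lpv p F -> Nv p (fun x i => t * F x i) = `|t| * Nv p F.
Proof.
move=> p0 LF; rewrite /Nv -[X in X * _]normr_id -(LpnormZ _ p0 (Lpv_normv p0 LF)).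
by congr (Lpnorm _ _ _); apply/funext => x; rewrite normvZ.
Qed.

Lemma Nv_ae p F G : (forall i, measurable_fun setT (fun x => F x i)) ->
  (forall i, measurable_fun setT (fun x => G x i)) ->
  {ae m, forall x, F x = G x} -> Nv p F = Nv p G.
Proof.
move=> mF mG FG.
have mn H : (forall i, measurable_fun setT (fun x => H x i)) ->
    measurable_fun setT (fun x => normv (H x)).
  move=> mH; apply: measurableT_comp; first exact: continuous_measurable_fun (@sqrt_continuous R).
  by apply: measurable_sum => i; apply: measurable_funX.
rewrite /Nv !LpnormE; congr (_ `^ _); apply: Lpmass_ae; [exact: mn|exact: mn|].
by apply: aeS FG => x -> _.
Qed.

Lemma NvB_le p F G : 1 <= p -> Lpv p F -> Lpv p G ->
  `|Nv p F - Nv p G| <= Nv p (fun x => F x \- G x).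
Proof.
move=> p1 LF LG; have p0 : 0 < p by lra.
have key H K : Lpv p H -> Lpv p K -> Nv p H - Nv p K <= Nv p (fun x => H x \- K x).
  move=> LH LK; rewrite lerBlDr.
  apply: le_trans (NvD p1 (LpvB p0 LH LK) LK).
  rewrite le_eqVlt; apply/orP; left; apply/eqP; congr (Lpnorm _ _ _); apply/funext => x.
  by congr normv; apply/funext => i /=; rewrite subrK.
rewrite ler_norml key// andbT lerNl opprB.
apply: le_trans (key _ _ LG LF) _.
rewrite le_eqVlt; apply/orP; left; apply/eqP; congr (Lpnorm _ _ _); apply/funext => x.
by rewrite -normvN; congr normv; apply/funext => i /=; rewrite opprB.
Qed.

Lemma dotv_pow_le p (x y : 'I_n -> R) :
  `|normv x `^ (p - 2) * dotv x y| <= normv x `^ (p - 1) * normv y.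
Proof.
have hx := normv_ge0 x; have [x0|xn0] := eqVneq (normv x) 0.
  have -> : dotv x y = 0 by rewrite /dotv big1// => i _; rewrite normv_eq0// mul0r.
  by rewrite mulr0 normr0 mulr_ge0 ?powR_ge0// normv_ge0.
have -> : normv x `^ (p - 1) = normv x `^ (p - 2) * normv x.
  rewrite -[X in _ * X](powRr1 hx) -powRD; last by rewrite xn0 implybT.
  by congr (_ `^ _); lra.
rewrite normrM (ger0_norm (powR_ge0 _ _)) -mulrA; apply: ler_wpM2l; first exact: powR_ge0.
exact: dotv_le.
Qed.

Lemma pow_holder_normv p F G : 1 < p -> Lpv p F -> Lpv p G ->
  integrableR m (fun x => normv (F x) `^ (p - 1) * normv (G x)) /\
  \int[m]_x (normv (F x) `^ (p - 1) * normv (G x)) <= Nv p F `^ (p - 1) * Nv p G.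
Proof.
move=> p1 LF LG; have p0 : 0 < p by lra.
have L1 := Lpv_normv p0 LF; have L2 := Lpv_normv p0 LG.
rewrite -[p]mulr1 in L1 L2.
have [[mH iH] H] := pow_holder p1 ltr01 L1 L2.
have E x : `| `|normv (F x)| `^ (p - 1) * `|normv (G x)| | `^ 1 = normv (F x) `^ (p - 1) * normv (G x).
  rewrite powRr1// !(ger0_norm (normv_ge0 _)) ger0_norm// mulr_ge0 ?powR_ge0 ?normv_ge0//.
split; first by move: iH; under eq_fun do rewrite E.
move: H; rewrite LpnormE LpmassE; under eq_Rintegral do rewrite E.
rewrite invr1 powRr1 ?mulr1//.
by apply: Rintegral_ge0 => x _; rewrite mulr_ge0 ?powR_ge0 ?normv_ge0.
Qed.

Lemma integrable_pow_dotv p F G : 1 < p -> Lpv p F -> Lpv p G ->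
  integrableR m (fun x => normv (F x) `^ (p - 2) * dotv (F x) (G x)).
Proof.
move=> p1 LF LG; have [iH _] := pow_holder_normv p1 LF LG.
have p0 : 0 < p by lra.
apply: integrableR_le iH _; last by move=> x; exact: dotv_pow_le.
apply: measurable_funM.
  have := measurable_powR_abs (p - 2) (Lpv_normv p0 LF).1; congr (measurable_fun _ _).
  by apply/funext => x; rewrite ger0_norm ?normv_ge0.
by apply: measurable_dotv => i; [exact: (LF i).1|exact: (LG i).1].
Qed.

Lemma vec_taylor p eps : 1 < p -> 0 < eps -> exists2 C : R, 0 < C & forall F G,
  Lpv p F -> Lpv p G ->
  `|Nv p (fun x => F x \+ G x) `^ p - Nv p F `^ p
    - p * \int[m]_x (normv (F x) `^ (p - 2) * dotv (F x) (G x))|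
  <= eps * (Nv p F `^ (p - 1) * Nv p G) + C * Nv p G `^ p.
Proof.
move=> p1 e0; have p0 : 0 < p by lra.
have [C C0 HC] := @normv_powR_taylor R n p eps p1 e0; exists C => // F G LF LG.
rewrite !(NvE _ p0).
have i1 := integrable_normv p0 (LpvD p0 LF LG); have i2 := integrable_normv p0 LF.
have i3 := integrable_pow_dotv p1 LF LG; have i4 := integrable_normv p0 LG.
have [i5 H5] := pow_holder_normv p1 LF LG.
have i12 := integrableRB i1 i2; have i3' := integrableRZ p i3.
have i123 := integrableRB i12 i3'.
rewrite -(RintB i1 i2) -(RintZ p i3) -(RintB i12 i3').
apply: le_trans (le_normr_Rintegral measurableT i123) _.
have i5' := integrableRZ eps i5; have i4' := integrableRZ C i4.
apply: (@le_trans _ _ (\int[m]_x (eps * (normv (F x) `^ (p - 1) * normv (G x)) + C * normv (G x) `^ p))).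
  apply: (le_RintegralT (integrableR_norm i123) (integrableRD i5' i4')) => x.
  exact: HC.
rewrite (RintD i5' i4') (RintZ _ i5) (RintZ _ i4) lerD2r.
by apply: ler_wpM2l; [exact: ltW|exact: H5].
Qed.

Lemma bregman_integral p F G : 1 < p -> Lpv p F -> Lpv p G ->
  integrableR m (fun x => bregman p (F x) (G x)) /\
  \int[m]_x bregman p (F x) (G x) = p^-1 * Nv p F `^ p + (1 - p^-1) * Nv p G `^ p
    - \int[m]_x (normv (G x) `^ (p - 2) * dotv (G x) (F x)).
Proof.
move=> p1 LF LG; have p0 : 0 < p by lra.
have i1 := integrableRZ p^-1 (integrable_normv p0 LF).
have i2 := integrableRZ (1 - p^-1) (integrable_normv p0 LG).
have i3 := integrable_pow_dotv p1 LG LF.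
have i12 := integrableRD i1 i2.
have i123 := integrableRB i12 i3.
have E x : bregman p (F x) (G x) = p^-1 * normv (F x) `^ p + (1 - p^-1) * normv (G x) `^ p
    - normv (G x) `^ (p - 2) * dotv (G x) (F x) by rewrite /bregman [_ / p]mulrC.
under eq_fun do rewrite E; split; first exact: i123.
rewrite (RintB i12 i3) (RintD i1 i2) (RintZ _ (integrable_normv p0 LF)).
by rewrite (RintZ _ (integrable_normv p0 LG)) !(NvE _ p0).
Qed.

Lemma bregman_integral_powR p eps : 1 < p -> 0 < eps -> exists2 C : R, 0 < C &
  forall F G, Lpv p F -> Lpv p G ->
  Nv p (fun x => F x \- G x) `^ p <= eps * Nv p G `^ p + C * \int[m]_x bregman p (F x) (G x).
Proof.
move=> p1 e0; have p0 : 0 < p by lra.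
have [C C0 HC] := @bregman_powR R n p eps p1 e0; exists C => // F G LF LG.
have [iB _] := bregman_integral p1 LF LG.
have i1 := integrable_normv p0 (LpvB p0 LF LG); have i2 := integrable_normv p0 LG.
have i2' := integrableRZ eps i2; have iB' := integrableRZ C iB.
rewrite !(NvE _ p0) -(RintZ _ i2) -(RintZ _ iB) -(RintD i2' iB').
by apply: (le_RintegralT i1 (integrableRD i2' iB')) => x; exact: HC.
Qed.

End VectorFields.

(** * The space D^{1,q} *)

Section RealSequences.
Variable R : realType.
Implicit Types (a b : nat -> R) (x : R).

Lemma cvg_dist_le a b x : (forall n, `|a n - x| <= b n) -> b n @[n --> \oo] --> (0 : R) ->
  a n @[n --> \oo] --> x.
Proof.
move=> ab b0; apply/cvgrPdist_le => e e0.
move/cvgrPdist_le : b0 => /(_ e e0); apply: filterS => n; rewrite sub0r normrN => be.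
by rewrite distrC (le_trans (ab n))// (le_trans (ler_norm _)).
Qed.

Lemma cvg_0_le a b : (forall n, 0 <= a n <= b n) -> b n @[n --> \oo] --> (0 : R) ->
  a n @[n --> \oo] --> (0 : R).
Proof.
move=> ab; apply: cvg_dist_le => n; have /andP[a0 ab'] := ab n.
by rewrite subr0 ger0_norm.
Qed.

Lemma cvgZ_0 (k : R) a : a n @[n --> \oo] --> (0 : R) -> k * a n @[n --> \oo] --> (0 : R).
Proof. by move=> a0; rewrite -(mulr0 k); apply: cvgM => //; exact: cvg_cst. Qed.

Lemma cvgD_0 a b : a n @[n --> \oo] --> (0 : R) -> b n @[n --> \oo] --> (0 : R) ->
  a n + b n @[n --> \oo] --> (0 : R).
Proof. by move=> a0 b0; rewrite -(addr0 (0 : R)); exact: cvgD. Qed.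

Lemma cvg_powR a x q : 1 < q -> (forall n, 0 <= a n) -> 0 <= x ->
  a n @[n --> \oo] --> x -> a n `^ q @[n --> \oo] --> x `^ q.
Proof.
move=> q1 a0 x0 ax.
have := cvg_comp _ _ ax (@continuous_powR_abs R q q1 x); rewrite ger0_norm//.
by apply: cvg_trans; apply: near_eq_cvg; apply: nearW => n /=; rewrite ger0_norm.
Qed.

Lemma small_powR (K r e : R) : 0 <= K -> 0 < r -> 0 < e -> exists2 d : R, 0 < d &
  forall t, 0 <= t <= d -> K * t `^ r <= e.
Proof.
move=> K0 r0 e0; have K1 : 0 < K + 1 by lra.
exists ((e / (K + 1)) `^ r^-1); first by apply: powR_gt0; rewrite divr_gt0.
move=> t /andP[t0 td].
have : t `^ r <= e / (K + 1).
  apply: (@le_trans _ _ (((e / (K + 1)) `^ r^-1) `^ r)).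
    by apply: ge0_ler_powR; rewrite ?nnegrE ?powR_ge0// ltW.
  by rewrite -powRrM mulVf ?gt_eqF// powRr1// divr_ge0// ltW.
rewrite ler_pdivlMr// => H; apply: le_trans H.
have := powR_ge0 t r; nra.
Qed.

End RealSequences.

Section FiniteEnergy.
Variable R : realType.
Local Notation mu := (@leb3 R).
Implicit Types (u v w eta f phi : R3 R -> R) (a c p q : R).

Lemma bounded_support_Lp a b : 0 < a -> bounded_support b -> Lp mu a b.
Proof.
move=> a0 [mb [n [M M0 bM]]]; split=> //.
apply: integrableR_le (integrableRZ (M `^ a) (integrableR_box (n%:R : R))) _.
  exact: measurable_powR_abs.
move=> x; rewrite ger0_norm ?powR_ge0//; apply: (@le_trans _ _ ((M * \1_(box n%:R) x) `^ a)).
  by apply: ge0_ler_powR; rewrite ?nnegrE ?mulr_ge0 ?(ltW a0).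
rewrite indicE; case: (_ \in _); first by rewrite !mulr1.
by rewrite !mulr0 powR0 ?gt_eqF.
Qed.

Lemma test_Lp a eta : 0 < a -> test_function eta -> Lp mu a eta.
Proof. by move=> a0 te; apply: bounded_support_Lp => //; exact: test_function_bounded_support. Qed.

Lemma test_weak_grad a eta : 0 < a -> test_function eta -> weak_grad_in a eta.
Proof.
move=> a0 te i; exists (partial i eta); last exact: test_weak_partial.
by apply/(Lfun_LpP mu _ a0); apply: test_Lp => //; exact: test_function_partial.
Qed.

Lemma weak_grad_Lpv p u : 0 < p -> weak_grad_in p u -> Lpv mu p (wgrad u).
Proof. by move=> p0 /(weak_grad_inP _ p0) H i; exact: (H i).2. Qed.

Lemma wgrad_lin_ae p c u v : 0 < p -> weak_grad_in p u -> weak_grad_in p v ->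
  {ae mu, forall x, wgrad (fun x => c * u x + v x) x = (fun i => c * wgrad u x i) \+ wgrad v x}.
Proof.
move=> p0 /(weak_grad_inP _ p0) wu /(weak_grad_inP _ p0) wv.
have := wgrad_lin c (fun i => (wu i).1) (fun i => (wv i).1).
by apply: aeS => x ->.
Qed.

Lemma weak_grad_inB p u v : 0 < p -> weak_grad_in p u -> weak_grad_in p v ->
  weak_grad_in p (fun x => u x - v x).
Proof.
move=> p0 wu wv; have := weak_grad_in_lin (-1) p0 wv wu; congr (weak_grad_in _ _).
by apply/funext => x; rewrite mulN1r addrC.
Qed.

Lemma wgradB_ae p u v : 0 < p -> weak_grad_in p u -> weak_grad_in p v ->
  {ae mu, forall x, wgrad (fun x => u x - v x) x = wgrad u x \- wgrad v x}.
Proof.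
move=> p0 wu wv; have := wgrad_lin_ae (-1) p0 wv wu.
have -> : (fun x => -1 * v x + u x) = (fun x => u x - v x).
  by apply/funext => x; rewrite mulN1r addrC.
apply: aeS => x ->; apply/funext => i /=; by rewrite mulN1r addrC.
Qed.

Lemma Lpv_measurable p (F : R3 R -> 'I_3 -> R) : Lpv mu p F ->
  forall i, measurable_fun setT (fun x => F x i).
Proof. by move=> LF i; exact: (LF i).1. Qed.

Lemma Nv_wgradB p u v : 0 < p -> weak_grad_in p u -> weak_grad_in p v ->
  Nv mu p (wgrad (fun x => u x - v x)) = Nv mu p (fun x => wgrad u x \- wgrad v x).
Proof.
move=> p0 wu wv; apply: Nv_ae; last exact: wgradB_ae wu wv.
  exact: (Lpv_measurable (weak_grad_Lpv p0 (weak_grad_inB p0 wu wv))).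
exact: (Lpv_measurable (LpvB p0 (weak_grad_Lpv p0 wu) (weak_grad_Lpv p0 wv))).
Qed.

Lemma Nv_wgrad_lin p c u v : 0 < p -> weak_grad_in p u -> weak_grad_in p v ->
  Nv mu p (wgrad (fun x => c * u x + v x)) = Nv mu p (fun x => (fun i => c * wgrad u x i) \+ wgrad v x).
Proof.
move=> p0 wu wv; apply: Nv_ae; last exact: wgrad_lin_ae wu wv.
  exact: (Lpv_measurable (weak_grad_Lpv p0 (weak_grad_in_lin c p0 wu wv))).
exact: (Lpv_measurable (LpvD p0 (LpvZ c (weak_grad_Lpv p0 wu)) (weak_grad_Lpv p0 wv))).
Qed.

Variable q : R.
Hypothesis hq : 1 < q < 3.
Let q1 : (1 : R) < q. Proof. by case/andP: hq. Qed.
Let q0 : (0 : R) < q. Proof. exact: lt_trans ltr01 q1. Qed.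
Local Notation qs := (sobolev_conj q).

Let qqs : q < qs. Proof. exact: sobolev_conj_gt. Qed.
Let qs1 : (1 : R) < qs. Proof. exact: lt_trans q1 qqs. Qed.
Let qs0 : (0 : R) < qs. Proof. exact: lt_trans q0 qqs. Qed.

(** Restates [D1] with real norms and with the difference of two gradients in place of the gradient
    of a difference, these agreeing only almost everywhere; the estimates on vector fields then
    apply. *)
Lemma D1P u : D1 q u <-> [/\ Lp mu qs u, weak_grad_in q u &
  exists eta : nat -> R3 R -> R, [/\ forall n, test_function (eta n),
    Nv mu q (fun x => wgrad (eta n) x \- wgrad u x) @[n --> \oo] --> (0 : R) &
    Lpnorm mu qs (fun x => eta n x - u x) @[n --> \oo] --> (0 : R)]].
Proof.
have E1 eta : test_function eta -> weak_grad_in q u ->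
    ('N[mu]_(q%:E)[EFin \o grad_norm (eta \- u)%R] = (Nv mu q (fun x => wgrad eta x \- wgrad u x))%:E)%E.
  move=> te wu; have wB := weak_grad_inB q0 (test_weak_grad q0 te) wu.
  rewrite (Lpnorm_Lnorm q0 (Lp_grad_norm q0 wB)); congr (_%:E).
  exact: (Nv_wgradB q0 (test_weak_grad q0 te) wu).
have E2 eta : test_function eta -> Lp mu qs u ->
    ('N[mu]_(qs%:E)[EFin \o (eta \- u)%R] = (Lpnorm mu qs (fun x => eta x - u x)%R)%:E)%E.
  by move=> te Lu; rewrite (Lpnorm_Lnorm qs0 (LpB qs0 (test_Lp qs0 te) Lu)).
split.
  move=> [/(Lfun_LpP mu _ qs0) Lu wu [eta [te c1 c2]]]; split=> //; exists eta; split=> //.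
    move: c1; under eq_fun do rewrite E1//.
    by move=> /fine_cvg.
  move: c2; under eq_fun do rewrite E2//.
  by move=> /fine_cvg.
move=> [Lu wu [eta [te c1 c2]]]; split=> //; first exact/(Lfun_LpP mu _ qs0).
exists eta; split=> //.
  under eq_fun do rewrite E1//.
  by apply: cvg_EFin; first exact: nearW.
under eq_fun do rewrite E2//.
by apply: cvg_EFin; first exact: nearW.
Qed.

Lemma Nv_eq0 p (F : R3 R -> 'I_3 -> R) : 0 < p -> (forall x i, F x i = 0) -> Nv mu p F = 0.
Proof.
move=> p0 F0; rewrite /Nv LpnormE LpmassE.
under eq_Rintegral => x _.
  have -> : normv (F x) = 0.
    by rewrite /normv big1 ?sqrtr0// => i _; rewrite F0 expr0n.
  rewrite normr0 powR0 ?gt_eqF//.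
  over.
by rewrite Rintegral_cst// mul0r powR0// invr_eq0 gt_eqF.
Qed.

Lemma D1_test eta : test_function eta -> D1 q eta.
Proof.
move=> te; apply/D1P; split; [exact: test_Lp|exact: test_weak_grad|].
exists (fun=> eta); split=> //.
  by rewrite Nv_eq0// => [|x i]; [exact: cvg_cst|rewrite /= subrr].
rewrite (_ : Lpnorm _ _ _ = 0); first exact: cvg_cst.
rewrite LpnormE LpmassE.
under eq_Rintegral do rewrite subrr normr0 powR0 ?gt_eqF//.
by rewrite Rintegral_cst// mul0r powR0// invr_eq0 gt_eqF.
Qed.

Lemma D1_Lp u : D1 q u -> Lp mu qs u. Proof. by move=> /D1P[]. Qed.

Lemma D1_grad u : D1 q u -> weak_grad_in q u. Proof. by case. Qed.

Lemma D1_Lpv u : D1 q u -> Lpv mu q (wgrad u).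
Proof. by move=> /D1_grad; exact: weak_grad_Lpv. Qed.

Lemma D1_lin c u v : D1 q u -> D1 q v -> D1 q (fun x => c * u x + v x).
Proof.
move=> Du Dv; have Lu := D1_Lp Du; have Lv := D1_Lp Dv.
have wu := D1_grad Du; have wv := D1_grad Dv; have Wu := D1_Lpv Du; have Wv := D1_Lpv Dv.
have /D1P[_ _ [eta [te c1 c2]]] := Du; have /D1P[_ _ [zeta [tz c3 c4]]] := Dv.
apply/D1P; split; first by apply: LpD => //; exact: LpZ.
  exact: weak_grad_in_lin.
exists (fun n x => c * eta n x + zeta n x); split.
- by move=> n; apply: test_functionD => //; exact: test_functionZ.
- apply: cvg_0_le (cvgD_0 (cvgZ_0 `|c| c1) c3) => n; rewrite Nv_ge0/=.
  have We := test_weak_grad q0 (te n); have Wz := test_weak_grad q0 (tz n).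
  have L1 := LpvB q0 (weak_grad_Lpv q0 We) Wu.
  have L2 := LpvB q0 (weak_grad_Lpv q0 Wz) Wv.
  rewrite -(NvZ c q0 L1); apply: le_trans (NvD (ltW q1) (LpvZ c L1) L2).
  rewrite le_eqVlt; apply/orP; left; apply/eqP; apply: Nv_ae.
  + exact: (Lpv_measurable (LpvB q0 (weak_grad_Lpv q0 (weak_grad_in_lin c q0 We Wz))
      (weak_grad_Lpv q0 (weak_grad_in_lin c q0 wu wv)))).
  + exact: (Lpv_measurable (LpvD q0 (LpvZ c L1) L2)).
  + apply: aeS2 (wgrad_lin_ae c q0 We Wz) (wgrad_lin_ae c q0 wu wv) => x -> ->.
    by apply/funext => i /=; ring.
- apply: cvg_0_le (cvgD_0 (cvgZ_0 `|c| c2) c4) => n; rewrite Lpnorm_ge0/=.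
  have L1 := LpB qs0 (test_Lp qs0 (te n)) Lu; have L2 := LpB qs0 (test_Lp qs0 (tz n)) Lv.
  rewrite -(LpnormZ c qs0 L1); apply: le_trans (Lpnorm_triangle (ltW qs1) (LpZ c L1) L2).
  rewrite le_eqVlt; apply/orP; left; apply/eqP; congr (Lpnorm _ _ _).
  by apply/funext => x; ring.
Qed.

Lemma D1B u v : D1 q u -> D1 q v -> D1 q (fun x => u x - v x).
Proof.
move=> Du Dv; have := D1_lin (-1) Dv Du; congr (D1 _ _).
by apply/funext => x; rewrite mulN1r addrC.
Qed.

Definition sobolev_const : R := 2 * q / (3 - q).

Lemma sobolev_const_ge0 : 0 <= sobolev_const.
Proof. by case/andP: hq => h1 h3; rewrite divr_ge0// ?subr_ge0 ?ltW// mulr_gt0. Qed.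

Lemma D1_sobolev u : D1 q u -> Lpnorm mu qs u <= sobolev_const * Nv mu q (wgrad u).
Proof.
move=> Du; have qsqs : 0 < qs <= qs by rewrite qs0 lexx.
by have [_] := sobolev hq qsqs (D1_Lp Du) (D1_grad Du).
Qed.

Lemma Nv_sum_le p (F : R3 R -> 'I_3 -> R) : 1 <= p -> Lpv mu p F ->
  Nv mu p F <= \sum_(i < 3) Lpnorm mu p (fun x => F x i).
Proof.
move=> p1 LF; have p0 : 0 < p by exact: lt_le_trans ltr01 p1.
pose A (i : 'I_3) x : R := `|F x i|.
have A0 i x : 0 <= A i x by exact: normr_ge0.
have LA i : Lp mu p (A i).
  apply: (Lp_le p0) (LF i) _ => [|x]; last by rewrite normr_id.
  by apply: measurableT_comp => //; exact: (LF i).1.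
have EA i : Lpnorm mu p (fun x => F x i) = Lpnorm mu p (A i).
  rewrite !LpnormE !LpmassE.
  have -> : (fun x => `|A i x| `^ p) = (fun x => `|F x i| `^ p); last by [].
  by apply/funext => x; rewrite /A normr_id.
have E (G : 'I_3 -> R) : \sum_(i < 3) G i = G ord0 + (G (lift ord0 ord0) + G (lift ord0 (lift ord0 ord0))).
  by rewrite !big_ord_recl big_ord0 addr0.
rewrite E !EA.
apply: le_trans (lerD (lexx _) (Lpnorm_triangle p1 (LA _) (LA _))).
apply: le_trans (Lpnorm_triangle p1 (LA _) (LpD p0 (LA _) (LA _))).
apply: (Lpnorm_mass_le p0); apply: (Lpmass_le p0 (Lpv_normv p0 LF)).
  by apply: LpD => //; exact: LpD.
apply: aeW => x; rewrite ger0_norm ?normv_ge0// -(E (fun i => A i x)) ger0_norm ?sumr_ge0//.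
rewrite -(ler_pXn2r (n := 2)) ?nnegrE ?normv_ge0 ?sumr_ge0//.
rewrite sqr_normv expr2 mulr_suml; apply: ler_sum => i _.
rewrite -real_normK ?num_real// expr2 ler_wpM2l//.
by rewrite -/(A i x) (bigD1 i)//= lerDl sumr_ge0.
Qed.

End FiniteEnergy.

(** * The q-Poisson equation *)

Lemma half_sum_le (R : realType) (x y b : R) : x <= b -> y <= b -> 2^-1 * (x + y) <= b.
Proof. lra. Qed.

Lemma quarter_half_lt (R : realType) (x y l : R) : 0 < l -> x <= l / 4 -> y <= l / 2 -> y + x < l.
Proof. lra. Qed.

(** The arithmetic of [minimizer_poisson]: the upper Taylor bound for the energy at phi + s w and
    the minimality of phi are combined and divided by q^-1 q t, leaving a bound on the defect L. *)
Lemma variation_arith (R : realType) (q e t P M Z C N N1 a I s G J J' K L T : R) : 0 < q -> 0 <= e -> 0 < t ->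
  0 <= P * M -> 0 <= Z -> 0 <= C -> s * (G - J) = - (L * t) -> a <= t -> T = t * K ->
  N1 <= T -> I - N - q * (s * G) <= e * (P * (a * M)) + C * (N1 * Z) ->
  q^-1 * N - J' <= q^-1 * I - (s * J + J') -> L <= q^-1 * (e * (P * M)) + q^-1 * (C * Z) * K.
Proof.
move=> q0 e0 t0 PM0 Z0 C0 sL at_ TK N1T H1 H2.
have h1 : e * (P * (a * M)) <= e * (P * M) * t.
  rewrite (_ : P * (a * M) = P * M * a); last by ring.
  by rewrite mulrA; apply: ler_wpM2l => //; exact: mulr_ge0.
have h2 : C * (N1 * Z) <= C * Z * K * t.
  rewrite (_ : C * Z * K * t = C * (T * Z)); last by rewrite TK; ring.
  by apply: ler_wpM2l => //; exact: ler_wpM2r.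
have h3 : N + q * (s * J) <= I.
  have : q * (q^-1 * N + s * J) <= q * (q^-1 * I) by rewrite ler_pM2l//; lra.
  by rewrite mulrDr !mulVKf ?gt_eqF.
have h4 : q * (L * t) <= e * (P * M) * t + C * Z * K * t.
  have : q * (L * t) = - (q * (s * (G - J))) by rewrite sL; ring.
  move: H1 h1 h2 h3; lra.
rewrite -(ler_pM2l q0) -(ler_pM2r t0).
have -> : q * (q^-1 * (e * (P * M)) + q^-1 * (C * Z) * K) * t = e * (P * M) * t + C * Z * K * t.
  by field; rewrite gt_eqF.
by rewrite -mulrA.
Qed.

Lemma Lpnorm_coord_le d (T : measurableType d) (R : realType) (m : {measure set T -> \bar R}) n
    (F : T -> 'I_n -> R) i p : 0 < p -> Lpv m p F -> Lpnorm m p (fun x => F x i) <= Nv m p F.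
Proof.
move=> p0 LF; apply: (Lpnorm_mass_le p0); apply: (Lpmass_le p0 (LF i) (Lpv_normv p0 LF)).
by apply: aeW => x; rewrite (ger0_norm (normv_ge0 _)) le_normv_coord.
Qed.

Lemma Rint_cvg d (T : measurableType d) (R : realType) (m : {measure set T -> \bar R})
    (a b : R) (F : nat -> T -> R) f h : 0 < a -> 0 < b -> a^-1 + b^-1 = 1 ->
  (forall n, Lp m a (F n)) -> Lp m a f -> Lp m b h ->
  Lpnorm m a (fun x => F n x - f x) @[n --> \oo] --> (0 : R) ->
  \int[m]_x (F n x * h x) @[n --> \oo] --> \int[m]_x (f x * h x).
Proof.
move=> a0 b0 ab LF Lf Lh c; apply: cvg_dist_le (cvgZ_0 (Lpnorm m b h) c) => n.
rewrite -(RintB (hoelder_integrableR a0 b0 ab (LF n) Lh) (hoelder_integrableR a0 b0 ab Lf Lh)).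
have -> : (fun x => F n x * h x - f x * h x) = (fun x => (F n x - f x) * h x).
  by apply/funext => x; rewrite mulrBl.
by rewrite mulrC; exact: (hoelder_abs_le a0 b0 ab (LpB a0 (LF n) Lf) Lh).
Qed.

Section Poisson.
Variable R : realType.
Local Notation mu := (@leb3 R).
Implicit Types (u v w eta phi psi : R3 R -> R) (t c p : R).

Variable q : R.
Hypothesis hq : (1 : R) < q < 3.
Let q1 : (1 : R) < q. Proof. by case/andP: hq. Qed.
Let q0 : (0 : R) < q. Proof. exact: lt_trans ltr01 q1. Qed.
Local Notation qs := (sobolev_conj q).
Local Notation S := (sobolev_const q).
Let qqs : q < qs. Proof. exact: sobolev_conj_gt. Qed.
Let qs1 : (1 : R) < qs. Proof. exact: lt_trans q1 qqs. Qed.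
Let qs0 : (0 : R) < qs. Proof. exact: lt_trans q0 qqs. Qed.

Definition dual_exp : R := qs / (qs - 1).
Local Notation qd := dual_exp.

Lemma dual_exp_gt0 : 0 < qd.
Proof. by rewrite divr_gt0 ?subr_gt0. Qed.

Lemma dual_expP : qd^-1 + qs^-1 = 1.
Proof.
rewrite /dual_exp; field; apply/andP; split; first by rewrite gt_eqF.
by rewrite gt_eqF// subr_gt0.
Qed.

Definition grad_form u v : R :=
  \int[mu]_x (normv (wgrad u x) `^ (q - 2) * dotv (wgrad u x) (wgrad v x)).

(** [poisson_weak] for a general load, convertible to it when f is |u|^s. General loads are what the
    stability estimates compare. *)
Definition poisson f phi := forall w, D1 q w -> grad_form phi w = \int[mu]_x (f x * w x).

Definition poisson_energy f w : R :=
  q^-1 * Nv mu q (wgrad w) `^ q - \int[mu]_x (f x * w x).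

Lemma pow_dotvv n (x : 'I_n -> R) : normv x `^ (q - 2) * dotv x x = normv x `^ q.
Proof.
have h := normv_ge0 x; rewrite dotvv; have [->|n0] := eqVneq (normv x) 0.
  by rewrite expr0n/= mulr0 powR0// gt_eqF.
rewrite -powR_mulrn// -powRD; last by rewrite n0 implybT.
by congr (_ `^ _); lra.
Qed.

Lemma grad_form_diag u : grad_form u u = Nv mu q (wgrad u) `^ q.
Proof. by rewrite (NvE mu (wgrad u) q0); apply: eq_Rintegral => x _; exact: pow_dotvv. Qed.

Section Load.
Variable f : R3 R -> R.
Hypothesis Lf : Lp mu qd f.
Local Notation E := (poisson_energy f).
Local Notation Nf := (Lpnorm mu qd f).

Lemma load_integrable w : D1 q w -> integrableR mu (fun x => f x * w x).
Proof. by move=> /(D1_Lp hq); exact: (hoelder_integrableR dual_exp_gt0 qs0 dual_expP Lf). Qed.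

Lemma load_le w : D1 q w -> `|\int[mu]_x (f x * w x)| <= Nf * (S * Nv mu q (wgrad w)).
Proof.
move=> Dw; apply: le_trans (hoelder_abs_le dual_exp_gt0 qs0 dual_expP Lf (D1_Lp hq Dw)) _.
by apply: ler_wpM2l; [exact: Lpnorm_ge0|exact: D1_sobolev].
Qed.

Lemma poisson_energy_coercive : exists C : R, forall w, D1 q w ->
  Nv mu q (wgrad w) `^ q <= 2 * q * (E w + C).
Proof.
pose K := Nf * S; have K0 : 0 <= K by rewrite mulr_ge0 ?Lpnorm_ge0 ?sobolev_const_ge0.
(* [a] solves a^(q-1) = 2K, so that Young's inequality lets half of |grad w|_q^q / q absorb the
   linear term. *)
pose a := (2 * K) `^ (q - 1)^-1; have a0 : 0 <= a by exact: powR_ge0.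
have aq : a `^ (q - 1) = 2 * K.
  rewrite /a -powRrM mulVf; last by rewrite gt_eqF// subr_gt0.
  by rewrite powRr1// mulr_ge0.
exists ((q - 1) / (2 * q) * a `^ q) => w Dw.
have G0 : 0 <= Nv mu q (wgrad w) by exact: Nv_ge0.
have := load_le Dw; rewrite ler_norml => /andP[_ L].
have := young_le a0 G0 q1; rewrite aq.
rewrite /poisson_energy; set G := Nv mu q (wgrad w) in G0 L *.
set A := a `^ q; set P := G `^ q; set I := \int[mu]_x _ in L *.
rewrite mulrA -/K in L.
have -> : 2 * q * (q^-1 * P - I + (q - 1) / (2 * q) * A) = 2 * P - 2 * q * I + (q - 1) * A.
  by field; rewrite gt_eqF.
have : q * (2 * I) <= q * (2 * K * G) by rewrite ler_pM2l//; lra.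
lra.
Qed.

Lemma poisson_energy_cvg (eta : nat -> R3 R -> R) w : (forall n, D1 q (eta n)) -> D1 q w ->
  Nv mu q (fun x => wgrad (eta n) x \- wgrad w x) @[n --> \oo] --> (0 : R) ->
  Lpnorm mu qs (fun x => eta n x - w x) @[n --> \oo] --> (0 : R) ->
  E (eta n) @[n --> \oo] --> E w.
Proof.
move=> De Dw c1 c2; apply: cvgB.
  apply: cvgM; first exact: cvg_cst.
  apply: cvg_powR => //; [by move=> n; exact: Nv_ge0|exact: Nv_ge0|].
  apply: cvg_dist_le c1 => n.
  exact: (NvB_le (ltW q1) (D1_Lpv hq (De n)) (D1_Lpv hq Dw)).
apply: cvg_dist_le (cvgZ_0 Nf c2) => n.
rewrite -(RintB (load_integrable (De n)) (load_integrable Dw)).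
have -> : (fun x => f x * eta n x - f x * w x) = (fun x => f x * (eta n x - w x)).
  by apply/funext => x; rewrite mulrBr.
exact: (hoelder_abs_le dual_exp_gt0 qs0 dual_expP Lf (LpB qs0 (D1_Lp hq (De n)) (D1_Lp hq Dw))).
Qed.

(** The infimum is taken over test functions only. Density extends the lower bound to all of [D1],
    while minimizing sequences consist of test functions and so provide the approximation that
    membership of their limit in [D1] requires. *)
Let Einf := inf [set E eta | eta in @test_function R].

Let has_Einf : has_inf [set E eta | eta in @test_function R].
Proof.
split; first by exists (E (fun=> 0)); exists (fun=> 0) => //; exact: test_function0.
have [C HC] := poisson_energy_coercive; exists (- C) => _ [eta te <-].
have := HC _ (D1_test hq te) => H.
have : 0 <= 2 * q * (E eta + C) by apply: le_trans H; exact: powR_ge0.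
by rewrite pmulr_rge0 ?mulr_gt0// -lerBlDr sub0r.
Qed.

Lemma poisson_energy_ge_inf w : D1 q w -> Einf <= E w.
Proof.
move=> Dw; have /(D1P hq)[_ _ [eta [te c1 c2]]] := Dw.
have ce := poisson_energy_cvg (fun n => D1_test hq (te n)) Dw c1 c2.
rewrite -(cvg_lim _ ce)//; apply: limr_ge; first exact: cvgP ce.
apply: nearW => n; apply: ge_inf; first exact: has_Einf.2.
by exists (eta n).
Qed.

Lemma minimizing_sequence : exists eta : nat -> R3 R -> R,
  forall n, test_function (eta n) /\ E (eta n) <= Einf + n.+1%:R^-1.
Proof.
have : forall n : nat, exists eta, test_function eta /\ E eta <= Einf + n.+1%:R^-1.
  move=> n; have n0 : (0 : R) < n.+1%:R^-1 by rewrite invr_gt0.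
  have [_ [eta te <-] He] := inf_adherent n0 has_Einf.
  by exists eta; split=> //; exact: ltW.
by move=> /choice[eta H]; exists eta.
Qed.

(** The linear part of E cancels at the midpoint, and E u + E v - 2 E ((u + v) / 2) is exactly the
    sum of the two Bregman distances to the mean gradient. The midpoint energy is at least [Einf],
    and one of the nonnegative distances is dropped. *)
Lemma midpoint_bregman u v (d : R) : D1 q u -> D1 q v -> E u + E v <= 2 * Einf + d ->
  \int[mu]_x bregman q (wgrad u x) (fun i => 2^-1 * (wgrad u x i + wgrad v x i)) <= d.
Proof.
move=> Du Dv Ed; pose M x i : R := 2^-1 * (wgrad u x i + wgrad v x i).
rewrite -/(M _).
have Wu := D1_Lpv hq Du; have Wv := D1_Lpv hq Dv.
have WM : Lpv mu q M by apply: LpvZ; exact: (LpvD q0 Wu Wv).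
pose z x : R := 2^-1 * (u x - v x) + v x.
have Dz : D1 q z by apply: D1_lin => //; exact: D1B.
have Nz : Nv mu q (wgrad z) = Nv mu q M.
  apply: Nv_ae; [exact: (Lpv_measurable (D1_Lpv hq Dz))|exact: (Lpv_measurable WM)|].
  apply: aeS2 (wgrad_lin_ae 2^-1 q0 (D1_grad (D1B hq Du Dv)) (D1_grad Dv))
    (wgradB_ae q0 (D1_grad Du) (D1_grad Dv)) => x -> ->.
  by apply/funext => i /=; rewrite /M; field.
have iu := load_integrable Du; have iv := load_integrable Dv.
have Iz : \int[mu]_x (f x * z x) = 2^-1 * (\int[mu]_x (f x * u x) + \int[mu]_x (f x * v x)).
  rewrite -(RintD iu iv) -(RintZ _ (integrableRD iu iv)).
  by apply: eq_Rintegral => x _; rewrite /z; field.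
have [iB1 B1] := bregman_integral q1 Wu WM.
have [iB2 B2] := bregman_integral q1 Wv WM.
have B20 : 0 <= \int[mu]_x bregman q (wgrad v x) (M x).
  by apply: Rintegral_ge0 => x _; exact: bregman_ge0.
have MM : \int[mu]_x (normv (M x) `^ (q - 2) * dotv (M x) (wgrad u x)) +
    \int[mu]_x (normv (M x) `^ (q - 2) * dotv (M x) (wgrad v x)) = 2 * Nv mu q M `^ q.
  rewrite -(RintD (integrable_pow_dotv q1 WM Wu) (integrable_pow_dotv q1 WM Wv)).
  rewrite (NvE mu M q0) -(RintZ _ (integrable_normv q0 WM)).
  apply: eq_Rintegral => x _; rewrite -mulrDr -dotvDr -pow_dotvv mulrCA; congr (_ * _).
  by rewrite -dotvZr; congr dotv; apply/funext => i /=; rewrite /M; field.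
have := poisson_energy_ge_inf Dz; move: Ed; rewrite /poisson_energy Nz Iz.
move: B1 B2 MM B20.
move: (\int[mu]_x bregman q (wgrad u x) (M x)) (\int[mu]_x bregman q (wgrad v x) (M x)).
move: (\int[mu]_x (normv (M x) `^ (q - 2) * dotv (M x) (wgrad u x))).
move: (\int[mu]_x (normv (M x) `^ (q - 2) * dotv (M x) (wgrad v x))).
move: (Nv mu q (wgrad u) `^ q) (Nv mu q (wgrad v) `^ q) (Nv mu q M `^ q).
move: (\int[mu]_x (f x * u x)) (\int[mu]_x (f x * v x)).
clear; intros; lra.
Qed.

(** Coercivity bounds the gradients, midpoints make the Bregman distances small, and
    [bregman_integral_powR] converts this into smallness of the norm. This replaces uniform
    convexity. *)
Lemma minimizing_cauchy (eta : nat -> R3 R -> R) :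
  (forall n, test_function (eta n) /\ E (eta n) <= Einf + n.+1%:R^-1) ->
  forall e : R, 0 < e -> exists N, forall k l, (N <= k)%N -> (N <= l)%N ->
    Nv mu q (fun x => wgrad (eta k) x \- wgrad (eta l) x) <= e.
Proof.
move=> H e e0; have [C HC] := poisson_energy_coercive.
have De n : D1 q (eta n) := D1_test hq (H n).1.
have We n : Lpv mu q (wgrad (eta n)) := D1_Lpv hq (De n).
pose B := 2 * q * (Einf + 1 + C).
have HB n : Nv mu q (wgrad (eta n)) `^ q <= B.
  apply: le_trans (HC _ (De n)) _; rewrite ler_pM2l ?mulr_gt0// lerD2r.
  apply: le_trans (H n).2 _; rewrite lerD2l invf_le1// ler1n//.
have B0 : 0 <= B by apply: le_trans (HB 0%N); exact: powR_ge0.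
pose b := B `^ q^-1; have b0 : 0 <= b by exact: powR_ge0.
have bq : b `^ q = B by rewrite /b -powRrM mulVf ?powRr1// gt_eqF.
have Hb n : Nv mu q (wgrad (eta n)) <= b.
  by rewrite /Nv (Lpmass_le_powR _ _ q0 b0) bq -(Lpnorm_powR _ _ q0); exact: HB.
(* A gradient differs from the mean of two by half of their difference, so (D / 2)^q <= t is the
   goal. The parameter t / (2 (B + 1)) uses up t / 2, and [N] is chosen for the Bregman term to use
   up the rest. *)
pose t := (e / 2) `^ q; have t0 : 0 < t by rewrite powR_gt0// divr_gt0.
have B1 : 0 < 2 * (B + 1) by rewrite mulr_gt0// ltr_wpDl.
have [C1 C10 HC1] := @bregman_integral_powR _ _ R mu 3 q (t / (2 * (B + 1))) q1 (divr_gt0 t0 B1).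
pose N := (Num.truncn (4 * C1 / t)).+1.
exists N => k l Nk Nl.
have dN n : (N <= n)%N -> n.+1%:R^-1 <= t / (4 * C1) :> R.
  move=> Nn; rewrite -[leRHS]invrK invf_div lef_pV2 ?posrE ?divr_gt0 ?mulr_gt0//.
  apply: ltW; apply: lt_le_trans (truncnS_gt _) _; rewrite ler_nat.
  by apply: leq_trans Nn _.
have hd : E (eta k) + E (eta l) <= 2 * Einf + t / (2 * C1).
  apply: le_trans (lerD (H k).2 (H l).2) _.
  have h1 := dN _ Nk; have h2 := dN _ Nl.
  have -> : t / (2 * C1) = t / (4 * C1) + t / (4 * C1) by field; rewrite gt_eqF.
  by rewrite addrACA [2 * Einf]mulr_natl mulr2n lerD2l; exact: lerD.
have mid := midpoint_bregman (De k) (De l) hd.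
pose M x i : R := 2^-1 * (wgrad (eta k) x i + wgrad (eta l) x i).
have WM : Lpv mu q M by apply: LpvZ; exact: (LpvD q0 (We k) (We l)).
have NM : Nv mu q M `^ q <= B.
  rewrite -bq; apply: ge0_ler_powR; rewrite ?nnegrE ?Nv_ge0 ?(ltW q0)//.
  rewrite /M (NvZ 2^-1 q0 (LpvD q0 (We k) (We l))) ger0_norm ?invr_ge0//.
  apply: le_trans (ler_wpM2l _ (NvD (ltW q1) (We k) (We l))) _; first by rewrite invr_ge0.
  exact: half_sum_le.
have := HC1 _ _ (We k) WM.
have -> : (fun x => wgrad (eta k) x \- M x) =
    (fun x i => 2^-1 * (wgrad (eta k) x \- wgrad (eta l) x) i).
  by apply/funext => x; apply/funext => i /=; rewrite /M; field.
have WB := LpvB q0 (We k) (We l).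
rewrite (NvZ 2^-1 q0 WB) ger0_norm ?invr_ge0//; set D := Nv mu q _.
have D0 : 0 <= D by exact: Nv_ge0.
move=> HD; have Dt : (2^-1 * D) `^ q <= t.
  apply: le_trans HD _.
  have h1 : t / (2 * (B + 1)) * Nv mu q M `^ q <= t / 2.
    apply: (@le_trans _ _ (t / (2 * (B + 1)) * (B + 1))).
      apply: ler_wpM2l; first by rewrite divr_ge0 ?ltW.
      by apply: le_trans NM _; rewrite lerDl.
    rewrite le_eqVlt; apply/orP; left; apply/eqP; field.
    by rewrite gt_eqF// ltr_wpDl.
  have h2 : C1 * \int[mu]_x bregman q (wgrad (eta k) x) (M x) <= t / 2.
    apply: le_trans (ler_wpM2l (ltW C10) mid) _.
    rewrite le_eqVlt; apply/orP; left; apply/eqP; field.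
    by rewrite gt_eqF.
  by rewrite [leRHS](splitr t) lerD.
rewrite leNgt; apply/negP => eD; move: Dt; rewrite leNgt => /negP; apply.
rewrite /t; apply: gt0_ltr_powR => //; rewrite ?nnegrE ?mulr_ge0 ?divr_ge0 ?invr_ge0 ?(ltW e0)//.
by rewrite mulrC ltr_pM2l ?invr_gt0.
Qed.

Lemma minimizer_exists : exists2 phi, D1 q phi & forall w, D1 q w -> E phi <= E w.
Proof.
have [eta H] := minimizing_sequence; have cau := minimizing_cauchy H.
have De n : D1 q (eta n) := D1_test hq (H n).1.
have We n : Lpv mu q (wgrad (eta n)) := D1_Lpv hq (De n).
have Le n : Lp mu qs (eta n) := D1_Lp hq (De n).
have /choice[g Hg] : forall i : 'I_3, exists g, Lp mu q g /\
    Lpnorm mu q (fun x => wgrad (eta n) x i - g x) @[n --> \oo] --> (0 : R).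
  move=> i; have [|g Lg cg] := @Lp_complete _ _ R mu q (fun n x => wgrad (eta n) x i) q1 (fun n => We n i).
    move=> e e0; have [N HN] := cau e e0; exists N => k l Nk Nl.
    apply: le_trans (HN k l Nk Nl).
    exact: (Lpnorm_coord_le i q0 (LpvB q0 (We k) (We l))).
  by exists g.
(* The functions themselves converge in L^{q-star} because the Sobolev inequality bounds their
   differences by those of the gradients. *)
have [|phi Lphi cphi] := @Lp_complete _ _ R mu qs eta qs1 Le.
  move=> e e0; have S1 : 0 < S + 1 by rewrite ltr_wpDl// sobolev_const_ge0.
  have [N HN] := cau (e / (S + 1)) (divr_gt0 e0 S1); exists N => k l Nk Nl.
  apply: le_trans (D1_sobolev hq (D1B hq (De k) (De l))) _.
  rewrite (Nv_wgradB q0 (D1_grad (De k)) (D1_grad (De l))).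
  apply: le_trans (ler_wpM2l (sobolev_const_ge0 hq) (HN k l Nk Nl)) _.
  rewrite mulrCA ger_pMr// ler_pdivrMr// mul1r lerDl//.
pose q' := q / (q - 1); have q'0 : 0 < q' by rewrite divr_gt0// subr_gt0.
have qq' : q^-1 + q'^-1 = 1.
  rewrite /q' invf_div addrC; rewrite -[X in _ + X]mul1r -mulrDl subrK divff//.
  by rewrite gt_eqF.
have qsqd : qs^-1 + qd^-1 = 1 by rewrite addrC dual_expP.
(* The weak derivative is closed: both sides of the defining identity pass to the limit by Hoelder
   against a fixed test function. *)
have wphi i : is_weak_partial i phi (g i).
  apply/is_weak_partialP; split.
  - exact: Lp_locint (ltW qs1) Lphi.
  - exact: Lp_locint (ltW q1) (Hg i).1.
  move=> z tz; have tpz := test_function_partial i tz.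
  have c1 := Rint_cvg qs0 dual_exp_gt0 qsqd Le Lphi (test_Lp dual_exp_gt0 tpz) cphi.
  have c2 := Rint_cvg q0 q'0 qq' (fun n => We n i) (Hg i).1 (test_Lp q'0 tz) (Hg i).2.
  have E0 n : \int[mu]_x (eta n x * partial i z x) = - \int[mu]_x (wgrad (eta n) x i * z x).
    have /(weak_grad_inP _ q0)/(_ i)[/is_weak_partialP[_ _ W] _] := D1_grad (De n).
    exact: W.
  move: c1; under eq_fun do rewrite E0.
  by move=> /cvg_unique; apply=> //; exact: cvgN.
have wgphi : {ae mu, forall x, wgrad phi x = (g^~ x)}.
  have W i := (wpartialP (wphi i)).2.
  apply: aeS3 (W ord0) (W (inord 1)) (W (inord 2)) => x h0 h1 h2.
  apply/funext => -[[|[|[|//]]] k]; rewrite /wgrad.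
  - by rewrite (_ : Ordinal k = ord0) ?h0//; exact/val_inj.
  - by rewrite (_ : Ordinal k = inord 1) ?h1//; apply/val_inj; rewrite /= inordK.
  - by rewrite (_ : Ordinal k = inord 2) ?h2//; apply/val_inj; rewrite /= inordK.
have wgi : weak_grad_in q phi.
  by move=> i; exists (g i) => //; apply/(Lfun_LpP mu _ q0); exact: (Hg i).1.
have Wphi := weak_grad_Lpv q0 wgi.
have cN : Nv mu q (fun x => wgrad (eta n) x \- wgrad phi x) @[n --> \oo] --> (0 : R).
  apply: cvg_0_le (cvgD_0 (Hg ord0).2 (cvgD_0 (Hg (lift ord0 ord0)).2 (Hg (lift ord0 (lift ord0 ord0))).2)) => n.
  rewrite Nv_ge0/=.
  apply: le_trans (Nv_sum_le (ltW q1) (LpvB q0 (We n) Wphi)) _.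
  have Ei i : Lpnorm mu q (fun x => (wgrad (eta n) x \- wgrad phi x) i) =
      Lpnorm mu q (fun x => wgrad (eta n) x i - g i x).
    rewrite !LpnormE; congr (_ `^ _); apply: Lpmass_ae.
    - by apply: measurable_funB; [exact: (We n i).1|exact: (Wphi i).1].
    - by apply: measurable_funB; [exact: (We n i).1|exact: (Hg i).1.1].
    - by apply: aeS wgphi => x /= ->.
  have -> : \sum_(i < 3) Lpnorm mu q (fun x => (wgrad (eta n) x \- wgrad phi x) i) =
      \sum_(i < 3) Lpnorm mu q (fun x => wgrad (eta n) x i - g i x).
    by apply: eq_bigr => i _; exact: Ei.
  by rewrite !big_ord_recl big_ord0 addr0; exact: lexx.
have Dphi : D1 q phi.
  by apply/(D1P hq); split=> //; exists eta; split=> // n; exact: (H n).1.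
exists phi => // w Dw; apply: le_trans (poisson_energy_ge_inf Dw).
have cE := poisson_energy_cvg De Dphi cN cphi.
have ch : Einf + n.+1%:R^-1 @[n --> \oo] --> Einf.
  by rewrite -[X in _ --> X]addr0; apply: cvgD; [exact: cvg_cst|exact: cvg_harmonic].
by apply: (ler_cvg_to cE ch); apply: nearW => n; exact: (H n).2.
Qed.

(** The first variation, obtained from the Taylor bound with parameter e: the defect L is at most a
    multiple of e plus C t^(q-1), where t is sent to 0 after e and its constant C are fixed. *)
Lemma minimizer_poisson phi : D1 q phi -> (forall w, D1 q w -> E phi <= E w) -> poisson f phi.
Proof.
move=> Dphi Hmin w Dw; apply/eqP; rewrite -subr_eq0 -normr_eq0 -normr_le0.
set L := grad_form phi w - _.
have W := D1_Lpv hq Dphi; have Ww := D1_Lpv hq Dw.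
set A := Nv mu q (wgrad phi) `^ (q - 1) * Nv mu q (wgrad w).
have A0 : 0 <= A by rewrite mulr_ge0 ?powR_ge0 ?Nv_ge0.
set Z := Nv mu q (wgrad w) `^ q; have Z0 : 0 <= Z by exact: powR_ge0.
have step (e : R) : 0 < e -> exists2 C : R, 0 <= C & forall t, 0 < t ->
    `|L| <= q^-1 * (e * A) + C * t `^ (q - 1).
  move=> e0; have [C C0 HC] := @vec_taylor _ _ R mu 3 q e q1 e0.
  exists (q^-1 * (C * Z)); first by rewrite mulr_ge0 ?invr_ge0 ?(ltW q0)// mulr_ge0 ?(ltW C0).
  (* The step has the sign opposite to L, so the first-order change of the energy is -|L| t. *)
  move=> t t0; pose s := - Num.sg L * t.
  have Ds : D1 q (fun x => s * w x + phi x) by exact: D1_lin.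
  have := Hmin _ Ds; rewrite /poisson_energy.
  have -> : Nv mu q (wgrad (fun x => s * w x + phi x)) =
      Nv mu q (fun x => wgrad phi x \+ (fun i => s * wgrad w x i)).
    rewrite (Nv_wgrad_lin s q0 (D1_grad Dw) (D1_grad Dphi)); congr (Nv _ _ _).
    by apply/funext => x; apply/funext => i /=; rewrite addrC.
  have -> : \int[mu]_x (f x * (s * w x + phi x)) = s * \int[mu]_x (f x * w x) + \int[mu]_x (f x * phi x).
    have iw := load_integrable Dw.
    rewrite -(RintZ s iw) -(RintD (integrableRZ s iw) (load_integrable Dphi)).
    by apply: eq_Rintegral => x _; ring.
  have := HC _ _ W (LpvZ s Ww); rewrite (NvZ s q0 Ww).
  have -> : \int[mu]_x (normv (wgrad phi x) `^ (q - 2) * dotv (wgrad phi x) (fun i => s * wgrad w x i)) =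
      s * grad_form phi w.
    rewrite -(RintZ s (integrable_pow_dotv q1 W Ww)); apply: eq_Rintegral => x _.
    by rewrite dotvZr mulrCA.
  rewrite powRM ?Nv_ge0// -/Z ler_norml => /andP[_].
  have sL : s * L = - (`|L| * t) by rewrite /s normrEsg; ring.
  have st : `|s| <= t.
    by rewrite /s normrM normrN (gtr0_norm t0) normr_sg ger_pMl//; case: (L != 0).
  have tq : t `^ q = t * t `^ (q - 1) by rewrite mulr_powRB1// ltW.
  have stq : `|s| `^ q <= t `^ q by apply: ge0_ler_powR; rewrite ?nnegrE ?(ltW q0) ?(ltW t0).
  exact: (variation_arith q0 (ltW e0) t0 A0 Z0 (ltW C0) sL st tq stq).
rewrite normr_id leNgt; apply/negP => L0.
have q10 : 0 < q - 1 by rewrite subr_gt0.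
(* The parameter |L| divided by this quantity makes the first term at most |L| / 2, and d makes the
   second at most |L| / 4: a contradiction if L is nonzero. *)
have A1 : 0 < 2 * (q^-1 * (A + 1)) by rewrite mulr_gt0// mulr_gt0 ?invr_gt0// ltr_wpDl.
have [C C0 HC] := step _ (divr_gt0 L0 A1).
have [d d0 Hd] := small_powR C0 q10 (divr_gt0 L0 (ltr0n _ 4)).
have := HC d d0; have := Hd d; rewrite lexx (ltW d0) => /(_ isT) h1.
rewrite leNgt => /negP; apply.
have h2 : q^-1 * (`|L| / (2 * (q^-1 * (A + 1))) * A) <= `|L| / 2.
  apply: (@le_trans _ _ (q^-1 * (`|L| / (2 * (q^-1 * (A + 1))) * (A + 1)))).
    rewrite ler_pM2l ?invr_gt0//; apply: ler_wpM2l; last by rewrite lerDl.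
    by rewrite divr_ge0 ?ltW.
  rewrite le_eqVlt; apply/orP; left; apply/eqP; field.
  by rewrite (gt_eqF q0) gt_eqF// ltr_wpDl.
exact: quarter_half_lt h1 h2.
Qed.

End Load.
End Poisson.

(** The unknown D occurs on both sides. If D > T, each term on the right is below a quarter of D^q =
    D D^(q-1). *)
Lemma absorb_bound (R : realType) (q D T : R) : 1 < q -> 0 <= D -> 0 < T -> 
  forall e C A h : R, 0 <= A -> 0 <= C -> 0 <= h -> e * A <= T `^ q / 4 -> C * h <= T `^ (q - 1) / 4 ->
  D `^ q <= e * A + C * (h * D) -> D <= T.
Proof.
move=> q1 D0 T0 e C A h A0 C0 h0 eA Ch H; rewrite leNgt; apply/negP => TD.
have q0 : 0 < q by exact: lt_trans ltr01 q1.
have q10 : 0 < q - 1 by rewrite subr_gt0.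
have P1 : T `^ (q - 1) < D `^ (q - 1) by apply: gt0_ltr_powR; rewrite ?nnegrE// ltW.
have E1 : D `^ q = D * D `^ (q - 1) by rewrite mulr_powRB1.
have E2 : T `^ q = T * T `^ (q - 1) by rewrite mulr_powRB1// ltW.
have T1 : 0 < T `^ (q - 1) by exact: powR_gt0.
move: H eA Ch; rewrite E1 E2.
move: (T `^ (q - 1)) (D `^ (q - 1)) P1 T1 => a b ab a0.
move: (e * A) => X H h1 h2.
have h3 : C * (h * D) <= a / 4 * D by rewrite mulrA; apply: ler_wpM2r.
have h4 : T * a <= D * a by rewrite ler_wpM2r// ltW.
have h5 : D * a < D * b by rewrite ltr_pM2l// (lt_trans T0).
have h6 : 0 < T * a by exact: mulr_gt0.
move: h1 h3 h4 h5 h6 H; clear; intros; lra.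
Qed.

(** Here and in [envelope_arith], k = 1/q, N1 and N2 are the q-th powers of the gradient norms of
    phi and psi, I12 is the integral of f psi and I21 that of g phi. The hypotheses are
    nonnegativity of Bregman distances. *)
Lemma bregman_sum_arith (R : realType) (k N1 N2 I12 I21 : R) :
  0 <= k * N1 + (1 - k) * N2 - I21 -> k * N2 + (1 - k) * N1 - I12 <= N1 + N2 - I12 - I21.
Proof. by lra. Qed.

Lemma envelope_arith (R : realType) (k N1 N2 I12 I21 J : R) :
  0 <= k * N1 + (1 - k) * N2 - I21 -> 0 <= k * N2 + (1 - k) * N1 - I12 ->
  J = N1 + N2 - I12 - I21 ->
  `|(1 - k) * N2 - (1 - k) * N1 - (I21 - N1)| <= J.
Proof. by move=> h1 h2 ->; rewrite ger0_norm; lra. Qed.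

(** * Existence, stability and uniqueness for the q-Poisson equation *)

Section PoissonStability.
Variable R : realType.
Local Notation mu := (@leb3 R).
Implicit Types (f g u v w phi psi : R3 R -> R) (e : R).

Variable q : R.
Hypothesis hq : (1 : R) < q < 3.
Let q1 : (1 : R) < q. Proof. by case/andP: hq. Qed.
Let q0 : (0 : R) < q. Proof. exact: lt_trans ltr01 q1. Qed.
Local Notation qs := (sobolev_conj q).
Local Notation qd := (dual_exp q).
Let qqs : q < qs. Proof. exact: sobolev_conj_gt. Qed.
Let qs0 : (0 : R) < qs. Proof. exact: lt_trans q0 qqs. Qed.
Let qd0 : 0 < qd. Proof. exact: dual_exp_gt0. Qed.

Lemma poisson_exists f : Lp mu qd f -> exists2 phi, D1 q phi & poisson q f phi.
Proof.
move=> Lf; have [phi Dphi H] := minimizer_exists hq Lf.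
by exists phi => //; exact: (minimizer_poisson hq Lf Dphi H).
Qed.

Lemma poisson_diag f phi : D1 q phi -> poisson q f phi ->
  \int[mu]_x (f x * phi x) = Nv mu q (wgrad phi) `^ q.
Proof. by move=> D P; rewrite -(grad_form_diag hq) P. Qed.

(** The right side is E_f(w) - E_f(phi), since E_f(phi) = -(1 - 1/q) |grad phi|_q^q: the excess
    energy is a Bregman distance. *)
Lemma poisson_bregman f phi w : D1 q phi -> poisson q f phi -> D1 q w ->
  \int[mu]_x bregman q (wgrad w x) (wgrad phi x) =
  q^-1 * Nv mu q (wgrad w) `^ q + (1 - q^-1) * Nv mu q (wgrad phi) `^ q - \int[mu]_x (f x * w x).
Proof.
move=> D P Dw; have [_ ->] := bregman_integral q1 (D1_Lpv hq Dw) (D1_Lpv hq D).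
by rewrite -(P w Dw).
Qed.

Lemma Rint_bregman_ge0 (F G : R3 R -> 'I_3 -> R) : 0 <= \int[mu]_x bregman q (F x) (G x).
Proof. by apply: Rintegral_ge0 => x _; exact: bregman_ge0. Qed.

Section TwoSolutions.
Variables f g phi psi : R3 R -> R.
Hypotheses (Lf : Lp mu qd f) (Lg : Lp mu qd g) (Dphi : D1 q phi) (Dpsi : D1 q psi).
Hypotheses (Pphi : poisson q f phi) (Ppsi : poisson q g psi).

Let J : \int[mu]_x ((g x - f x) * (psi x - phi x)) =
  Nv mu q (wgrad phi) `^ q + Nv mu q (wgrad psi) `^ q
  - \int[mu]_x (f x * psi x) - \int[mu]_x (g x * phi x).
Proof.
have i1 := load_integrable hq Lf Dphi; have i2 := load_integrable hq Lg Dpsi.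
have i3 := load_integrable hq Lf Dpsi; have i4 := load_integrable hq Lg Dphi.
rewrite -(poisson_diag Dphi Pphi) -(poisson_diag Dpsi Ppsi).
rewrite -(RintD i1 i2) -(RintB (integrableRD i1 i2) i3).
rewrite -(RintB (integrableRB (integrableRD i1 i2) i3) i4).
by apply: eq_Rintegral => x _; ring.
Qed.

Let Jle : `|\int[mu]_x ((g x - f x) * (psi x - phi x))| <=
  Lpnorm mu qd (fun x => g x - f x) *
  (sobolev_const q * Nv mu q (fun x => wgrad psi x \- wgrad phi x)).
Proof.
rewrite -(Nv_wgradB q0 (D1_grad Dpsi) (D1_grad Dphi)).
exact: (load_le hq (LpB qd0 Lg Lf) (D1B hq Dpsi Dphi)).
Qed.

(** The quantity inside the absolute value is the Bregman distance of grad phi to grad psi. Adding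
    the opposite distance gives the integral of (g - f)(psi - phi), which Hoelder and Sobolev bound
    by the right side. *)
Lemma poisson_envelope :
  `|(1 - q^-1) * (\int[mu]_x (g x * psi x)) - (1 - q^-1) * (\int[mu]_x (f x * phi x))
    - \int[mu]_x ((g x - f x) * phi x)| <=
  Lpnorm mu qd (fun x => g x - f x) *
  (sobolev_const q * Nv mu q (fun x => wgrad psi x \- wgrad phi x)).
Proof.
have i1 := load_integrable hq Lf Dphi; have i4 := load_integrable hq Lg Dphi.
have -> : \int[mu]_x ((g x - f x) * phi x) = \int[mu]_x (g x * phi x) - \int[mu]_x (f x * phi x).
  by rewrite -(RintB i4 i1); apply: eq_Rintegral => x _; ring.
apply: le_trans (le_trans (ler_norm _) Jle).
have := Rint_bregman_ge0 (wgrad phi) (wgrad psi); rewrite (poisson_bregman Dpsi Ppsi Dphi).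
have := Rint_bregman_ge0 (wgrad psi) (wgrad phi); rewrite (poisson_bregman Dphi Pphi Dpsi).
rewrite (poisson_diag Dphi Pphi) (poisson_diag Dpsi Ppsi) => h1 h2.
exact: (envelope_arith h2 h1 J).
Qed.

Lemma poisson_bregman_le : \int[mu]_x bregman q (wgrad psi x) (wgrad phi x) <=
  Lpnorm mu qd (fun x => g x - f x) *
  (sobolev_const q * Nv mu q (fun x => wgrad psi x \- wgrad phi x)).
Proof.
apply: le_trans (le_trans (ler_norm _) Jle).
have := Rint_bregman_ge0 (wgrad phi) (wgrad psi).
rewrite (poisson_bregman Dpsi Ppsi Dphi) (poisson_bregman Dphi Pphi Dpsi) J.
exact: bregman_sum_arith.
Qed.

End TwoSolutions.

(** By [poisson_bregman_le] the Bregman distance is at most a multiple of the load difference times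
    the unknown D itself; the coercivity bound then controls D^q and [absorb_bound] removes D from
    the right. *)
Lemma poisson_stable f phi : Lp mu qd f -> D1 q phi -> poisson q f phi ->
  forall e, 0 < e -> exists2 d, 0 < d & forall g psi, Lp mu qd g -> D1 q psi -> poisson q g psi ->
    Lpnorm mu qd (fun x => g x - f x) <= d -> Nv mu q (fun x => wgrad psi x \- wgrad phi x) <= e.
Proof.
move=> Lf Dphi Pphi e e0.
set A := Nv mu q (wgrad phi) `^ q; have A0 : 0 <= A by exact: powR_ge0.
have A1 : 0 < 4 * (A + 1) by rewrite mulr_gt0// ltr_wpDl.
have T0 : 0 < e `^ q / (4 * (A + 1)) by rewrite divr_gt0// powR_gt0.
have [C C0 HC] := @bregman_integral_powR _ _ R mu 3 q (e `^ q / (4 * (A + 1))) q1 T0.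
have S0 := sobolev_const_ge0 hq.
have CS0 : 0 <= C * sobolev_const q by exact: mulr_ge0 (ltW C0) S0.
have CS1 : 0 < 4 * (C * sobolev_const q + 1) by rewrite mulr_gt0// ltr_wpDl.
exists (e `^ (q - 1) / (4 * (C * sobolev_const q + 1))); first by rewrite divr_gt0// powR_gt0.
move=> g psi Lg Dpsi Ppsi hd.
have HB := poisson_bregman_le Lf Lg Dphi Dpsi Pphi Ppsi.
have := HC _ _ (D1_Lpv hq Dpsi) (D1_Lpv hq Dphi).
set D := Nv mu q _ in HB *; have D0 : 0 <= D by exact: Nv_ge0.
set h := Lpnorm mu qd _ in hd HB; have h0 : 0 <= h by exact: Lpnorm_ge0.
move=> H; apply: (absorb_bound q1 D0 e0 A0 CS0 h0 (e := e `^ q / (4 * (A + 1)))).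
- apply: (@le_trans _ _ (e `^ q / (4 * (A + 1)) * (A + 1))).
    by apply: ler_wpM2l; [exact: ltW|rewrite lerDl].
  by rewrite le_eqVlt; apply/orP; left; apply/eqP; field; rewrite gt_eqF// ltr_wpDl.
- apply: (@le_trans _ _ ((C * sobolev_const q + 1) * h)).
    by apply: ler_wpM2r; [exact: h0|rewrite lerDl].
  apply: le_trans (ler_wpM2l _ hd) _; first by rewrite ltW// ltr_wpDl.
  by rewrite le_eqVlt; apply/orP; left; apply/eqP; field; rewrite gt_eqF// ltr_wpDl.
apply: le_trans H _; rewrite lerD2l.
apply: le_trans (ler_wpM2l (ltW C0) HB) _.
by rewrite le_eqVlt; apply/orP; left; apply/eqP; ring.
Qed.

Lemma poisson_envelope_small f phi : Lp mu qd f -> D1 q phi -> poisson q f phi ->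
  forall e, 0 < e -> exists2 d, 0 < d & forall g psi, Lp mu qd g -> D1 q psi -> poisson q g psi ->
    Lpnorm mu qd (fun x => g x - f x) <= d ->
    `|(1 - q^-1) * (\int[mu]_x (g x * psi x)) - (1 - q^-1) * (\int[mu]_x (f x * phi x))
      - \int[mu]_x ((g x - f x) * phi x)| <= e * Lpnorm mu qd (fun x => g x - f x).
Proof.
move=> Lf Dphi Pphi e e0; have S0 := sobolev_const_ge0 hq.
have S1 : 0 < sobolev_const q + 1 by rewrite ltr_wpDl.
have [d d0 H] := poisson_stable Lf Dphi Pphi (divr_gt0 e0 S1).
exists d => // g psi Lg Dpsi Ppsi hd.
apply: le_trans (poisson_envelope Lf Lg Dphi Dpsi Pphi Ppsi) _.
rewrite mulrC; apply: ler_wpM2r; first exact: Lpnorm_ge0.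
apply: le_trans (ler_wpM2l S0 (H g psi Lg Dpsi Ppsi hd)) _.
by rewrite mulrCA ger_pMr// ler_pdivrMr// mul1r lerDl.
Qed.

(** Stability with g = f forces equal gradients in norm, and the Sobolev inequality passes from
    gradients to functions. *)
Lemma poisson_unique f phi psi : Lp mu qd f -> D1 q phi -> D1 q psi ->
  poisson q f phi -> poisson q f psi -> phi = psi %[ae mu].
Proof.
move=> Lf Dphi Dpsi Pphi Ppsi.
have Z : Lpnorm mu qd (fun x => f x - f x) = 0.
  rewrite LpnormE LpmassE.
  under eq_Rintegral do rewrite subrr normr0 powR0 ?(gt_eqF qd0)//.
  by rewrite Rintegral_cst// mul0r powR0// invr_eq0 gt_eqF.
have N0 : Nv mu q (fun x => wgrad psi x \- wgrad phi x) <= 0.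
  apply/ler_addgt0Pl => e e0; rewrite addr0.
  have [d d0 H] := poisson_stable Lf Dphi Pphi e0.
  by apply: (H f psi) => //; rewrite Z ltW.
have L := D1_Lp hq (D1B hq Dphi Dpsi).
have : Lpnorm mu qs (fun x => phi x - psi x) <= 0.
  have := D1_sobolev hq (D1B hq Dpsi Dphi).
  rewrite (Nv_wgradB q0 (D1_grad Dpsi) (D1_grad Dphi)).
  have -> : Lpnorm mu qs (fun x => psi x - phi x) = Lpnorm mu qs (fun x => phi x - psi x).
    by rewrite !LpnormE !LpmassE; under eq_Rintegral do rewrite distrC.
  move/le_trans; apply; rewrite mulr_ge0_le0//; exact: sobolev_const_ge0.
move=> n0; have {}n0 : Lpmass mu qs (fun x => phi x - psi x) = 0.
  rewrite -(Lpnorm_powR _ _ qs0) (_ : Lpnorm _ _ _ = 0) ?powR0 ?gt_eqF//.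
  by apply/eqP; rewrite eq_le n0 Lpnorm_ge0.
rewrite LpmassE in n0; have := Rintegral_eq0_ae (fun x => powR_ge0 _ _) L.2 n0.
by apply: aeS => x H _; move: (H I) => /eqP; rewrite powR_eq0 normr_eq0 subr_eq0 => /andP[/eqP].
Qed.

(** The weak gradient of psi is a representative chosen independently of that of phi, so even a
    change on a null set has to be followed through [weak_grad_in_ae]. *)
Lemma poisson_ae f phi psi : D1 q phi -> measurable_fun setT (psi : R3 (measurableTypeR R) -> R) ->
  phi = psi %[ae mu] -> poisson q f phi -> poisson q f psi.
Proof.
move=> Dphi mpsi E P w Dw; rewrite -(P w Dw).
have [wpsi H] := weak_grad_in_ae q0 (D1_grad Dphi) mpsi E.
have Wphi := D1_Lpv hq Dphi; have Wpsi := weak_grad_Lpv q0 wpsi.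
apply: ae_eq_Rintegral.
- exact: integrableR_measurable (integrable_pow_dotv q1 Wpsi (D1_Lpv hq Dw)).
- exact: integrableR_measurable (integrable_pow_dotv q1 Wphi (D1_Lpv hq Dw)).
by apply: aeS H => x ->.
Qed.

End PoissonStability.

(** * Differentiability of the energy *)

Lemma powR_norm_mul_le (R : realType) (s a b : R) :
  `| `|a| `^ (s - 2) * (a * b)| <= `|a| `^ (s - 1) * `|b|.
Proof.
by have := @dotv_pow_le R 1 s (fun=> a) (fun=> b); rewrite !normv_const /dotv big_ord1.
Qed.

Section LittleO.
Variables (R : realType) (V : Type) (W : V -> Prop) (N : V -> R).
Hypothesis N0 : forall v, 0 <= N v.
Implicit Types (f g h M : V -> R) (e r : R).

Definition little_o f := forall e, 0 < e -> exists2 d : R, 0 < d &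
  forall v, W v -> N v < d -> `|f v| <= e * N v.

Lemma little_oD f g : little_o f -> little_o g -> little_o (fun v => f v + g v).
Proof.
move=> of_ og e e0; have e2 : 0 < e / 2 by rewrite divr_gt0.
have [d1 d10 H1] := of_ _ e2; have [d2 d20 H2] := og _ e2.
exists (Num.min d1 d2); first by rewrite lt_min d10.
move=> v Wv; rewrite lt_min => /andP[v1 v2].
by rewrite (splitr e) mulrDl (le_trans (ler_normD _ _))// lerD ?H1 ?H2.
Qed.

Lemma little_oZ (k : R) f : little_o f -> little_o (fun v => k * f v).
Proof.
move=> of_ e e0; have k0 : 0 < `|k| + 1 by rewrite ltr_wpDl.
have [d d0 H] := of_ _ (divr_gt0 e0 k0); exists d => // v Wv vd.
rewrite normrM; apply: le_trans (ler_wpM2l (normr_ge0 k) (H v Wv vd)) _.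
rewrite mulrA; apply: ler_wpM2r => //.
by rewrite mulrCA ger_pMr// ler_pdivrMr// mul1r lerDl.
Qed.

Lemma little_o_le f g : (forall v, W v -> `|f v| <= `|g v|) -> little_o g -> little_o f.
Proof.
move=> fg og e e0; have [d d0 H] := og e e0; exists d => // v Wv vd.
exact: le_trans (fg v Wv) (H v Wv vd).
Qed.

(** C may grow without bound as e tends to 0. It is fixed together with e, and only then does r > 1
    make C M^r small against N near 0. *)
Lemma little_o_taylor f M r (A K : R) : 1 < r -> 0 <= A -> 0 <= K ->
  (forall v, W v -> 0 <= M v <= K * N v) ->
  (forall e, 0 < e -> exists2 C : R, 0 < C & forall v, W v ->
    `|f v| <= e * (A * M v) + C * M v `^ r) ->
  little_o f.
Proof.
move=> r1 A0 K0 MN Hf e e0.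
have r0 : 0 < r by exact: lt_trans ltr01 r1.
have AK : 0 < 2 * (A * K + 1) by rewrite mulr_gt0// ltr_wpDl// mulr_ge0.
have [C C0 HC] := Hf _ (divr_gt0 e0 AK).
have CK0 : 0 <= C * K `^ r by rewrite mulr_ge0 ?powR_ge0// ltW.
have r10 : 0 < r - 1 by rewrite subr_gt0.
have [d d0 Hd] := small_powR CK0 r10 (divr_gt0 e0 (ltr0n _ 2)).
exists d => // v Wv /ltW vd; apply: le_trans (HC v Wv) _.
have /andP[M0 MK] := MN v Wv.
rewrite [leRHS](_ : _ = e / 2 * N v + e / 2 * N v); last by rewrite -mulrDl -splitr.
apply: lerD.
  apply: (@le_trans _ _ (e / (2 * (A * K + 1)) * ((A * K + 1) * N v))).
    apply: ler_wpM2l; first by rewrite divr_ge0 ?ltW.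
    apply: le_trans (ler_wpM2l A0 MK) _.
    by rewrite mulrA; apply: ler_wpM2r => //; rewrite lerDl.
  rewrite le_eqVlt; apply/orP; left; apply/eqP; field.
  by rewrite gt_eqF// ltr_wpDl// mulr_ge0.
apply: (@le_trans _ _ (C * (K * N v) `^ r)).
  apply: ler_wpM2l; first exact: ltW.
  by apply: ge0_ler_powR; rewrite ?nnegrE ?(ltW r0)//; apply: mulr_ge0.
rewrite powRM// -(mulr_powRB1 (N0 v) r0) mulrA mulrCA.
rewrite [leRHS]mulrC; apply: ler_wpM2l => //.
by apply: Hd; rewrite N0.
Qed.

(** Here f is small relative to an intermediate quantity h, the change of the load |u|^s, which is
    itself controlled linearly by the norm of v near 0. *)
Lemma little_o_comp f h (K : R) : 0 <= K ->
  (forall v, W v -> N v <= 1 -> h v <= K * N v) ->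
  (forall e, 0 < e -> exists2 d : R, 0 < d & forall v, W v -> h v <= d -> `|f v| <= e * h v) ->
  little_o f.
Proof.
move=> K0 hK Hf e e0; have K1 : 0 < K + 1 by rewrite ltr_wpDl.
have [d d0 Hd] := Hf _ (divr_gt0 e0 K1).
exists (Num.min 1 (d / (K + 1))); first by rewrite lt_min ltr01 divr_gt0.
move=> v Wv; rewrite lt_min => /andP[/ltW v1 /ltW vd].
have hv := hK v Wv v1.
have KN : K * N v <= (K + 1) * N v by apply: ler_wpM2r => //; rewrite lerDl.
have hd : h v <= d.
  apply: le_trans hv _; apply: le_trans KN _.
  by rewrite mulrC -ler_pdivlMr.
apply: le_trans (Hd v Wv hd) _.
apply: (@le_trans _ _ (e / (K + 1) * ((K + 1) * N v))).
  by apply: ler_wpM2l; [rewrite divr_ge0 ?ltW|exact: le_trans hv KN].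
by rewrite le_eqVlt mulrA divfK ?eqxx// gt_eqF.
Qed.

End LittleO.

Section ScalarTaylor.
Context d (T : measurableType d) (R : realType) (m : {measure set T -> \bar R}).
Implicit Types (f g u v : T -> R) (r e : R).

Lemma LpE_vec r f : Lp m r f -> Lpv m r (fun x (_ : 'I_1) => f x).
Proof. by move=> Lf i; exact: Lf. Qed.

Lemma Nv_const r f : 0 < r -> Nv m r (fun x (_ : 'I_1) => f x) = Lpnorm m r f.
Proof.
move=> r0; rewrite /Nv !LpnormE !LpmassE.
by under eq_Rintegral do rewrite normv_const normr_id.
Qed.

Lemma integrable_pow_mul r f g : 1 < r -> Lp m r f -> Lp m r g ->
  integrableR m (fun x => `|f x| `^ (r - 2) * (f x * g x)).
Proof.
move=> r1 Lf Lg; have := integrable_pow_dotv r1 (LpE_vec Lf) (LpE_vec Lg).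
by under eq_fun do rewrite normv_const /dotv big_ord1.
Qed.

Lemma scalar_taylor r e : 1 < r -> 0 < e -> exists2 C : R, 0 < C & forall u v,
  Lp m r u -> Lp m r v ->
  `|Lpnorm m r (fun x => u x + v x) `^ r - Lpnorm m r u `^ r
    - r * \int[m]_x (`|u x| `^ (r - 2) * (u x * v x))|
  <= e * (Lpnorm m r u `^ (r - 1) * Lpnorm m r v) + C * Lpnorm m r v `^ r.
Proof.
move=> r1 e0; have r0 : 0 < r by exact: lt_trans ltr01 r1.
have [C C0 HC] := @vec_taylor _ _ R m 1 r e r1 e0; exists C => // u v Lu Lv.
have := HC _ _ (LpE_vec Lu) (LpE_vec Lv); rewrite !(Nv_const _ r0).
by under eq_Rintegral do rewrite normv_const /dotv big_ord1.
Qed.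

Variables (s a b : R).
Hypotheses (s1 : 1 < s) (a0 : 0 < a) (a1 : 1 <= a) (b0 : 0 < b) (ab : a^-1 + b^-1 = 1).

Lemma Lp_pow_mul u v : Lp m (s * a) u -> Lp m (s * a) v ->
  Lp m a (fun x => `|u x| `^ (s - 2) * (u x * v x)).
Proof.
move=> Lu Lv; have [L _] := pow_holder s1 a0 Lu Lv.
apply: (Lp_le a0) L _ => [|x].
  apply: measurable_funM; first exact: measurable_powR_abs Lu.1.
  by apply: measurable_funM; [exact: Lu.1|exact: Lv.1].
by rewrite [leRHS]ger0_norm ?mulr_ge0 ?powR_ge0//; exact: powR_norm_mul_le.
Qed.

(** Measures how far the load |u|^s moves in L^a when u moves in L^(sa); a will be the dual exponent
    of q-star. *)
Lemma Lpnorm_pow_sub_le : exists2 C : R, 0 < C & forall u v,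
  Lp m (s * a) u -> Lp m (s * a) v ->
  Lpnorm m a (fun x => `|u x + v x| `^ s - `|u x| `^ s) <=
  C * (Lpnorm m (s * a) u `^ (s - 1) * Lpnorm m (s * a) v + Lpnorm m (s * a) v `^ s).
Proof.
have s0 : 0 < s by exact: lt_trans ltr01 s1.
have sa0 : 0 < s * a by exact: mulr_gt0.
have [C C0 HC] := powR_norm_sub_le s1; exists C => // u v Lu Lv.
have [L1 N1] := pow_holder s1 a0 Lu Lv.
have L2 := Lp_abs_powR s0 Lv.
have L12 := LpD a0 L1 L2.
have Lg : Lp m a (fun x => `|u x + v x| `^ s - `|u x| `^ s).
  by exact: (LpB a0 (Lp_abs_powR s0 (LpD sa0 Lu Lv)) (Lp_abs_powR s0 Lu)).
apply: (@le_trans _ _ (Lpnorm m a (fun x => C * (`|u x| `^ (s - 1) * `|v x| + `|v x| `^ s)))).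
  apply: (Lpnorm_mass_le a0); apply: (Lpmass_le a0 Lg (LpZ C L12)).
  apply: aeW => x; rewrite [leRHS]ger0_norm; first exact: HC.
  by rewrite mulr_ge0 ?(ltW C0)// addr_ge0 ?powR_ge0// mulr_ge0 ?powR_ge0.
rewrite (LpnormZ C a0 L12) gtr0_norm// ler_pM2l//.
apply: le_trans (Lpnorm_triangle a1 L1 L2) _; apply: lerD; first exact: N1.
by rewrite (Lpnorm_abs_powR _ _ s0 a0).
Qed.

(** The weight phi enters only through its L^b norm P, so the pointwise Taylor bound is used with
    parameter e / (P + 1), the added 1 covering P = 0. *)
Lemma weighted_taylor u phi : Lp m (s * a) u -> Lp m b phi ->
  forall e, 0 < e -> exists2 C : R, 0 < C & forall v, Lp m (s * a) v ->
  `|\int[m]_x ((`|u x + v x| `^ s - `|u x| `^ s) * phi x)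
    - s * \int[m]_x (`|u x| `^ (s - 2) * (u x * v x) * phi x)| <=
  e * (Lpnorm m (s * a) u `^ (s - 1) * Lpnorm m (s * a) v) + C * Lpnorm m (s * a) v `^ s.
Proof.
move=> Lu Lphi e e0; set P := Lpnorm m b phi.
have P0 : 0 <= P by exact: Lpnorm_ge0.
have P1 : 0 < P + 1 by rewrite ltr_wpDl.
have s0 : 0 < s by exact: lt_trans ltr01 s1.
have sa0 : 0 < s * a by exact: mulr_gt0.
have eP : 0 < e / (P + 1) by exact: divr_gt0.
have [C C0 HC] := powR_norm_taylor s1 eP; exists (C * (P + 1)); first exact: mulr_gt0.
move=> v Lv; have [L1 N1] := pow_holder s1 a0 Lu Lv.
have L2 := Lp_abs_powR s0 Lv.
have LR := LpD a0 (LpZ (e / (P + 1)) L1) (LpZ C L2).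
have Lg : Lp m a (fun x => `|u x + v x| `^ s - `|u x| `^ s).
  by exact: (LpB a0 (Lp_abs_powR s0 (LpD sa0 Lu Lv)) (Lp_abs_powR s0 Lu)).
have Ld := Lp_pow_mul Lu Lv.
have i1 := hoelder_integrableR a0 b0 ab Lg Lphi.
have i2 := hoelder_integrableR a0 b0 ab Ld Lphi.
have Lr := LpB a0 Lg (LpZ s Ld).
rewrite -(RintZ s i2) -(RintB i1 (integrableRZ s i2)).
have -> : (fun x => (`|u x + v x| `^ s - `|u x| `^ s) * phi x - s * (`|u x| `^ (s - 2) * (u x * v x) * phi x)) =
    (fun x => (`|u x + v x| `^ s - `|u x| `^ s - s * (`|u x| `^ (s - 2) * (u x * v x))) * phi x).
  by apply/funext => x; ring.
apply: le_trans (hoelder_abs_le a0 b0 ab Lr Lphi) _; rewrite -/P.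
apply: (@le_trans _ _ ((e / (P + 1) * (Lpnorm m (s * a) u `^ (s - 1) * Lpnorm m (s * a) v)
    + C * Lpnorm m (s * a) v `^ s) * (P + 1))); last first.
  by rewrite le_eqVlt; apply/orP; left; apply/eqP; field; rewrite gt_eqF.
apply: ler_pM; [exact: Lpnorm_ge0|exact: P0| |by rewrite lerDl].
apply: (@le_trans _ _ (Lpnorm m a (fun x => e / (P + 1) * (`|u x| `^ (s - 1) * `|v x|) + C * `|v x| `^ s))).
  apply: (Lpnorm_mass_le a0); apply: (Lpmass_le a0 Lr LR).
  apply: aeW => x; rewrite [leRHS]ger0_norm; first exact: HC.
  by rewrite addr_ge0// mulr_ge0 ?powR_ge0 ?(ltW C0) ?(ltW eP)// mulr_ge0 ?powR_ge0.
apply: le_trans (Lpnorm_triangle a1 (LpZ _ L1) (LpZ _ L2)) _.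
rewrite (LpnormZ _ a0 L1) (LpnormZ _ a0 L2) (gtr0_norm eP) (gtr0_norm C0).
rewrite (Lpnorm_abs_powR _ _ s0 a0) lerD2r.
by apply: ler_wpM2l; [exact: ltW|exact: N1].
Qed.

End ScalarTaylor.

Lemma ler_powR_cancel (R : realType) (p x y : R) : 0 < p -> 0 <= x -> 0 <= y -> x `^ p <= y `^ p -> x <= y.
Proof.
move=> p0 x0 y0; rewrite leNgt => /negP H; rewrite leNgt; apply/negP => yx; apply: H.
by apply: gt0_ltr_powR; rewrite ?nnegrE.
Qed.

Lemma energy_arith (R : realType) (p s r l N N' P P' A A' Q Q' I1 I2 I3 I4 : R) :
  p != 0 -> s != 0 -> r != 0 ->
  p^-1 * (N' + P') + l / s * A' - r^-1 * Q' - (p^-1 * (N + P) + l / s * A - r^-1 * Q)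
    - (I1 + I2 + l * I3 - I4) =
  p^-1 * (N' - N - p * I1 + (P' - P - p * I2)) + l / s * (A' - A - s * I3)
    + - r^-1 * (Q' - Q - r * I4).
Proof. by move=> p0 s0 r0; field; rewrite p0 s0 r0. Qed.

(** * The space W^{1,p} and its embeddings *)

Section W1.
Variable R : realType.
Local Notation mu := (@leb3 R).
Implicit Types (u v w : R3 R -> R) (b c : R).

Variable p : R.
Hypothesis hp : (1 : R) < p < 3.
Let p1 : (1 : R) < p. Proof. by case/andP: hp. Qed.
Let p0 : (0 : R) < p. Proof. exact: lt_trans ltr01 p1. Qed.
Local Notation ps := (sobolev_conj p).
Let pps : p < ps. Proof. exact: sobolev_conj_gt. Qed.

Lemma W1_Lp u : W1 p u -> Lp mu p u.
Proof. by case=> /(Lfun_LpP mu _ p0). Qed.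

Lemma W1_grad u : W1 p u -> weak_grad_in p u. Proof. by case. Qed.

Lemma W1_Lpv u : W1 p u -> Lpv mu p (wgrad u).
Proof. by move=> /W1_grad; exact: weak_grad_Lpv. Qed.

Lemma W1_lin c u v : W1 p u -> W1 p v -> W1 p (fun x => c * u x + v x).
Proof.
move=> Wu Wv; split; last exact: (weak_grad_in_lin c p0 (W1_grad Wu) (W1_grad Wv)).
by apply/(Lfun_LpP mu _ p0); exact: (LpD p0 (LpZ c (W1_Lp Wu)) (W1_Lp Wv)).
Qed.

Lemma W1D u v : W1 p u -> W1 p v -> W1 p (u \+ v).
Proof.
move=> Wu Wv; have := W1_lin 1 Wu Wv; congr (W1 _ _).
by apply/funext => x /=; rewrite mul1r.
Qed.

(** Makes scaling an instance of the combinations c u + v for which gradients were already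
    computed. *)
Lemma W1_scaleE c u : (fun x => c * u x) = (fun x => (c - 1) * u x + u x).
Proof. by apply/funext => x; ring. Qed.

Lemma W1Z c u : W1 p u -> W1 p (fun x => c * u x).
Proof. by move=> Wu; rewrite W1_scaleE; exact: W1_lin. Qed.

Lemma W1_wgradZ c u : W1 p u -> {ae mu, forall x, wgrad (fun x => c * u x) x = (fun i => c * wgrad u x i)}.
Proof.
move=> Wu; rewrite W1_scaleE; apply: aeS (wgrad_lin_ae (c - 1) p0 (W1_grad Wu) (W1_grad Wu)) => x ->.
by apply/funext => i /=; ring.
Qed.

Lemma W1_wgradD u v : W1 p u -> W1 p v -> {ae mu, forall x, wgrad (u \+ v) x = wgrad u x \+ wgrad v x}.
Proof.
move=> Wu Wv; have -> : (u \+ v) = (fun x => 1 * u x + v x) by apply/funext => x; rewrite mul1r.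
apply: aeS (wgrad_lin_ae 1 p0 (W1_grad Wu) (W1_grad Wv)) => x ->.
by apply/funext => i /=; rewrite mul1r.
Qed.

Lemma W1_massE u : W1 p u -> \int[mu]_x (grad_norm u x `^ p + `|u x| `^ p) =
  Nv mu p (wgrad u) `^ p + Lpnorm mu p u `^ p.
Proof.
move=> Wu; rewrite (RintD (integrable_normv p0 (W1_Lpv Wu)) (W1_Lp Wu).2).
by rewrite (NvE _ _ p0) (Lpnorm_powR _ _ p0) LpmassE.
Qed.

Lemma W1norm_ge0 u : 0 <= W1norm p u. Proof. exact: powR_ge0. Qed.

Lemma W1norm_powR u : W1 p u -> W1norm p u `^ p = Nv mu p (wgrad u) `^ p + Lpnorm mu p u `^ p.
Proof.
move=> Wu; rewrite /W1norm -powRrM mulVf ?gt_eqF// W1_massE// powRr1//.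
by rewrite addr_ge0 ?powR_ge0.
Qed.

Lemma Nv_le_W1norm u : W1 p u -> Nv mu p (wgrad u) <= W1norm p u.
Proof.
move=> Wu; apply: (ler_powR_cancel p0 (Nv_ge0 _ _ _) (W1norm_ge0 u)).
by rewrite (W1norm_powR Wu) lerDl powR_ge0.
Qed.

Lemma Lpnorm_le_W1norm u : W1 p u -> Lpnorm mu p u <= W1norm p u.
Proof.
move=> Wu; apply: (ler_powR_cancel p0 (Lpnorm_ge0 _ _ _) (W1norm_ge0 u)).
by rewrite (W1norm_powR Wu) lerDr powR_ge0.
Qed.

Lemma W1normZ c u : W1 p u -> W1norm p (fun x => c * u x) = `|c| * W1norm p u.
Proof.
move=> Wu; have Wc := W1Z c Wu.
have En : Nv mu p (wgrad (fun x => c * u x)) = `|c| * Nv mu p (wgrad u).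
  rewrite -(NvZ c p0 (W1_Lpv Wu)); apply: Nv_ae; last exact: W1_wgradZ.
    exact: (Lpv_measurable (W1_Lpv Wc)).
  exact: (Lpv_measurable (LpvZ c (W1_Lpv Wu))).
have E : W1norm p (fun x => c * u x) `^ p = (`|c| * W1norm p u) `^ p.
  rewrite (W1norm_powR Wc) En (LpnormZ c p0 (W1_Lp Wu)).
  by rewrite !powRM ?Nv_ge0 ?Lpnorm_ge0 ?W1norm_ge0// (W1norm_powR Wu) mulrDr.
have N0 := W1norm_ge0 (fun x => c * u x).
have N1 : 0 <= `|c| * W1norm p u by exact: (mulr_ge0 (normr_ge0 c) (W1norm_ge0 u)).
by apply/eqP; rewrite eq_le (ler_powR_cancel p0 N0 N1) ?E// (ler_powR_cancel p0 N1 N0) ?E.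
Qed.

Lemma W1_embed b : p <= b <= ps -> exists2 K : R, 0 < K &
  forall u, W1 p u -> Lp mu b u /\ Lpnorm mu b u <= K * W1norm p u.
Proof.
move=> hb; have S0 := sobolev_const_ge0 hp.
exists (2 * (1 + sobolev_const p)); first by rewrite mulr_gt0// ltr_pwDl.
move=> u Wu; have Lu := W1_Lp Wu; have pp : 0 < p <= ps by rewrite p0 ltW.
have [Ls Ns] := sobolev hp pp Lu (W1_grad Wu).
split; first exact: (Lp_interp p0 hb Lu Ls).
apply/ler_addgt0Pl => e e0.
(* Interpolation asks for a positive t, while the norm of u may be 0; hence the slack e / 2, doubled
   to e at the end. *)
pose t := (1 + sobolev_const p) * W1norm p u + e / 2.
have W0 := W1norm_ge0 u.
have h1 : 0 <= sobolev_const p * W1norm p u by exact: mulr_ge0.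
have t0 : 0 < t by rewrite /t ltr_wpDl ?divr_gt0// mulr_ge0// addr_ge0.
have e2 : 0 <= e / 2 by rewrite divr_ge0// ltW.
have a1 : Lpnorm mu p u <= t.
  apply: le_trans (Lpnorm_le_W1norm Wu) _.
  by rewrite /t mulrDl mul1r -addrA lerDl addr_ge0.
have a2 : Lpnorm mu ps u <= t.
  apply: le_trans Ns _; rewrite -/(sobolev_const p).
  apply: le_trans (ler_wpM2l S0 (Nv_le_W1norm Wu)) _.
  by rewrite /t mulrDl mul1r addrAC lerDr addr_ge0.
apply: le_trans (Lpnorm_interp (ltW p1) hb Lu Ls t0 a1 a2) _.
rewrite le_eqVlt; apply/orP; left; apply/eqP; rewrite /t; by field.
Qed.

End W1.

(** * Derivative and critical points of the energy *)

Section Energy.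
Variable R : realType.
Local Notation mu := (@leb3 R).
Implicit Types (u v w phi : R3 R -> R).
Variables (p q s r lambda : R).
Hypothesis hp : (1 : R) < p < 3.
Hypothesis hq : (1 : R) < q < 3.
Hypothesis s1 : 1 < s.
Hypothesis hs : (sobolev_conj q - 1) * p / sobolev_conj q < s
        < (sobolev_conj q - 1) * sobolev_conj p / sobolev_conj q.
Hypothesis hr : p < r < sobolev_conj p.
Let p1 : (1 : R) < p. Proof. by case/andP: hp. Qed.
Let p0 : (0 : R) < p. Proof. exact: lt_trans ltr01 p1. Qed.
Let q0 : (0 : R) < q. Proof. by case/andP: hq => /(lt_trans ltr01). Qed.
Let s0 : (0 : R) < s. Proof. exact: lt_trans ltr01 s1. Qed.
Let r1 : (1 : R) < r. Proof. by case/andP: hr => h _; exact: lt_trans p1 h. Qed.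
Let r0 : (0 : R) < r. Proof. exact: lt_trans ltr01 r1. Qed.
Local Notation ps := (sobolev_conj p).
Local Notation qs := (sobolev_conj q).
Local Notation qd := (dual_exp q).
Let qs1 : (1 : R) < qs.
Proof. by case/andP: (hq) => h _; exact: lt_trans h (sobolev_conj_gt hq). Qed.
Let qs0 : (0 : R) < qs. Proof. exact: lt_trans ltr01 qs1. Qed.
Let qd0 : (0 : R) < qd. Proof. exact: dual_exp_gt0. Qed.
Let qd1 : (1 : R) <= qd.
Proof. by rewrite /dual_exp ler_pdivlMr ?subr_gt0// mul1r lerBlDr lerDl. Qed.
Let qdP : qd^-1 + qs^-1 = 1. Proof. exact: dual_expP. Qed.
Let hsd : p <= s * qd <= ps.
Proof.
case/andP: hs => h1 h2; have qs10 : 0 < qs - 1 by rewrite subr_gt0.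
rewrite /dual_exp mulrA; apply/andP; split.
  by rewrite ler_pdivlMr// mulrC -ler_pdivrMr// ltW.
by rewrite ler_pdivrMr// [ps * _]mulrC -ler_pdivlMr// ltW.
Qed.
Let hrp : p <= r <= ps. Proof. by case/andP: hr => h1 h2; rewrite !ltW. Qed.
Let hpp : p <= p <= ps. Proof. by rewrite lexx ltW// sobolev_conj_gt. Qed.

Lemma W1_Lp_sd u : W1 p u -> Lp mu (s * qd) u.
Proof. by move=> Wu; have [K _ /(_ u Wu)[]] := W1_embed hp hsd. Qed.

Lemma W1_Lp_r u : W1 p u -> Lp mu r u.
Proof. by move=> Wu; have [K _ /(_ u Wu)[]] := W1_embed hp hrp. Qed.

Lemma W1_source u : W1 p u -> Lp mu qd (fun x => `|u x| `^ s).
Proof. by move=> Wu; apply: Lp_abs_powR s0 (W1_Lp_sd Wu). Qed.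

(** Existence shows that the set described in [phi_sol] is inhabited, so the description never falls
    back to its default value 0. *)
Lemma phi_solP u : W1 p u -> D1 q (phi_sol q s u) /\ poisson q (fun x => `|u x| `^ s) (phi_sol q s u).
Proof.
move=> Wu; have [phi Dphi Pphi] := poisson_exists hq (W1_source Wu).
by have := @xgetPex _ (cst 0) [set phi | D1 q phi /\ poisson_weak q s u phi]; apply; exists phi.
Qed.

Lemma phi_sol_unique u phi : W1 p u -> D1 q phi -> poisson q (fun x => `|u x| `^ s) phi ->
  phi = phi_sol q s u %[ae mu].
Proof.
by move=> Wu Dphi P; have [D' P'] := phi_solP Wu; exact: (poisson_unique hq (W1_source Wu) Dphi D' P P').
Qed.

Definition energy_deriv u phi v : R :=
  \int[mu]_x (grad_norm u x `^ (p - 2) * grad_dot u v x + `|u x| `^ (p - 2) * u x * v x)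
  + lambda * \int[mu]_x (phi x * `|u x| `^ (s - 2) * u x * v x)
  - \int[mu]_x (`|u x| `^ (r - 2) * u x * v x).

Lemma energy_derivE u phi v : W1 p u -> W1 p v -> energy_deriv u phi v =
  \int[mu]_x (normv (wgrad u x) `^ (p - 2) * dotv (wgrad u x) (wgrad v x))
  + \int[mu]_x (`|u x| `^ (p - 2) * (u x * v x))
  + lambda * \int[mu]_x (`|u x| `^ (s - 2) * (u x * v x) * phi x)
  - \int[mu]_x (`|u x| `^ (r - 2) * (u x * v x)).
Proof.
move=> Wu Wv; have i1 := integrable_pow_dotv p1 (W1_Lpv hp Wu) (W1_Lpv hp Wv).
have i2 := integrable_pow_mul p1 (W1_Lp hp Wu) (W1_Lp hp Wv).
rewrite -(RintD i1 i2) /energy_deriv; congr (_ + _ * _ - _).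
- by apply: eq_Rintegral => x _; rewrite -mulrA.
- by apply: eq_Rintegral => x _; rewrite mulrC -!mulrA; ring.
- by apply: eq_Rintegral => x _; rewrite -mulrA.
Qed.

(** Homogeneity is what later turns a little-o bound near 0 into a statement about a fixed
    direction. *)
Lemma energy_derivZ u phi v c : W1 p u -> D1 q phi -> W1 p v ->
  energy_deriv u phi (fun x => c * v x) = c * energy_deriv u phi v.
Proof.
move=> Wu Dphi Wv; have Wc := W1Z hp c Wv; rewrite !energy_derivE// mulrBr !mulrDr.
have i1 := integrable_pow_dotv p1 (W1_Lpv hp Wu) (W1_Lpv hp Wv).
have i2 := integrable_pow_mul p1 (W1_Lp hp Wu) (W1_Lp hp Wv).
have i3 := hoelder_integrableR qd0 qs0 qdP (Lp_pow_mul s1 qd0 (W1_Lp_sd Wu) (W1_Lp_sd Wv)) (D1_Lp hq Dphi).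
have i4 := integrable_pow_mul r1 (W1_Lp_r Wu) (W1_Lp_r Wv).
rewrite -(RintZ c i1) -(RintZ c i2) [c * (lambda * _)]mulrCA -(RintZ c i3) -(RintZ c i4).
congr (_ + _ + _ * _ - _).
- apply: ae_eq_Rintegral.
  + exact: integrableR_measurable (integrable_pow_dotv p1 (W1_Lpv hp Wu) (W1_Lpv hp Wc)).
  + exact: integrableR_measurable (integrableRZ c i1).
  by apply: aeS (W1_wgradZ hp c Wv) => x -> _; rewrite dotvZr mulrCA.
- by apply: eq_Rintegral => x _; ring.
- by apply: eq_Rintegral => x _; ring.
- by apply: eq_Rintegral => x _; ring.
Qed.

Lemma energyE u : W1 p u -> energy p q s r lambda u =
  p^-1 * (Nv mu p (wgrad u) `^ p + Lpnorm mu p u `^ p)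
  + lambda / s * ((1 - q^-1) * \int[mu]_x (`|u x| `^ s * phi_sol q s u x))
  - r^-1 * Lpnorm mu r u `^ r.
Proof.
move=> Wu; rewrite /energy (W1_massE hp Wu) (Lpnorm_powR _ _ r0) LpmassE.
congr (_ + _ - _); rewrite mulrA; congr (_ * _).
  by field; rewrite !gt_eqF.
by apply: eq_Rintegral => x _; rewrite mulrC.
Qed.

Let N0 v : 0 <= W1norm p v. Proof. exact: W1norm_ge0. Qed.
Local Notation o := (little_o (W1 p) (W1norm p)).

Lemma gradient_differentiable u : W1 p u -> o (fun v =>
  Nv mu p (wgrad (u \+ v)) `^ p - Nv mu p (wgrad u) `^ p
  - p * \int[mu]_x (normv (wgrad u x) `^ (p - 2) * dotv (wgrad u x) (wgrad v x))).
Proof.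
move=> Wu; apply: (little_o_taylor N0 p1 (powR_ge0 (Nv mu p (wgrad u)) (p - 1)) ler01
  (M := fun v => Nv mu p (wgrad v))) => [v Wv|e e0].
  by rewrite mul1r Nv_ge0; exact: Nv_le_W1norm.
have [C C0 HC] := @vec_taylor _ _ R mu 3 p e p1 e0; exists C => // v Wv.
have -> : Nv mu p (wgrad (u \+ v)) = Nv mu p (fun x => wgrad u x \+ wgrad v x).
  apply: Nv_ae; last exact: (W1_wgradD hp Wu Wv).
    exact: (Lpv_measurable (W1_Lpv hp (W1D hp Wu Wv))).
  exact: (Lpv_measurable (LpvD p0 (W1_Lpv hp Wu) (W1_Lpv hp Wv))).
exact: HC (W1_Lpv hp Wu) (W1_Lpv hp Wv).
Qed.

Lemma power_differentiable b u : 1 < b -> p <= b <= ps -> W1 p u -> o (fun v =>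
  Lpnorm mu b (u \+ v) `^ b - Lpnorm mu b u `^ b - b * \int[mu]_x (`|u x| `^ (b - 2) * (u x * v x))).
Proof.
move=> b1 hb Wu; have [K K0 HK] := W1_embed hp hb.
apply: (little_o_taylor N0 b1 (powR_ge0 (Lpnorm mu b u) (b - 1)) (ltW K0)
  (M := fun v => Lpnorm mu b v)) => [v Wv|e e0].
  by rewrite Lpnorm_ge0; exact: (HK v Wv).2.
have [C C0 HC] := @scalar_taylor _ _ R mu b e b1 e0; exists C => // v Wv.
exact: HC (HK u Wu).1 (HK v Wv).1.
Qed.

(** Two little-o errors with the potential frozen at phi_u: the envelope bound replaces the change
    of the nonlocal term by the integral of (|u + v|^s - |u|^s) phi_u, and the weighted Taylor bound
    linearizes that integral in v. *)
Lemma nonlocal_differentiable u : W1 p u -> o (fun v =>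
  (1 - q^-1) * \int[mu]_x (`|u x + v x| `^ s * phi_sol q s (u \+ v) x)
  - (1 - q^-1) * \int[mu]_x (`|u x| `^ s * phi_sol q s u x)
  - s * \int[mu]_x (`|u x| `^ (s - 2) * (u x * v x) * phi_sol q s u x)).
Proof.
move=> Wu; have [Dphi Pphi] := phi_solP Wu; set phi := phi_sol q s u in Dphi Pphi *.
have Lu := W1_Lp_sd Wu; have [K K0 HK] := W1_embed hp hsd.
set A := Lpnorm mu (s * qd) u `^ (s - 1); have A0 : 0 <= A by exact: powR_ge0.
pose g v x : R := `|u x + v x| `^ s - `|u x| `^ s.
have HM v : W1 p v -> 0 <= Lpnorm mu (s * qd) v <= K * W1norm p v.
  by move=> Wv; rewrite Lpnorm_ge0; exact: (HK v Wv).2.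
have oT : o (fun v => \int[mu]_x (g v x * phi x) - s * \int[mu]_x (`|u x| `^ (s - 2) * (u x * v x) * phi x)).
  apply: (little_o_taylor N0 s1 A0 (ltW K0) HM) => e e0.
  have [C C0 HC] := weighted_taylor s1 qd0 qd1 qs0 qdP Lu (D1_Lp hq Dphi) e0.
  by exists C => // v Wv; exact: HC (W1_Lp_sd Wv).
have oE : o (fun v => (1 - q^-1) * \int[mu]_x (`|u x + v x| `^ s * phi_sol q s (u \+ v) x)
    - (1 - q^-1) * \int[mu]_x (`|u x| `^ s * phi x) - \int[mu]_x (g v x * phi x)).
  have [C C0 HC] := Lpnorm_pow_sub_le mu s1 qd0 qd1.
  have Ks0 : 0 <= K `^ s by exact: powR_ge0.
  (* For W^{1,p} norm at most 1 its s-th power is at most the norm itself, which gives this constant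
     for the change of the load. *)
  apply: (little_o_comp N0 (h := fun v => Lpnorm mu qd (g v)) (K := C * (A * K + K `^ s))).
  - apply: mulr_ge0; [exact: ltW|apply: addr_ge0 => //; exact: mulr_ge0 A0 (ltW K0)].
  - move=> v Wv v1; apply: le_trans (HC u v Lu (W1_Lp_sd Wv)) _.
    have /andP[M0 MK] := HM v Wv.
    rewrite -mulrA; apply: ler_wpM2l; first exact: ltW.
    rewrite mulrDl; apply: lerD; first by rewrite -mulrA; exact: ler_wpM2l.
    apply: (@le_trans _ _ ((K * W1norm p v) `^ s)).
      by apply: ge0_ler_powR; rewrite ?nnegrE ?(ltW s0)//; apply: mulr_ge0 => //; exact: ltW.
    rewrite powRM ?(ltW K0)//; apply: ler_wpM2l => //.
    rewrite -(mulr_powRB1 (N0 v) s0); apply: ler_piMr => //.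
    have : W1norm p v `^ (s - 1) <= 1 `^ (s - 1).
      by apply: ge0_ler_powR; rewrite ?nnegrE ?subr_ge0 ?(ltW s1).
    by rewrite powR1.
  move=> e e0; have [d d0 Hd] := poisson_envelope_small hq (W1_source Wu) Dphi Pphi e0.
  exists d => // v Wv hd; have Wuv := W1D hp Wu Wv; have [D' P'] := phi_solP Wuv.
  exact: (Hd _ _ (W1_source Wuv) D' P' hd).
apply: little_o_le (little_oD oE oT) => v Wv.
by rewrite addrA subrK.
Qed.

Lemma energy_differentiable u : W1 p u -> o (fun v =>
  energy p q s r lambda (u \+ v) - energy p q s r lambda u - energy_deriv u (phi_sol q s u) v).
Proof.
move=> Wu.
have o1 := little_oZ N0 p^-1 (little_oD (gradient_differentiable Wu) (power_differentiable p1 hpp Wu)).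
have o2 := little_oZ N0 (lambda / s) (nonlocal_differentiable Wu).
have o3 := little_oZ N0 (- r^-1) (power_differentiable r1 hrp Wu).
apply: little_o_le (little_oD (little_oD o1 o2) o3) => v Wv.
rewrite (energyE (W1D hp Wu Wv)) (energyE Wu) (energy_derivE _ Wu Wv).
rewrite le_eqVlt; apply/orP; left; apply/eqP; congr `|_|.
exact: (energy_arith _ _ _ _ _ _ _ _ _ _ _ _ _ (lt0r_neq0 p0) (lt0r_neq0 s0) (lt0r_neq0 r0)).
Qed.

Lemma schrodinger_weakE u phi : schrodinger_weak p s r lambda u phi <->
  forall v, W1 p v -> energy_deriv u phi v = 0.
Proof.
split=> H v Wv; first by apply/eqP; rewrite subr_eq0; apply/eqP; exact: H.
by apply/eqP; rewrite -subr_eq0; apply/eqP; exact: H.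
Qed.

Lemma energy_deriv_ae u phi psi v : W1 p u -> W1 p v -> D1 q phi -> D1 q psi ->
  phi = psi %[ae mu] -> energy_deriv u phi v = energy_deriv u psi v.
Proof.
move=> Wu Wv D1 D2 E; rewrite !energy_derivE//; congr (_ + _ * _ - _).
have L := Lp_pow_mul s1 qd0 (W1_Lp_sd Wu) (W1_Lp_sd Wv).
apply: ae_eq_Rintegral.
- exact: integrableR_measurable (hoelder_integrableR qd0 qs0 qdP L (D1_Lp hq D1)).
- exact: integrableR_measurable (hoelder_integrableR qd0 qs0 qdP L (D1_Lp hq D2)).
by apply: aeS E => x /(_ I) ->.
Qed.

(** If 0 is a derivative, subtracting the two expansions shows that [energy_deriv] is itself
    little-o of the norm; being homogeneous, it vanishes. The converse is the expansion itself. *)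
Lemma critical_pointP u : W1 p u -> critical_point p (energy p q s r lambda) u <->
  forall v, W1 p v -> energy_deriv u (phi_sol q s u) v = 0.
Proof.
move=> Wu; have oL := energy_differentiable Wu; have [Dphi Pphi] := phi_solP Wu; split.
  move=> [_ [_ _ H]] v Wv; apply/eqP; rewrite -normr_le0; apply/ler_addgt0Pl => e e0; rewrite addr0.
  have o0 : o (fun v => energy p q s r lambda (u \+ v) - energy p q s r lambda u).
    by move=> e' e'0; have [d d0 Hd] := H e' e'0; exists d => // w Ww wd; have := Hd w Ww wd; rewrite subr0.
  have oD : o (fun v => energy_deriv u (phi_sol q s u) v).
    apply: little_o_le (little_oD o0 (little_oZ N0 (-1) oL)) => w Ww.
    by rewrite mulN1r subKr.
  have e1 : 0 < W1norm p v + 1 by rewrite ltr_wpDl.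
  have [d d0 Hd] := oD (e / (W1norm p v + 1)) (divr_gt0 e0 e1).
  (* Scales v into the ball of radius d; the factor t then cancels from both sides by
     homogeneity. *)
  pose t := d / (W1norm p v + 1); have t0 : 0 < t by exact: divr_gt0.
  have td : W1norm p (fun x => t * v x) < d.
    rewrite (W1normZ hp t Wv) gtr0_norm// /t mulrAC ltr_pdivrMr// ltr_pM2l// ltrDl//.
  have := Hd _ (W1Z hp t Wv) td.
  rewrite (W1normZ hp t Wv) (energy_derivZ t Wu Dphi Wv) normrM (gtr0_norm t0).
  rewrite mulrCA ler_pM2l// => /le_trans; apply.
  by rewrite mulrAC ler_pdivrMr// ler_pM2l// lerDl.
move=> H; split=> //; split.
- by move=> *; rewrite mulr0 addr0.
- by exists 0 => v _; rewrite normr0 mul0r.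
move=> e e0; have [d d0 Hd] := oL e e0; exists d => // v Wv vd.
by rewrite -(H v Wv); exact: Hd.
Qed.

End Energy.

Theorem proposition2p4 (R : realType) (p q s r lambda : R)
  (hp : 1 < p < 3)
  (hq : Num.max 1 (3 * p / (5 * p - 3)) < q < 3)
  (hs : Num.max 1 ((sobolev_conj q - 1) * p / sobolev_conj q) < s
        < (sobolev_conj q - 1) * sobolev_conj p / sobolev_conj q)
  (hr : p < r < sobolev_conj p)
  (hlambda : 0 < lambda)
  (u phi : R3 R -> R) (hu : W1 p u) (hphi : D1 q phi) :
  system_solution p q s r lambda u phi <->
  critical_point p (energy p q s r lambda) u
  /\ (phi = phi_sol q s u %[ae leb3]).
Proof.
have hq' : 1 < q < 3 by case/andP: hq; rewrite gt_max => /andP[-> _] ->.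
have [s1 hs'] : 1 < s /\ (sobolev_conj q - 1) * p / sobolev_conj q < s
        < (sobolev_conj q - 1) * sobolev_conj p / sobolev_conj q.
  by case/andP: hs; rewrite gt_max => /andP[-> ->] ->.
have [Dsol Psol] := phi_solP hp hq' s1 hs' hu.
(* [phi] agrees with the chosen solution only almost everywhere, so both equations have to be
   carried across a null set: the first here, the second by [poisson_ae]. *)
have transfer v : phi = phi_sol q s u %[ae leb3] -> W1 p v ->
    energy_deriv p s r lambda u phi v = energy_deriv p s r lambda u (phi_sol q s u) v.
  by move=> E Wv; exact: (energy_deriv_ae r lambda hp hq' s1 hs' hu Wv hphi Dsol E).
split.
  move=> [_ _ /schrodinger_weakE Hu Hphi].
  have E := phi_sol_unique hp hq' s1 hs' hu hphi Hphi; split=> //.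
  apply/(critical_pointP lambda hp hq' s1 hs' hr hu) => v Wv.
  by rewrite -(transfer v E Wv); exact: Hu.
move=> [/(critical_pointP lambda hp hq' s1 hs' hr hu) H E]; split; [exact: hu|exact: hphi| |].
  by apply/schrodinger_weakE => v Wv; rewrite (transfer v E Wv); exact: H.
apply: (poisson_ae hq' Dsol _ _ Psol); first exact: (D1_Lp hq' hphi).1.
by apply: aeS E => x phix _; rewrite phix.
Qed.
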